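(* Let $G=PGL_3$ be split over $F=\mathbb{F}_q((\epsilon))$ and let $\tau\in G(L)$ be the length $0$ element described in the context. Then for any $\tilde w\in\widetilde W$, $$\sharp X_{\tilde w}(\tau)(\mathbb{F}_q)=\begin{cases}3q^{\frac{\ell(\tilde w)}{2}},&\tilde w\in\mathbb{O}_{id,\tau},\\ 3\left\lceil\frac{\ell(\tilde w)-6i+3}{4}\right\rceil q^{\frac{\ell(\tilde w)-1}{2}}(q-1),&\tilde w\in\mathbb{O}_{i,\tau},\ i\in\mathbb{N}_+\text{ and }\ell(\tilde w)\geq6i-1,\\ 3\left\lceil\frac{\ell(\tilde w)-6i+1}{4}\right\rceil q^{\frac{\ell(\tilde w)-1}{2}}(q-1),&\tilde w\in\mathbb{O}_{1-i,\tau},\ i\in\mathbb{N}_+\text{ and }\ell(\tilde w)\geq6i+1,\\ 0,&\text{otherwise.}\end{cases}$$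
   Context: $\mathbf{k}$ is an algebraic closure of $\mathbb{F}_q$, $L=\mathbf{k}((\epsilon))$, $\sigma$ is the Frobenius on $G(L)$, $I\subset G(L)$ is a $\sigma$-stable Iwahori subgroup corresponding to the base alcove, and elements of the Iwahori–Weyl group $\widetilde W$ are identified with ($\sigma$-fixed) representatives in $G(L)$. $X_{\tilde w}(b)=\{gI\in G(L)/I\mid g^{-1}b\sigma(g)\in I\tilde wI\}$, and $X_{\tilde w}(\tau)(\mathbb{F}_q)$ is its set of $\mathbb{F}_q$-rational ($\sigma$-fixed) points. $W=\langle s_1,s_2\rangle$ is the finite Weyl group of type $A_2$; $\alpha_1,\alpha_2$ are the simple roots, identified with the simple coroots ($\langle\alpha_i,\alpha_i\rangle=2$, $\langle\alpha_1,\alpha_2\rangle=-1$); $Q=\mathbb{Z}\alpha_1\oplus\mathbb{Z}\alpha_2$; $P$ is the coweight lattice; $\widetilde W=P\rtimes W$ with translations $t^\lambda$. $W_a=Q\rtimes W$ is the Coxeter group generated by $s_0=t^{\alpha_1+\alpha_2}s_1s_2s_1$, $s_1$, $s_2$; $\widetilde W=W_a\rtimes\langle\tau\rangle$ with $\tau^3=1$, $\tau s_0\tau^{-1}=s_1$, $\tau s_1\tau^{-1}=s_2$, $\tau s_2\tau^{-1}=s_0$, i.e. $\tau=t^{(2\alpha_1+\alpha_2)/3}s_1s_2$; $\ell$ extends the length of $W_a$ by $\ell(w\tau^j)=\ell(w)$. $\mathbb{N}_+$ is the set of positive integers. $\widetilde W$-conjugacy classes: $\mathbb{O}_{id,\tau}=\{t^{m\alpha_1+n\alpha_2}\tau,\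 t^{m\alpha_1+n\alpha_2}s_1s_2\tau\mid m,n\in\mathbb{Z}\}$; for $i\in\mathbb{Z}$, $\mathbb{O}_{i,\tau}=\{t^{k\alpha_1+i\alpha_2}s_1s_2s_1\tau,\ t^{(k+i-1)\alpha_1+k\alpha_2}s_2\tau,\ t^{(1-i)\alpha_1+k\alpha_2}s_1\tau\mid k\in\mathbb{Z}\}$. *)

(* Defs.v *)
From HB Require Import structures.
From mathcomp Require Import all_boot all_order all_algebra.
From mathcomp Require Import generic_quotient fingroup perm finfield.
From mathcomp Require Import boolp classical_sets functions cardinality fsbigop.
From mathcomp Require Import ring zify.
Set Implicit Arguments.
Unset Strict Implicit.
Unset Printing Implicit Defensive.
Import Order.TTheory GRing.Theory Num.Theory.
Local Open Scope quotient_scope.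
Local Open Scope classical_set_scope.
Local Open Scope ring_scope.

Record laurent (K : fieldType) := Laurent {
  lcoef :> int -> K;
  laurentP : exists N : int, forall n, n < N -> lcoef n = 0 }.

HB.instance Definition _ (K : fieldType) := gen_eqMixin (laurent K).
HB.instance Definition _ (K : fieldType) := gen_choiceMixin (laurent K).

Section LaurentRing.
Variable K : fieldType.
Implicit Types f g h : laurent K.

Definition vanish_below (a : int) (f : int -> K) := forall n, n < a -> f n = 0.

Lemma laurent_eq f g : (forall n, f n = g n) -> f = g.
Proof.
case: f g => [f fP] [g gP] /= /funext fg; rewrite fg in fP *.
by congr Laurent; exact: Prop_irrelevance.
Qed.

Lemma vanish_belowW a b (f : int -> K) :
  b <= a -> vanish_below a f -> vanish_below b f.
Proof. by move=> ba fa n nb; apply: fa; exact: lt_le_trans ba. Qed.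

Lemma laurent_bound f : exists a, vanish_below a f.
Proof. exact: laurentP. Qed.

Definition ladd_coef f g n := f n + g n.
Definition lopp_coef f n := - f n.
Definition lconst_coef (c : K) (n : int) : K := if n == 0 then c else 0.
Definition lmul_coef f g n := \sum_(i \in [set: int]) f i * g (n - i).

Lemma ladd_subproof f g : exists a, vanish_below a (ladd_coef f g).
Proof.
have [[a fa] [b gb]] := (laurent_bound f, laurent_bound g).
exists (Order.min a b) => n; rewrite lt_min => /andP[na nb].
by rewrite /ladd_coef fa // gb // addr0.
Qed.

Lemma lopp_subproof f : exists a, vanish_below a (lopp_coef f).
Proof.
by have [a fa] := laurent_bound f; exists a => n /fa; rewrite /lopp_coef => ->; rewrite oppr0.
Qed.

Lemma lconst_subproof c : exists a, vanish_below a (lconst_coef c).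
Proof. by exists 0 => n n0; rewrite /lconst_coef lt_eqF. Qed.

Lemma lmul_coef_lt f g a b n : vanish_below a f -> vanish_below b g ->
  n < a + b -> lmul_coef f g n = 0.
Proof.
move=> fa gb nab; apply: fsbig1 => i _.
have [ia|ai] := ltP i a; first by rewrite fa // mul0r.
by rewrite gb ?mulr0 // ltrBlDl (lt_le_trans nab) // lerD2r.
Qed.

Lemma lmul_coefE f g a b (m : nat) : vanish_below a f -> vanish_below b g ->
  lmul_coef f g (a + b + m%:Z) =
  \sum_(i < m.+1) f (a + i%:Z) * g (b + (m - i)%N%:Z).
Proof.
move=> fa gb; rewrite /lmul_coef.
pose r : seq int := [seq a + i%:Z | i <- iota 0 m.+1].
have r_uniq : uniq r.
  by rewrite map_inj_uniq ?iota_uniq // => i j /addrI [].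
rewrite -(fsbig_widen [set` r] setT) //; last first.
  move=> i [_ /= ir]; have [ia|ai] := ltP i a; first by rewrite fa // mul0r.
  rewrite gb ?mulr0 // ltNge; apply: contra_notN ir => bi.
  by apply/mapP; exists `|i - a|%N; [rewrite mem_iota; lia|lia].
rewrite -fsbig_seq // big_map -/(index_iota 0 m.+1) big_mkord.
apply: eq_bigr => i _; congr (_ * g _).
by have := ltn_ord i; lia.
Qed.

Lemma lmul_subproof f g : exists a, vanish_below a (lmul_coef f g).
Proof.
have [[a fa] [b gb]] := (laurent_bound f, laurent_bound g).
by exists (a + b) => n; exact: lmul_coef_lt.
Qed.

Definition ladd f g := Laurent (ladd_subproof f g).
Definition lopp f := Laurent (lopp_subproof f).
Definition lconst c := Laurent (lconst_subproof c).
Definition lmul f g := Laurent (lmul_subproof f g).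

Lemma lmul_vanish f g a b :
  vanish_below a f -> vanish_below b g -> vanish_below (a + b) (lmul f g).
Proof. by move=> fa gb n; exact: lmul_coef_lt. Qed.

Lemma laddA : associative ladd.
Proof. by move=> f g h; apply: laurent_eq => n; exact: addrA. Qed.

Lemma laddC : commutative ladd.
Proof. by move=> f g; apply: laurent_eq => n; exact: addrC. Qed.

Lemma ladd0 : left_id (lconst 0) ladd.
Proof.
move=> f; apply: laurent_eq => n.
by rewrite /= /ladd_coef /= /lconst_coef if_same add0r.
Qed.

Lemma laddN : left_inverse (lconst 0) lopp ladd.
Proof.
move=> f; apply: laurent_eq => n.
by rewrite /= /ladd_coef /= /lconst_coef /lopp_coef if_same addNr.
Qed.

HB.instance Definition _ :=
  GRing.isZmodule.Build (laurent K) laddA laddC ladd0 laddN.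

Definition ltrunc (a : int) (m : nat) f : {poly K} := \poly_(i < m.+1) f (a + i%:Z).

Lemma lmul_coefP f g a b (m p : nat) : (m <= p)%N ->
  vanish_below a f -> vanish_below b g ->
  lmul f g (a + b + m%:Z) = (ltrunc a p f * ltrunc b p g)`_m.
Proof.
move=> mp fa gb; rewrite /= (lmul_coefE _ fa gb) coefM.
apply: eq_bigr => i _; have im := ltn_ord i; rewrite !coef_poly !ifT //; lia.
Qed.

Lemma ltrunc_mul f g a b (m p : nat) : (m <= p)%N ->
  vanish_below a f -> vanish_below b g ->
  (ltrunc (a + b) p (lmul f g))`_m = (ltrunc a p f * ltrunc b p g)`_m.
Proof.
by move=> mp fa gb; rewrite coef_poly ltnS mp; exact: lmul_coefP.
Qed.

Lemma laurent_eq_from a f g : vanish_below a f -> vanish_below a g ->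
  (forall m : nat, f (a + m%:Z) = g (a + m%:Z)) -> f = g.
Proof.
move=> fa ga fg; apply: laurent_eq => n; have [na|an] := ltP n a.
  by rewrite fa // ga.
by have := fg `|n - a|%N; suff -> : a + `|n - a|%N%:Z = n by []; lia.
Qed.

Lemma lmulC : commutative lmul.
Proof.
move=> f g; have [[a fa] [b gb]] := (laurent_bound f, laurent_bound g).
apply: (@laurent_eq_from (a + b)); first exact: lmul_vanish.
  by rewrite (addrC a); exact: lmul_vanish.
move=> m; rewrite (lmul_coefP (leqnn m) fa gb) (addrC a).
by rewrite (lmul_coefP (leqnn m) gb fa) mulrC.
Qed.

Lemma lmulA : associative lmul.
Proof.
move=> f g h; have [a fa] := laurent_bound f.
have [[b gb] [c hc]] := (laurent_bound g, laurent_bound h).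
have fgab : vanish_below (a + b) (lmul f g) by exact: lmul_vanish.
have ghbc : vanish_below (b + c) (lmul g h) by exact: lmul_vanish.
apply: (@laurent_eq_from (a + b + c)).
- by rewrite -addrA; exact: lmul_vanish.
- exact: lmul_vanish.
move=> m; rewrite (lmul_coefP (leqnn m) fgab hc) -(addrA a).
rewrite (lmul_coefP (leqnn m) fa ghbc).
transitivity (ltrunc a m f * (ltrunc b m g * ltrunc c m h))`_m.
  rewrite !coefM; apply: eq_bigr => i _; congr (_ * _).
  by apply: ltrunc_mul => //; rewrite leq_subr.
rewrite mulrA !coefM; apply: eq_bigr => i _; congr (_ * _).
by apply/esym/ltrunc_mul => //; rewrite -ltnS.
Qed.

Lemma lmul1 : left_id (lconst 1) lmul.
Proof.
move=> f; have [a fa] := laurent_bound f.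
have v1 : vanish_below 0 (lconst 1) by move=> n n0; rewrite /= /lconst_coef lt_eqF.
apply: (@laurent_eq_from a) => //.
  by rewrite -[a]add0r; exact: lmul_vanish.
move=> m; have := lmul_coefE m v1 fa; rewrite add0r /= => ->.
rewrite big_ord_recl big1 /= ?addr0 ?subn0 ?/lconst_coef ?add0r ?eqxx ?mul1r //.
by move=> i _; rewrite add0r /= mul0r.
Qed.

Lemma lmulDl : left_distributive lmul ladd.
Proof.
move=> f g h; apply: laurent_eq => n.
have [[a fa] [b gb]] := (laurent_bound f, laurent_bound g).
have [d hd] := laurent_bound h.
have [c ca cb] : exists2 c : int, c <= a & c <= b.
  by exists (Order.min a b); rewrite ge_min lexx // orbT.
have [fc gc] := (vanish_belowW ca fa, vanish_belowW cb gb).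
have fgc : vanish_below c (ladd f g).
  by move=> i ic; rewrite /= /ladd_coef fc // gc // addr0.
rewrite /= /ladd_coef /=; have [ncd|cdn] := ltP n (c + d).
  by rewrite !(lmul_coef_lt _ hd ncd) // addr0.
have -> : n = c + d + (absz (n - (c + d))%R)%:Z by lia.
rewrite (lmul_coefE _ fgc hd) (lmul_coefE _ fc hd) (lmul_coefE _ gc hd).
by rewrite -big_split; apply: eq_bigr => i _; rewrite /= /ladd_coef mulrDl.
Qed.

Lemma lone_neq0 : lconst 1 != 0.
Proof.
apply/eqP => /(congr1 (fun f => lcoef f 0)); rewrite /= /lconst_coef eqxx.
by move/eqP; rewrite oner_eq0.
Qed.

HB.instance Definition _ :=
  GRing.Zmodule_isComNzRing.Build (laurent K) lmulA lmulC lmul1 lmulDl lone_neq0.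

Section Inverse.
Variables (f : laurent K) (v : int).
Hypotheses (fv : vanish_below v f) (fv0 : f v != 0).

Fixpoint linv_seq (n : nat) : seq K :=
  if n is m.+1 then
    let s := linv_seq m in
    rcons s ((f v)^-1 * ((m == 0)%:R - \sum_(i < m) s`_i * f (v + (m - i)%N%:Z)))
  else [::].

Definition linv_nth n := (linv_seq n.+1)`_n.

Lemma size_linv_seq n : size (linv_seq n) = n.
Proof. by elim: n => //= n IH; rewrite size_rcons IH. Qed.

Lemma nth_linv_seq n m : (n < m)%N -> (linv_seq m)`_n = linv_nth n.
Proof.
elim: m => // m IH; rewrite ltnS leq_eqVlt => /orP[/eqP -> //|nm].
by rewrite /= nth_rcons size_linv_seq nm IH.
Qed.

Lemma linv_nthE m :
  \sum_(i < m.+1) linv_nth i * f (v + (m - i)%N%:Z) = (m == 0)%:R.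
Proof.
rewrite big_ord_recr /= subnn addr0 {2}/linv_nth /= nth_rcons size_linv_seq.
rewrite ltnn eqxx mulrAC mulVf // mul1r.
under [X in _ - X]eq_bigr => i _ do rewrite nth_linv_seq //.
by rewrite addrC subrK.
Qed.

Definition linv_coef (n : int) : K := if n < - v then 0 else linv_nth (absz (n + v)%R).

Lemma linv_subproof : exists a, vanish_below a linv_coef.
Proof. by exists (- v) => n nv; rewrite /linv_coef nv. Qed.

Lemma linvP : exists g, g * f = 1.
Proof.
pose g := Laurent linv_subproof; exists g.
have gv : vanish_below (- v) g by move=> n nv; rewrite /= /linv_coef nv.
have v1 : vanish_below 0 (lconst 1) by move=> n n0; rewrite /= /lconst_coef lt_eqF.
apply: (@laurent_eq_from 0) => //.
  by rewrite -(addNr v); exact: lmul_vanish.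
move=> m; rewrite -{1}(addNr v); have /= -> := lmul_coefE m gv fv.
rewrite /lconst_coef add0r -[RHS]/(if m == 0%N then 1 else 0).
transitivity ((m == 0)%:R : K); last by case: m.
rewrite -linv_nthE; apply: eq_bigr => i _; congr (_ * _).
by rewrite /linv_coef ifF; [congr linv_nth; lia | lia].
Qed.

End Inverse.

Lemma laurent_inv_ex f : f != 0 -> exists g, g * f = 1.
Proof.
move=> /eqP f0; have [a fa] := laurent_bound f.
have ex : exists m : nat, f (a + m%:Z) != 0.
  apply: contrapT => /forallNP fm; apply: f0; apply: (@laurent_eq_from a) => //.
    by move=> n _; rewrite /= /lconst_coef if_same.
  by move=> m; rewrite /= /lconst_coef if_same; apply/eqP; have /negP/negPn := fm m.
case: (ex_minnP ex) => m fm0 mmin; apply: linvP fm0 => n nm.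
have [/fa //|an] := ltP n a; apply/eqP; apply: contraPT nm => fn.
have := mmin `|n - a|%N; suff -> : a + `|n - a|%N%:Z = n by move=> /(_ fn); lia.
by lia.
Qed.

Definition linv f : laurent K :=
  if pselect (exists g, g * f = 1) is left e then projT1 (cid e) else 0.

Lemma lmulVf f : f != 0 -> linv f * f = 1.
Proof.
move=> f0; rewrite /linv; case: pselect => [e|]; first exact: projT2 (cid e).
by have := laurent_inv_ex f0.
Qed.

Lemma linv0 : linv 0 = 0.
Proof.
rewrite /linv; case: pselect => // e; have [g] := e; rewrite mulr0.
by move=> /esym/eqP; rewrite oner_eq0.
Qed.

HB.instance Definition _ := GRing.ComNzRing_isField.Build (laurent K) lmulVf linv0.

End LaurentRing.

Definition eps_coef (K : fieldType) (n : int) : K := if n == 1 then 1 else 0.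

Lemma eps_subproof (K : fieldType) : exists a, vanish_below a (@eps_coef K).
Proof. by exists 1 => n n1; rewrite /eps_coef lt_eqF. Qed.

Definition eps (K : fieldType) : laurent K := Laurent (eps_subproof K).

Lemma eps_neq0 (K : fieldType) : eps K != 0.
Proof.
apply/eqP => /(congr1 (fun f => lcoef f 1)); rewrite /= /eps_coef /lconst_coef.
by move/eqP; rewrite oner_eq0.
Qed.

Definition integral (K : fieldType) (f : laurent K) := forall n, n < 0 -> f n = 0.

Section LaurentMap.
Variables (K K' : fieldType) (phi : {rmorphism K -> K'}).

Lemma lmap_subproof (f : laurent K) : exists a, vanish_below a (phi \o f).
Proof.
by have [a fa] := laurent_bound f; exists a => n /fa /= ->; rewrite rmorph0.
Qed.

Definition lmap (f : laurent K) : laurent K' := Laurent (lmap_subproof f).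

Lemma lmap_is_zmod_morphism : zmod_morphism lmap.
Proof. by move=> f g; apply: laurent_eq => n; exact: rmorphB. Qed.

Lemma lmap_is_monoid_morphism : monoid_morphism lmap.
Proof.
split.
  apply: laurent_eq => n; rewrite /= /lconst_coef.
  by case: ifP; rewrite ?rmorph1 ?rmorph0.
move=> f g; have [[a fa] [b gb]] := (laurent_bound f, laurent_bound g).
have vf : vanish_below a (lmap f) by move=> n /fa /= ->; rewrite rmorph0.
have vg : vanish_below b (lmap g) by move=> n /gb /= ->; rewrite rmorph0.
apply: (@laurent_eq_from _ (a + b)).
- by move=> n nab; rewrite /= (lmul_coef_lt fa gb) ?rmorph0.
- exact: lmul_vanish.
move=> m; rewrite /= (lmul_coefE m fa gb) (lmul_coefE m vf vg) rmorph_sum.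
by apply: eq_bigr => i _; rewrite rmorphM.
Qed.

HB.instance Definition _ :=
  GRing.isZmodMorphism.Build (laurent K) (laurent K') lmap lmap_is_zmod_morphism.
HB.instance Definition _ :=
  GRing.isMonoidMorphism.Build (laurent K) (laurent K') lmap lmap_is_monoid_morphism.

End LaurentMap.

Section Frobenius.
Variables (Fq : finFieldType) (k : fieldType) (iota : {rmorphism Fq -> k}).

(* [iota] only serves to know that the characteristic of [k] divides [#|Fq|]. *)
Definition frob of {rmorphism Fq -> k} := fun x : k => x ^+ #|Fq|.

Lemma frobE x : frob iota x = x ^+ #|Fq|. Proof. by []. Qed.

Lemma frob_is_zmod_morphism : zmod_morphism (frob iota).
Proof.
move=> x y; rewrite !frobE.
have [p p_pr pF] := finPcharP Fq.
have q_pchar : [pchar k].-nat #|Fq|.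
  rewrite (card_pprimeChar pF) pnatX pnatE //.
  by rewrite (rmorph_pchar iota pF).
by rewrite -[in RHS](subrK y x) [in RHS]exprDn_pchar ?addrK.
Qed.

Lemma frob_is_monoid_morphism : monoid_morphism (frob iota).
Proof. by split=> [|x y]; rewrite !frobE ?expr1n ?exprMn. Qed.

HB.instance Definition _ :=
  GRing.isZmodMorphism.Build k k (frob iota) frob_is_zmod_morphism.
HB.instance Definition _ :=
  GRing.isMonoidMorphism.Build k k (frob iota) frob_is_monoid_morphism.

End Frobenius.

Section GL.
Variables (L : fieldType) (n : nat).

Record gl := Gl { gl_mx :> 'M[L]_n; gl_unit : gl_mx \in unitmx }.

HB.instance Definition _ := [isSub for gl_mx].
HB.instance Definition _ := [Choice of gl by <:].

Definition gl_one := Gl (unitmx1 L n).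

Lemma gl_mul_subproof (g h : gl) : (g *m h) \in unitmx.
Proof. by rewrite unitmx_mul !gl_unit. Qed.
Definition gl_mul g h := Gl (gl_mul_subproof g h).

Lemma gl_inv_subproof (g : gl) : invmx g \in unitmx.
Proof. by rewrite unitmx_inv gl_unit. Qed.
Definition gl_inv g := Gl (gl_inv_subproof g).

Lemma gl_mulA : associative gl_mul.
Proof. by move=> f g h; apply: val_inj; exact: mulmxA. Qed.
Lemma gl_mul1 : left_id gl_one gl_mul.
Proof. by move=> f; apply: val_inj; exact: mul1mx. Qed.
Lemma gl_mulr1 : right_id gl_one gl_mul.
Proof. by move=> f; apply: val_inj; exact: mulmx1. Qed.
Lemma gl_mulV : left_inverse gl_one gl_inv gl_mul.
Proof. by move=> f; apply: val_inj; exact: mulVmx (gl_unit f). Qed.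
Lemma gl_mulrV : right_inverse gl_one gl_inv gl_mul.
Proof. by move=> f; apply: val_inj; exact: mulmxV (gl_unit f). Qed.

HB.instance Definition _ :=
  isGroup.Build gl gl_mulA gl_mul1 gl_mulr1 gl_mulV gl_mulrV.

Definition scalar_equiv (g h : gl) : bool :=
  `[< exists2 c : L, c != 0 & (g : 'M_n) = c *: (h : 'M_n) >].

Lemma scalar_equiv_refl : reflexive scalar_equiv.
Proof. by move=> g; apply/asboolP; exists 1; rewrite ?oner_eq0 ?scale1r. Qed.

Lemma scalar_equiv_sym : symmetric scalar_equiv.
Proof.
have H g h : scalar_equiv g h -> scalar_equiv h g.
  move=> /asboolP[c c0 gh]; apply/asboolP; exists c^-1; first by rewrite invr_eq0.
  by rewrite gh scalerK.
by move=> g h; apply/idP/idP; exact: H.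
Qed.

Lemma scalar_equiv_trans : transitive scalar_equiv.
Proof.
move=> g f h /asboolP[c c0 fg] /asboolP[d d0 gh]; apply/asboolP.
by exists (c * d); rewrite ?mulf_neq0 // fg gh scalerA.
Qed.

Canonical scalar_equiv_rel :=
  EquivRel scalar_equiv scalar_equiv_refl scalar_equiv_sym scalar_equiv_trans.

Definition pgl := {eq_quot scalar_equiv}.
HB.instance Definition _ := Choice.on pgl.

Definition to_pgl (g : gl) : pgl := (\pi_({eq_quot scalar_equiv}) g)%qT.

Definition pgl_repr (x : pgl) : gl :=
  generic_quotient.repr (x : {eq_quot scalar_equiv}).

Lemma to_pglP g h :
  to_pgl g = to_pgl h <-> exists2 c : L, c != 0 & (g : 'M_n) = c *: (h : 'M_n).
Proof.
by split=> [/eqquotP/asboolP //|gh]; apply/eqquotP/asboolP.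
Qed.

Lemma pgl_reprK (x : pgl) : to_pgl (pgl_repr x) = x.
Proof. exact: reprK. Qed.

Definition pgl_one := to_pgl 1%g.
Definition pgl_mul x y := to_pgl (pgl_repr x * pgl_repr y)%g.
Definition pgl_inv x := to_pgl (pgl_repr x)^-1%g.

Lemma pgl_mulE g h : pgl_mul (to_pgl g) (to_pgl h) = to_pgl (g * h)%g.
Proof.
have /to_pglP[c c0 gc] := pgl_reprK (to_pgl g).
have /to_pglP[d d0 hd] := pgl_reprK (to_pgl h).
apply/to_pglP; exists (c * d); first by rewrite mulf_neq0.
by rewrite /= gc hd -scalemxAl -scalemxAr scalerA.
Qed.

Lemma pgl_invE g : pgl_inv (to_pgl g) = to_pgl g^-1%g.
Proof.
have /to_pglP[c c0 gc] := pgl_reprK (to_pgl g).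
apply/to_pglP; exists c^-1; first by rewrite invr_eq0.
by rewrite /= gc invmxZ // -gc gl_unit.
Qed.

Lemma pgl_ind (P : pgl -> Prop) : (forall g, P (to_pgl g)) -> forall x, P x.
Proof. by move=> Pg x; rewrite -(pgl_reprK x). Qed.

Lemma pgl_mulA : associative pgl_mul.
Proof.
by elim/pgl_ind=> f; elim/pgl_ind=> g; elim/pgl_ind=> h; rewrite !pgl_mulE mulgA.
Qed.
Lemma pgl_mul1 : left_id pgl_one pgl_mul.
Proof. by elim/pgl_ind=> f; rewrite pgl_mulE mul1g. Qed.
Lemma pgl_mulr1 : right_id pgl_one pgl_mul.
Proof. by elim/pgl_ind=> f; rewrite pgl_mulE mulg1. Qed.
Lemma pgl_mulV : left_inverse pgl_one pgl_inv pgl_mul.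
Proof. by elim/pgl_ind=> f; rewrite pgl_invE pgl_mulE mulVg. Qed.
Lemma pgl_mulrV : right_inverse pgl_one pgl_inv pgl_mul.
Proof. by elim/pgl_ind=> f; rewrite pgl_invE pgl_mulE mulgV. Qed.

HB.instance Definition _ :=
  isGroup.Build pgl pgl_mulA pgl_mul1 pgl_mulr1 pgl_mulV pgl_mulrV.

End GL.

Section PGLMap.
Variables (L L' : fieldType) (n : nat) (phi : {rmorphism L -> L'}).

Lemma gl_map_subproof (g : gl L n) : map_mx phi g \in unitmx.
Proof. by rewrite map_unitmx gl_unit. Qed.
Definition gl_map (g : gl L n) : gl L' n := Gl (gl_map_subproof g).

Definition pgl_map (x : pgl L n) : pgl L' n := to_pgl (gl_map (pgl_repr x)).

Lemma pgl_mapE g : pgl_map (to_pgl g) = to_pgl (gl_map g).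
Proof.
have /to_pglP[c c0 gc] := pgl_reprK (to_pgl g).
by apply/to_pglP; exists (phi c); rewrite ?fmorph_eq0 //= gc map_mxZ.
Qed.

End PGLMap.

(* The pair [(a, b)] stands for [a omega_1 + b omega_2] in the coweight lattice
   [P], so that its components are its pairings with the simple roots. *)
Definition coweight := (int * int)%type.

Definition omega1 : coweight := (1, 0).
Definition alpha1 : coweight := (2, -1).
Definition alpha2 : coweight := (-1, 2).

Lemma omega1E : omega1 *+ 3 = alpha1 *+ 2 + alpha2.
Proof. by []. Qed.

(* [P] is also [Z^3 / Z(1,1,1)], with [omega_1 = (1,0,0)], [omega_2 = (1,1,0)]. *)
Definition cw_coord (l : coweight) (i : 'I_3) : int :=
  [:: l.1 + l.2; l.2; 0]`_i.
Definition cw_of (c : 'I_3 -> int) : coweight := (c 0 - c 1, c 1 - c 2).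

(* The Weyl group is ['S_3].  MathComp composes permutations from left to right,
   [(s * t) i = t (s i)], which makes this a left action. *)
Definition weyl_act (w : 'S_3) (l : coweight) : coweight :=
  cw_of (fun i => cw_coord l (w i)).

Lemma ord3P (P : 'I_3 -> Prop) : P 0 -> P 1 -> P 2 -> forall i, P i.
Proof.
move=> P0 P1 P2 [[|[|[|//]]] i3].
- by rewrite (_ : Ordinal i3 = 0) //; exact: val_inj.
- by rewrite (_ : Ordinal i3 = 1) //; exact: val_inj.
- by rewrite (_ : Ordinal i3 = 2) //; exact: val_inj.
Qed.

Lemma cw_ofB c d : (forall i j, c i - c j = d i - d j) -> cw_of c = cw_of d.
Proof. by move=> cd; rewrite /cw_of !cd. Qed.

Lemma cw_coord_of c i : cw_coord (cw_of c) i = c i - c 2.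
Proof. by move: i; apply: ord3P; rewrite /cw_coord /=; ring. Qed.

Lemma cw_ofK c i j : cw_coord (cw_of c) i - cw_coord (cw_of c) j = c i - c j.
Proof. by rewrite !cw_coord_of; ring. Qed.

Lemma cw_coordK l : cw_of (cw_coord l) = l.
Proof. by case: l => a b; rewrite /cw_of /cw_coord /=; congr pair; ring. Qed.

Lemma weyl_act1 l : weyl_act 1%g l = l.
Proof.
by rewrite -[RHS]cw_coordK; apply: cw_ofB => i j; rewrite !perm1.
Qed.

Lemma weyl_actM v w l : weyl_act (v * w)%g l = weyl_act v (weyl_act w l).
Proof.
by rewrite /weyl_act; apply: cw_ofB => i j; rewrite cw_ofK !permM.
Qed.

Lemma cw_coordD l m i : cw_coord (l + m) i = cw_coord l i + cw_coord m i.
Proof. by move: i; apply: ord3P; rewrite /cw_coord /=; ring. Qed.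

Lemma weyl_actD w l m : weyl_act w (l + m) = weyl_act w l + weyl_act w m.
Proof.
rewrite /weyl_act /cw_of !cw_coordD; congr pair => /=; ring.
Qed.

(* [IwahoriWeyl l w] is [t^l w]. *)
Record iwahori_weyl := IwahoriWeyl { iw_trans : coweight; iw_lin : 'S_3 }.

Definition iw_pair x := (iw_trans x, iw_lin x).
Definition iw_unpair (p : coweight * 'S_3) := IwahoriWeyl p.1 p.2.
Lemma iw_pairK : cancel iw_pair iw_unpair. Proof. by case. Qed.
HB.instance Definition _ := Choice.copy iwahori_weyl (can_type iw_pairK).

Definition iw_one := IwahoriWeyl 0 1%g.
Definition iw_mul x y :=
  IwahoriWeyl (iw_trans x + weyl_act (iw_lin x) (iw_trans y))
              (iw_lin x * iw_lin y)%g.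
Definition iw_inv x :=
  IwahoriWeyl (- weyl_act (iw_lin x)^-1%g (iw_trans x)) (iw_lin x)^-1%g.

Lemma weyl_act0 w : weyl_act w 0 = 0.
Proof. by apply: (addIr (weyl_act w 0)); rewrite -weyl_actD !add0r. Qed.

Lemma weyl_actN w l : weyl_act w (- l) = - weyl_act w l.
Proof. by apply: (addIr (weyl_act w l)); rewrite -weyl_actD !addNr weyl_act0. Qed.

Lemma iw_mulA : associative iw_mul.
Proof.
by move=> x y z; rewrite /iw_mul /= mulgA weyl_actD weyl_actM addrA.
Qed.
Lemma iw_mul1 : left_id iw_one iw_mul.
Proof. by move=> [l w]; rewrite /iw_mul /= weyl_act1 add0r mul1g. Qed.
Lemma iw_mulr1 : right_id iw_one iw_mul.
Proof. by move=> [l w]; rewrite /iw_mul /= weyl_act0 addr0 mulg1. Qed.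
Lemma iw_mulV : left_inverse iw_one iw_inv iw_mul.
Proof. by move=> [l w]; rewrite /iw_mul /= addNr mulVg. Qed.
Lemma iw_mulrV : right_inverse iw_one iw_inv iw_mul.
Proof.
move=> [l w]; rewrite /iw_mul /= weyl_actN -weyl_actM mulgV weyl_act1.
by rewrite addrN.
Qed.

HB.instance Definition _ :=
  isGroup.Build iwahori_weyl iw_mulA iw_mul1 iw_mulr1 iw_mulV iw_mulrV.

Definition t_ (l : coweight) : iwahori_weyl := IwahoriWeyl l 1%g.
Definition s1 : iwahori_weyl := IwahoriWeyl 0 (tperm 0 1).
Definition s2 : iwahori_weyl := IwahoriWeyl 0 (tperm 1 2).
Definition s0 : iwahori_weyl := (t_ (alpha1 + alpha2) * s1 * s2 * s1)%g.
Definition tau : iwahori_weyl := (t_ omega1 * s1 * s2)%g.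

Lemma iw_eq (x y : iwahori_weyl) : iw_trans x = iw_trans y ->
  (forall i, iw_lin x i = iw_lin y i) -> x = y.
Proof. by case: x y => [l w] [m v] /= -> /permP ->. Qed.

Local Ltac iw_compute :=
  apply: iw_eq;
  [ rewrite /= /weyl_act /cw_of /= ?permM ?permE /= ?permM ?permE //=
  | apply: ord3P; rewrite /= ?permM ?permE /= ?permE //= ].

Lemma coweightMz (l : coweight) (m : int) : l *~ m = (l.1 *~ m, l.2 *~ m).
Proof.
have H1 : (l *~ m).1 = l.1 *~ m by exact: (raddfMz (@fst int int)).
have H2 : (l *~ m).2 = l.2 *~ m by exact: (raddfMz (@snd int int)).
by rewrite -H1 -H2; case: (l *~ m).
Qed.

Lemma s1_act l : weyl_act (iw_lin s1) l = l - alpha1 *~ l.1.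
Proof.
case: l => a b; rewrite coweightMz /weyl_act /cw_of /= !permE /= /cw_coord /=.
by congr pair; rewrite /= mulrzz; lia.
Qed.

Lemma s2_act l : weyl_act (iw_lin s2) l = l - alpha2 *~ l.2.
Proof.
case: l => a b; rewrite coweightMz /weyl_act /cw_of /= !permE /= /cw_coord /=.
by congr pair; rewrite /= mulrzz; lia.
Qed.

Lemma tau3 : (tau ^+ 3 = 1)%g. Proof. iw_compute. Qed.
Lemma tau_s0 : (tau * s0 = s1 * tau)%g. Proof. iw_compute. Qed.
Lemma tau_s1 : (tau * s1 = s2 * tau)%g. Proof. iw_compute. Qed.
Lemma tau_s2 : (tau * s2 = s0 * tau)%g. Proof. iw_compute. Qed.

(* The factor [tau ^+ j] is not counted, so that the least such [n] is the Coxeter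
   length on [W_a], extended by [l(w tau^j) = l(w)]. *)
Definition is_word (n : nat) (x : iwahori_weyl) : Prop :=
  exists (u : seq iwahori_weyl) (j : nat),
    [/\ size u = n, {subset u <= [:: s0; s1; s2]}
      & x = (\prod_(y <- u) y * tau ^+ j)%g].

Section WordExists.
Local Notation P := (fun x => exists n, is_word n x).

Lemma word1 : P 1%g.
Proof. by exists 0, [::], 0; split=> //; rewrite big_nil mul1g expg0. Qed.

Lemma word_s s x : s \in [:: s0; s1; s2] -> P x -> P (s * x)%g.
Proof.
move=> sS [n [u [j [su uS ->]]]]; exists n.+1, (s :: u), j; split.
- by rewrite /= su.
- by move=> y; rewrite inE => /predU1P[-> //|/uS].
- by rewrite big_cons mulgA.
Qed.

Lemma word_tau x : P x -> P (tau * x)%g.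
Proof.
move=> [n [u [j [_ uS ->]]]]; rewrite mulgA.
suff [v vS ->] : exists2 v : seq iwahori_weyl, {subset v <= [:: s0; s1; s2]} &
    (tau * \prod_(y <- u) y = \prod_(y <- v) y * tau)%g.
  by exists (size v), v, j.+1; split=> //; rewrite -mulgA -expgS.
elim: u uS => [|y u IH] uS; first by exists [::]; rewrite // !big_nil mulg1 mul1g.
have [v vS uv] : exists2 v : seq iwahori_weyl, {subset v <= [:: s0; s1; s2]} &
    (tau * \prod_(y <- u) y = \prod_(y <- v) y * tau)%g.
  by apply: IH => z zu; apply: uS; rewrite inE zu orbT.
have [z zS yz] : exists2 z, z \in [:: s0; s1; s2] & (tau * y = z * tau)%g.
  have := uS y (mem_head _ _); rewrite !inE => /or3P[] /eqP ->.
  - by exists s1; rewrite ?inE ?eqxx ?orbT // tau_s0.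
  - by exists s2; rewrite ?inE ?eqxx ?orbT // tau_s1.
  - by exists s0; rewrite ?inE ?eqxx ?orbT // tau_s2.
exists (z :: v); first by move=> w; rewrite inE => /predU1P[-> //|/vS].
by rewrite !big_cons mulgA yz -(mulgA z) uv mulgA.
Qed.

Lemma word_s1 x : P x -> P (s1 * x)%g.
Proof. by apply: word_s; rewrite !inE eqxx orbT. Qed.
Lemma word_s2 x : P x -> P (s2 * x)%g.
Proof. by apply: word_s; rewrite !inE eqxx !orbT. Qed.

Lemma t_D l m : t_ (l + m) = (t_ l * t_ m)%g.
Proof. by apply: iw_eq => [|i]; rewrite /= ?weyl_act1 ?mulg1. Qed.

Lemma word_t l x : P x -> P (t_ l * x)%g.
Proof.
pose good m := forall y, P y -> P (t_ m * y)%g.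
have good0 : good 0 by move=> y Py; rewrite (_ : t_ 0 = 1%g) // mul1g.
have goodD m m' : good m -> good m' -> good (m + m').
  by move=> gm gm' y Py; rewrite t_D -mulgA; apply/gm/gm'.
have goodM m (z : int) : good m -> good (- m) -> good (m *~ z).
  move=> gm gm'; elim/int_ind: z => [|n IH|n IH]; first by rewrite mulr0z.
    by rewrite -addn1 PoszD mulrzDr; apply: goodD.
  by rewrite -addn1 PoszD opprD mulrzDr mulrN1z; apply: goodD.
have -> : l = (1, 0) *~ l.1 + (0, 1) *~ l.2 :> coweight.
  rewrite !coweightMz; case: l => a b; congr pair; rewrite /= !mulrzz; lia.
apply: (goodD); apply: goodM => y Py {x}.
- rewrite (_ : t_ _ = (tau * s2 * s1)%g); last by iw_compute.
  by have := word_tau (word_s2 (word_s1 Py)); rewrite !mulgA.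
- rewrite (_ : t_ _ = (s1 * s2 * tau * tau)%g); last by iw_compute.
  by have := word_s1 (word_s2 (word_tau (word_tau Py))); rewrite !mulgA.
- rewrite (_ : t_ _ = (tau * tau * s1 * s2)%g); last by iw_compute.
  by have := word_tau (word_tau (word_s1 (word_s2 Py))); rewrite !mulgA.
- rewrite (_ : t_ _ = (s2 * s1 * tau)%g); last by iw_compute.
  by have := word_s2 (word_s1 (word_tau Py)); rewrite !mulgA.
Qed.

Lemma word_tperm (i j : 'I_3) y : P y -> P (IwahoriWeyl 0 (tperm i j) * y)%g.
Proof.
pose good w := forall y, P y -> P (IwahoriWeyl 0 w * y)%g.
have good1 : good 1%g by move=> z Pz; rewrite (_ : IwahoriWeyl 0 1 = 1%g) // mul1g.
have good01 : good (tperm 0 1) by move=> z; exact: word_s1.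
have good12 : good (tperm 1 2) by move=> z; exact: word_s2.
have good02 : good (tperm 0 2).
  move=> z Pz; rewrite (_ : IwahoriWeyl _ _ = (s1 * s2 * s1)%g); last by iw_compute.
  by have := word_s1 (word_s2 (word_s1 Pz)); rewrite !mulgA.
suff : good (tperm i j) by exact.
move: i j {y}; apply: ord3P; apply: ord3P; rewrite ?tperm1 //.
- by rewrite tpermC.
- by rewrite tpermC.
- by rewrite tpermC.
Qed.

Lemma iw_linM v w :
  IwahoriWeyl 0 (v * w)%g = (IwahoriWeyl 0 v * IwahoriWeyl 0 w)%g.
Proof. by apply: iw_eq => [|h]; rewrite /= ?weyl_act0 ?addr0. Qed.

Lemma word_w w x : P x -> P (IwahoriWeyl 0 w * x)%g.
Proof.
move=> Px; have [ts -> _] := prod_tpermP w.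
elim: ts => [|[i j] ts IH].
  by rewrite big_nil (_ : IwahoriWeyl 0 1 = 1%g) // mul1g.
by rewrite big_cons /= iw_linM -(mulgA (IwahoriWeyl 0 (tperm i j))); apply: word_tperm.
Qed.

Lemma word_ex x : exists n, `[< is_word n x >].
Proof.
have [n xn] : P x; last by exists n; apply/asboolP.
suff -> : x = (t_ (iw_trans x) * (IwahoriWeyl 0 (iw_lin x) * 1))%g.
  exact/word_t/word_w/word1.
by apply: iw_eq => [|i]; rewrite /= ?weyl_act1 ?weyl_act0 ?addr0 ?mulg1 ?mul1g.
Qed.

End WordExists.

Definition iw_length (x : iwahori_weyl) : nat := ex_minn (word_ex x).

Section Representatives.
Variable k : fieldType.
Local Notation L := (laurent k).

Definition iw_mx (x : iwahori_weyl) : 'M[L]_3 :=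
  diag_mx (\row_i eps k ^ cw_coord (iw_trans x) i) *m perm_mx (iw_lin x).

Lemma iw_mx_unit x : iw_mx x \in unitmx.
Proof.
rewrite unitmx_mul unitmx_perm andbT unitmxE det_diag unitfE.
by apply/prodf_neq0 => i _; rewrite mxE expfz_neq0 // eps_neq0.
Qed.

Definition iw_gl (x : iwahori_weyl) : gl L 3 := Gl (iw_mx_unit x).

(* [t^l w] is represented by [eps^l] times the permutation matrix of [w]. *)
Definition iw_rep (x : iwahori_weyl) : pgl L 3 := to_pgl (iw_gl x).

Lemma iw_mxE x i j :
  iw_mx x i j = eps k ^ cw_coord (iw_trans x) i * (iw_lin x i == j)%:R.
Proof. by rewrite /iw_mx mul_diag_mx !mxE. Qed.

Lemma iw_repM x y : iw_rep (x * y)%g = (iw_rep x * iw_rep y)%g.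
Proof.
rewrite /iw_rep -[RHS]/(pgl_mul _ _) pgl_mulE; apply/esym/to_pglP.
exists (eps k ^ cw_coord (iw_trans y) (iw_lin x 2)).
  by rewrite expfz_neq0 // eps_neq0.
apply/matrixP => i j; rewrite [RHS]mxE [LHS]mxE iw_mxE /=.
rewrite (bigD1 (iw_lin x i)) //= big1 => [|h hi]; last first.
  by rewrite iw_mxE eq_sym (negbTE hi) mulr0 mul0r.
rewrite addr0 !iw_mxE eqxx mulr1 permM !mulrA; congr (_ * _).
rewrite cw_coordD cw_coord_of -!expfzDr ?eps_neq0 //; congr (_ ^ _); ring.
Qed.

Lemma iw_rep_fixed (phi : {rmorphism k -> k}) x : pgl_map (lmap phi) (iw_rep x) = iw_rep x.
Proof.
rewrite pgl_mapE; congr to_pgl; apply: val_inj => /=.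
apply/matrixP => i j; rewrite mxE !iw_mxE rmorphM rmorph_nat; congr (_ * _).
rewrite fmorphXz; congr (_ ^ _); apply: laurent_eq => n /=.
by rewrite /eps_coef; case: ifP; rewrite ?rmorph1 ?rmorph0.
Qed.

(* Matrices in [GL_3(k[[eps]])] that are lower triangular modulo [eps].  With
   [t^l] represented by [eps^l], this is the Iwahori subgroup attached to the
   base alcove of the dominant chamber, i.e. the one whose simple affine
   reflections are [s0], [s1], [s2] and which is normalised by [tau]. *)
Definition iwahori_gl : set (gl L 3) := [set g : gl L 3 |
  [/\ forall i j, integral (g i j), forall i j, integral ((g^-1)%g i j)
    & forall i j : 'I_3, (i < j)%N -> lcoef (g i j) 0 = 0]].

Definition iwahori : set (pgl L 3) := [set to_pgl g | g in iwahori_gl].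

Definition iw_coset (g : pgl L 3) : set (pgl L 3) :=
  [set (g * h)%g | h in iwahori].

Definition iw_double_coset (g : pgl L 3) : set (pgl L 3) :=
  [set (h1 * g * h2)%g | h1 in iwahori & h2 in iwahori].

End Representatives.

Section ADLV.
Variables (Fq : finFieldType) (k : fieldType) (iota : {rmorphism Fq -> k}).
Local Notation L := (laurent k).

Definition sigma : pgl L 3 -> pgl L 3 := pgl_map (lmap (frob iota)).

Definition adlv (w : iwahori_weyl) (b : pgl L 3) : set (set (pgl L 3)) :=
  [set C | exists2 g, C = iw_coset g
                    & iw_double_coset (iw_rep k w) (g^-1 * b * sigma g)%g].

Definition rational_points (X : set (set (pgl L 3))) : set (set (pgl L 3)) :=
  [set C | X C /\ sigma @` C = C].

End ADLV.

Definition root_lattice (m n : int) : coweight := alpha1 *~ m + alpha2 *~ n.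

Definition O_id_tau : set iwahori_weyl := [set x | exists m n : int,
  x = (t_ (root_lattice m n) * tau)%g \/
  x = (t_ (root_lattice m n) * s1 * s2 * tau)%g].

Definition O_tau (i : int) : set iwahori_weyl := [set x | exists k : int,
  [\/ x = (t_ (root_lattice k i) * s1 * s2 * s1 * tau)%g,
      x = (t_ (root_lattice (k + i - 1) k) * s2 * tau)%g
    | x = (t_ (root_lattice (1 - i) k) * s1 * tau)%g]].

(* In particular, [A] is finite. *)
Definition has_card (T : Type) (A : set T) (z : int) :=
  exists2 N : nat, (A #= `I_N)%card & N%:Z = z.

(* Main.v *)
Require Import Defs.
From HB Require Import structures.
From mathcomp Require Import all_boot all_order all_algebra.
From mathcomp Require Import fingroup perm finfield.
From mathcomp Require Import boolp classical_sets cardinality.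
From mathcomp Require Import ring zify.
Set Implicit Arguments.
Unset Strict Implicit.
Unset Printing Implicit Defensive.
Import Order.TTheory GRing.Theory Num.Theory.
Local Open Scope ring_scope.

(* Every sigma-fixed coset [gI] has a representative over [F = Fq((eps))]: writing
   [g] in the Bruhat decomposition, its successive root coordinates are unique,
   hence fixed by Frobenius.  So the cardinal N(w) sought is the number of
   chambers [gI] over [F] with [g^-1 tau g] in [I w I].  Deligne-Lusztig
   reduction turns into the recursion
     N(sw) = N(ws)                          if sw > w and ws > w,
     N(sws) = q N(w) + (q - 1) N(ws)        if moreover sws > ws,
   and N is invariant under conjugation by [tau], so that [s = s1] is enough.
   The recursion ends at N(tau) = 3, where the centralizer of [tau] in the
   Iwahori-Weyl group is [<tau>], and at elements [w] with N(w) = 0: such a [w]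
   fixes a coordinate whose entry dominates the trace of every element of
   [I w I], or of its inverse, whereas conjugates of [tau] and [tau^-1] have
   trace 0.

   Conventions.  The monomial [eps^m e_i] is numbered [i + 3m], so that [I] is the
   stabilizer of the flag of lattices spanned by the monomials of number at least
   [n], and [t^c v] is encoded by the values [v i - 3 c_i] taken by its inverse at
   [i = 0, 1, 2]. *)

(** * Valuations of Laurent series *)

(** The shape of the three formulas comes from the linear part v of [t^c v]. If v is a 3-cycle, the
    element [w * s1] of a reduction is a transposition with empty fiber, so each reduction only
    multiplies by q, whence 3 q^(l/2). If v is a transposition, every other step is a reduction in
    which [w * s1] is a 3-cycle, and it contributes 3 (q - 1) q^((l-1)/2). Later steps multiply this
    by q while the length grows by 2, so all contributions have the same form in terms of the final
    length, and the ceiling counts how many are collected before a transposition with empty fiber is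
    met. If v = 1, the determinant prevents the three coordinates from being equal, one of them is
    strictly extreme, and the trace makes the fiber empty. The reduction is purely combinatorial: it
    counts pairs of adjacent chambers C, C' with a prescribed distance from C' to tau C. It uses
    only properties of BN-pairs, needed both over Fq((eps)), for counting, and over k((eps)), for
    descent; this is why they are isolated in [iwahori_system]. *)

Section Valuation.
Variable K : fieldType.
Local Notation L := (laurent K).
Implicit Types f g : L.

Definition valuation f n := vanish_below n f /\ f n != 0.

Lemma lcoef0 n : (0 : L) n = 0.
Proof. by rewrite /= /lconst_coef if_same. Qed.

Lemma lcoefD f g n : (f + g) n = f n + g n.
Proof. by []. Qed.

Lemma lcoefN f n : (- f) n = - f n.
Proof. by []. Qed.

Lemma vanish_below0 n : vanish_below n (0 : L).
Proof. by move=> m _; exact: lcoef0. Qed.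

Lemma vanish_belowD n f g :
  vanish_below n f -> vanish_below n g -> vanish_below n (f + g).
Proof. by move=> fn gn m mn; rewrite lcoefD fn // gn // addr0. Qed.

Lemma vanish_belowM a b f g :
  vanish_below a f -> vanish_below b g -> vanish_below (a + b) (f * g).
Proof. exact: lmul_vanish. Qed.

Lemma vanish_belowMle c a b f g : c <= a + b ->
  vanish_below a f -> vanish_below b g -> vanish_below c (f * g).
Proof. by move=> cab fa gb; apply: vanish_belowW cab _; exact: vanish_belowM. Qed.

Lemma vanish_below_sum (I : Type) (r : seq I) (P : pred I) (F : I -> L) n :
  (forall i, P i -> vanish_below n (F i)) ->
  vanish_below n (\sum_(i <- r | P i) F i : L).
Proof.
move=> Fn; elim/big_ind: _ => //; first exact: vanish_below0.
by move=> f g; exact: vanish_belowD.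
Qed.

Lemma lcoefM_lead a b f g : vanish_below a f -> vanish_below b g ->
  (f * g) (a + b) = f a * g b.
Proof.
move=> fa gb; have := lmul_coefE 0 fa gb.
by rewrite big_ord1 /= subn0 !addr0 => <-.
Qed.

Lemma valuationM a b f g :
  valuation f a -> valuation g b -> valuation (f * g) (a + b).
Proof.
move=> [fa fa0] [gb gb0]; split; first exact: vanish_belowM.
by rewrite (lcoefM_lead fa gb) mulf_neq0.
Qed.

Lemma valuation_const (c : K) : c != 0 -> valuation (lconst c) 0.
Proof.
move=> c0; split; first by move=> n n0; rewrite /= /lconst_coef lt_eqF.
by rewrite /= /lconst_coef eqxx.
Qed.

Lemma valuation1 : valuation (1 : L) 0.
Proof. exact/valuation_const/oner_neq0. Qed.

Lemma valuation_neq0 f n : valuation f n -> f != 0.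
Proof. by case=> _; apply: contra_neq => ->; rewrite lcoef0. Qed.

Lemma valuation_uniq f m n : valuation f m -> valuation f n -> m = n.
Proof.
move=> [fm fm0] [fn fn0]; case: (ltgtP m n) => //.
- by move/fn => /eqP; rewrite (negbTE fm0).
- by move/fm => /eqP; rewrite (negbTE fn0).
Qed.

Lemma vanish_below_valuation f m n : vanish_below m f -> valuation f n -> m <= n.
Proof. by move=> fm [_ fn0]; rewrite leNgt; apply: contra_neqN fn0 => /fm. Qed.

Lemma valuation_exists f : f != 0 -> exists n, valuation f n.
Proof.
move=> f0; have [a fa] := laurent_bound f.
have ex : exists m : nat, f (a + m%:Z) != 0.
  apply: contrapT => /forallNP fm; move/eqP: f0; apply; apply: (laurent_eq_from fa).
    exact: vanish_below0.
  by move=> m; rewrite lcoef0; apply/eqP; have /negP/negPn := fm m.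
case: (ex_minnP ex) => m fm0 mmin; exists (a + m%:Z); split=> // n nm.
have [/fa //|an] := ltP n a; apply/eqP; apply: contraPT nm => fn.
have := mmin `|n - a|%N; suff -> : a + `|n - a|%N%:Z = n by move=> /(_ fn); lia.
by lia.
Qed.

Lemma valuationV f n : valuation f n -> valuation f^-1 (- n).
Proof.
move=> fn; have f0 := valuation_neq0 fn.
have [m fm] : exists m, valuation f^-1 m by apply: valuation_exists; rewrite invr_eq0.
suff <- : m = - n by [].
apply/eqP; rewrite -addr_eq0; apply/eqP.
by apply: valuation_uniq valuation1; rewrite -(mulVf f0); exact: valuationM.
Qed.

Lemma valuation_eps (n : int) : valuation (eps K ^ n) n.
Proof.
have eps1 : valuation (eps K) 1.
  split=> [m m1|]; first by rewrite /= /eps_coef lt_eqF.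
  by rewrite /= /eps_coef eqxx oner_neq0.
have epsn (m : nat) : valuation (eps K ^+ m) m.
  elim: m => [|m IH]; first exact: valuation1.
  by rewrite exprS intS; exact: valuationM.
case: n => n; first exact: epsn.
by rewrite NegzE -exprnN; apply: valuationV; exact: epsn.
Qed.

Lemma vanish_below_eps (n : int) : vanish_below n (eps K ^ n).
Proof. exact: (valuation_eps n).1. Qed.

Lemma valuation_prod (I : Type) (r : seq I) (F : I -> L) (n : I -> int) :
  (forall i, valuation (F i) (n i)) ->
  valuation (\prod_(i <- r) F i) (\sum_(i <- r) n i).
Proof.
move=> Fn; elim/big_rec2: _ => [|i m f _ fm]; first exact: valuation1.
exact: valuationM.
Qed.

Lemma valuationN f n : valuation f n -> valuation (- f) n.
Proof.
case=> fn fn0; split=> [m mn|]; first by rewrite lcoefN fn // oppr0.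
by rewrite lcoefN oppr_eq0.
Qed.

Lemma valuation_dominant (I : finType) (F : I -> L) (i : I) n :
  valuation (F i) n -> (forall j, j != i -> vanish_below (n + 1) (F j)) ->
  \sum_j F j != 0.
Proof.
move=> [Fi Fi0] Fj; rewrite (bigD1 i) //=.
set s := \sum_(j | _) _; have sn : s n = 0.
  have sn1 : vanish_below (n + 1) s by exact: vanish_below_sum.
  by apply: sn1; rewrite ltrDl.
by apply: contra_neq Fi0 => s0; have := lcoef0 n; rewrite -s0 lcoefD sn addr0.
Qed.

End Valuation.

(** * The Iwahori subgroup *)

Lemma tau_tau : (tau * tau = tau^-1)%g.
Proof. by apply: (mulIg tau); rewrite mulVg -tau3 !expgS expg0 mulg1 (mulgA tau tau tau). Qed.

Lemma conjg_square (G : groupType) (t x : G) : (t * t = t^-1)%g ->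
  (t * (t * x * t^-1) * t^-1 = t^-1 * x * t)%g.
Proof. by move=> tt; rewrite !mulgA tt -(mulgA _ t^-1%g t^-1%g) -invgM tt invgK. Qed.

Section Iwahori.
Variable K : fieldType.
Local Notation L := (laurent K).
Local Notation gl := (gl L 3).
Local Notation pgl := (pgl L 3).
Implicit Types (f : L) (g h : gl) (M N : 'M[L]_3) (w x y : iwahori_weyl).

Lemma to_pglM g h : to_pgl (g * h)%g = (to_pgl g * to_pgl h)%g.
Proof. exact/esym/pgl_mulE. Qed.

Lemma to_pglV g : to_pgl g^-1%g = (to_pgl g)^-1%g.
Proof. exact/esym/pgl_invE. Qed.

Lemma iw_repV w : iw_rep K w^-1%g = (iw_rep K w)^-1%g.
Proof.
have rep1 : iw_rep K 1%g = 1%g by apply: (mulIg (iw_rep K 1%g)); rewrite -iw_repM !mul1g.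
by apply: (mulIg (iw_rep K w)); rewrite -iw_repM !mulVg.
Qed.

Definition ivanish M := forall i j : 'I_3, vanish_below (i < j)%N%:Z (M i j).

Lemma ivanish_integral M i j : ivanish M -> vanish_below 0 (M i j).
Proof. by move=> Mi; apply: vanish_belowW (Mi i j). Qed.

Lemma ivanishM M N : ivanish M -> ivanish N -> ivanish (M *m N).
Proof.
move=> Mi Ni i j; rewrite mxE; apply: vanish_below_sum => k _.
apply: vanish_belowMle (Mi i k) (Ni k j).
by case: (ltnP i j); case: (ltnP i k); case: (ltnP k j) => //=; lia.
Qed.

Lemma integral_det n (M : 'M[L]_n) : (forall i j, vanish_below 0 (M i j)) -> vanish_below 0 (\det M).
Proof.
move=> Mi; apply: vanish_below_sum => s _; rewrite -signr_odd.
apply: (@vanish_belowMle _ 0 0 0) => //.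
  case: (odd _); rewrite ?expr1 ?expr0; last exact: (valuation1 K).1.
  exact: (valuationN (valuation1 K)).1.
elim/big_ind: _ => //; first exact: (valuation1 K).1.
by move=> f g; exact: (@vanish_belowMle _ 0 0 0).
Qed.

Lemma integral_inverse g : (forall i j, vanish_below 0 (g i j)) ->
  valuation (\det g) 0 -> forall i j, vanish_below 0 ((g^-1)%g i j).
Proof.
move=> gi dg i j; have -> : ((g^-1)%g : 'M_3) = (\det g)^-1 *: \adj g.
  by rewrite -[LHS]/(invmx g) /invmx gl_unit.
rewrite !mxE; apply: (@vanish_belowMle _ 0 0 0) => //.
  by have := (valuationV dg).1; rewrite oppr0.
apply: (@vanish_belowMle _ 0 0 0) => //.
  rewrite -signr_odd; case: (odd _); rewrite ?expr1 ?expr0.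
    exact: (valuationN (valuation1 K)).1.
  exact: (valuation1 K).1.
by apply: integral_det => k l; rewrite !mxE.
Qed.

(** The determinants of [g] and of its inverse are integral with opposite valuations, hence of
    valuation 0; conversely the adjugate formula makes the inverse integral. The inverse thus
    disappears from the definition. *)
Lemma iwahori_glP g : iwahori_gl g <-> ivanish g /\ valuation (\det g) 0.
Proof.
split=> [[gi gVi gl0]|[gi dg]].
  split=> [i j n|].
    case: (ltnP i j) => [ij|_] /=; last exact: gi.
    by rewrite (ltzD1 n 0) le_eqVlt => /predU1P[->|]; [exact: gl0|exact: gi].
  have [m dm] : exists m, valuation (\det g) m.
    by apply: valuation_exists; rewrite -unitfE -unitmxE gl_unit.
  have m0 := vanish_below_valuation (integral_det gi) dm.
  have dVm : valuation (\det (g^-1)%g) (- m).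
    by rewrite -[X in \det X]/(invmx g) det_inv; exact: valuationV.
  have := vanish_below_valuation (integral_det gVi) dVm.
  by rewrite oppr_ge0 => m0'; have /eqP : m = 0 by [lia|]; move/eqP <-.
split=> [i j||i j ij]; first exact: ivanish_integral.
  by apply: integral_inverse => // i j; exact: ivanish_integral.
by apply: gi; rewrite ij.
Qed.

Lemma iwahori_gl1 : iwahori_gl (1%g : gl).
Proof.
apply/iwahori_glP; split; last by rewrite det1; exact: valuation1.
move=> i j; rewrite /= mxE; case: eqVneq => [->|_].
  by rewrite ltnn; exact: (valuation1 K).1.
exact: vanish_below0.
Qed.

Lemma iwahori_glM g h : iwahori_gl g -> iwahori_gl h -> iwahori_gl (g * h)%g.
Proof.
move=> /iwahori_glP[gi dg] /iwahori_glP[hi dh]; apply/iwahori_glP; split.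
  exact: ivanishM.
by rewrite det_mulmx -[0]addr0; exact: valuationM.
Qed.

Lemma lcoefM_integral f f' :
  vanish_below 0 f -> vanish_below 0 f' -> (f * f') 0 = f 0 * f' 0.
Proof. by move=> fi f'i; rewrite -[X in lcoef _ X]addr0 lcoefM_lead. Qed.

Lemma ord3_sum (R : nmodType) (F : 'I_3 -> R) : \sum_i F i = F 0 + F 1 + F 2.
Proof.
rewrite !big_ord_recr big_ord0 /= add0r.
by congr (F _ + F _ + F _); exact: val_inj.
Qed.

(** Modulo eps, [g] is an invertible lower triangular matrix. The relations between constant terms,
    solved row by row, give nonzero diagonal residues and a lower triangular inverse. *)
Lemma iwahori_residues g : iwahori_gl g ->
  (forall i, valuation (g i i) 0) /\ ivanish (g^-1)%g.
Proof.
move=> /[dup] /iwahori_glP[gi _] [_ gVi _].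
have gg k l : \sum_m (g k m) 0 * ((g^-1)%g m l) 0 = (k == l)%:R :> K.
  have /matrixP/(_ k l) := mulmxV (gl_unit g).
  rewrite mxE mxE ord3_sum => /(congr1 (fun f : L => f 0)).
  rewrite -[invmx g]/((g^-1)%g : 'M_3) !lcoefD !lcoefM_integral;
    try solve [exact: ivanish_integral | exact: gVi].
  rewrite ord3_sum => ->; case: (k == l); last exact: lcoef0.
  by rewrite /= /lconst_coef eqxx.
have r0 : forall k l : 'I_3, (k < l)%N -> (g k l) 0 = 0.
  by move=> k l kl; apply: gi; rewrite kl.
have [[r01 r02] r12] := (r0 0 1 isT, r0 0 2 isT, r0 1 2 isT).
have {}gg k l := etrans (esym (ord3_sum (fun m => (g k m) 0 * ((g^-1)%g m l) 0))) (gg k l).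
have nz (a b : K) : a * b = 1 -> a != 0.
  by move=> ab; apply: contra_eq_neq ab => ->; rewrite mul0r eq_sym oner_eq0.
have sol (a b : K) : a != 0 -> a * b = 0 -> b = 0.
  by move=> a0 /eqP; rewrite mulf_eq0 (negbTE a0) => /eqP.
move: (gg 0 0) (gg 0 1) (gg 0 2); rewrite r01 r02 !mul0r !addr0 /= => e00 e01 e02.
have n0 := nz _ _ e00; have [h01 h02] := (sol _ _ n0 e01, sol _ _ n0 e02).
move: (gg 1 1) (gg 1 2); rewrite h01 h02 r12 !mul0r !mulr0 !addr0 !add0r /= => e11 e12.
have n1 := nz _ _ e11; have h12 := sol _ _ n1 e12.
move: (gg 2 2); rewrite h02 h12 !mulr0 !add0r /= => e22.
have n2 := nz _ _ e22.
split; first by apply: ord3P; split=> //; exact: ivanish_integral.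
have vb1 f : vanish_below 0 f -> f 0 = 0 -> vanish_below 1 f.
  by move=> f0 f00 n; rewrite (ltzD1 n 0) le_eqVlt => /predU1P[->|]; [|exact: f0].
by apply: ord3P; apply: ord3P; first [exact: (gVi _ _)|apply: vb1 (gVi _ _) _].
Qed.

Lemma iwahori_glV g : iwahori_gl g -> iwahori_gl (g^-1)%g.
Proof.
move=> gI; have [_ gVi] := iwahori_residues gI; apply/iwahori_glP; split=> //.
have [_ dg] := (iwahori_glP g).1 gI.
by rewrite -[X in \det X]/(invmx g) det_inv -oppr0; exact: valuationV.
Qed.

Lemma iwahori1 : iwahori (1%g : pgl).
Proof. by exists 1%g => //; exact: iwahori_gl1. Qed.

Lemma iwahoriM (g h : pgl) : iwahori g -> iwahori h -> iwahori (g * h)%g.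
Proof.
move=> [g' g'I <-] [h' h'I <-]; exists (g' * h')%g; last exact: to_pglM.
exact: iwahori_glM.
Qed.

Lemma iwahoriV (g : pgl) : iwahori g -> iwahori g^-1%g.
Proof.
by move=> [g' g'I <-]; exists g'^-1%g; [exact: iwahori_glV|exact: to_pglV].
Qed.

Definition iw_conj w g : gl := (iw_gl K w * g * (iw_gl K w)^-1)%g.

Lemma to_pgl_conj w g :
  to_pgl (iw_conj w g) = (iw_rep K w * to_pgl g * (iw_rep K w)^-1)%g.
Proof. by rewrite (to_pglM (iw_gl K w * g)%g) (to_pglM (iw_gl K w)) to_pglV. Qed.

Lemma iw_conjE w g i j : iw_conj w g i j =
  eps K ^ (cw_coord (iw_trans w) i - cw_coord (iw_trans w) j)
    * g (iw_lin w i) (iw_lin w j).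
Proof.
set c := cw_coord _; pose N : 'M[L]_3 :=
  \matrix_(i, j) (eps K ^ (c i - c j) * g (iw_lin w i) (iw_lin w j)).
suff -> : (iw_conj w g : 'M_3) = N by rewrite mxE.
rewrite [LHS](_ : _ = iw_mx K w *m g *m invmx (iw_mx K w)) //.
suff -> : iw_mx K w *m g = N *m iw_mx K w by rewrite mulmxK // iw_mx_unit.
apply/matrixP => k l; rewrite !mxE.
rewrite (bigD1 (iw_lin w k)) //= big1 => [|h hk]; last first.
  by rewrite iw_mxE eq_sym (negbTE hk) mulr0 mul0r.
rewrite (bigD1 ((iw_lin w)^-1%g l)) //= big1 => [|h hk]; last first.
  by rewrite iw_mxE (canF_eq (permK _)) (negbTE hk) !mulr0.
rewrite !iw_mxE mxE permKV !eqxx !mulr1 !addr0 -/c mulrAC -expfzDr ?eps_neq0 //.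
by rewrite subrK.
Qed.

Lemma det_iw_conj w g : \det (iw_conj w g) = \det g.
Proof.
rewrite [X in \det X](_ : _ = iw_mx K w *m g *m invmx (iw_mx K w)) //.
rewrite (det_mulmx (_ *m _)) (det_mulmx (iw_mx K w)) det_inv mulrAC.
by rewrite mulrV ?mul1r // -unitmxE iw_mx_unit.
Qed.

Lemma conj_iwahori w g : valuation (\det g) 0 -> ivanish (iw_conj w g) ->
  iwahori (iw_rep K w * to_pgl g * (iw_rep K w)^-1)%g.
Proof.
move=> dg gi; exists (iw_conj w g); last exact: to_pgl_conj.
by apply/iwahori_glP; rewrite det_iw_conj.
Qed.

Lemma vanish_below_epsM (m n : int) f :
  vanish_below (m - n) f -> vanish_below m (eps K ^ n * f).
Proof. move=> fn; rewrite -(subrKC n m); exact: vanish_belowM (@vanish_below_eps K n) fn.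
Qed.

Lemma iw_lin_tau :
  [/\ iw_lin tau 0 = 2, iw_lin tau 1 = 0 & iw_lin tau 2 = 1].
Proof. by split; rewrite /= !permM !permE /=. Qed.

Lemma cw_coord_tau i : cw_coord (iw_trans tau) i = (i == 0).
Proof.
have -> : iw_trans tau = omega1 by rewrite /= !weyl_act0 !addr0.
by move: i; apply: ord3P.
Qed.

(** [tau] shifts the numbering of the monomials by one, so it permutes the lattices of the flag
    stabilized by I. *)
Lemma iwahori_tau (g : pgl) : iwahori g ->
  iwahori (iw_rep K tau * g * (iw_rep K tau)^-1)%g.
Proof.
move=> [{}g /iwahori_glP[gi dg] <-]; apply: conj_iwahori => // i j.
rewrite iw_conjE !cw_coord_tau; apply: vanish_below_epsM.
have [t0 t1 t2] := iw_lin_tau.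
by move: i j; apply: ord3P; apply: ord3P; rewrite /= ?t0 ?t1 ?t2; apply: vanish_belowW (gi _ _).
Qed.

Lemma iwahori_tauV (g : pgl) : iwahori g ->
  iwahori ((iw_rep K tau)^-1 * g * iw_rep K tau)%g.
Proof.
move=> gI; have := iwahori_tau (iwahori_tau gI).
by rewrite conjg_square // -iw_repM tau_tau iw_repV.
Qed.

End Iwahori.

(** * The root subgroup of [s1] *)

(** In the numbering of monomials, [w^-1] sends 0 below the image of 1; this means l(s1 w) > l(w).
    Accordingly [ascent w^-1] means l(w s1) > l(w). *)
Definition ascent (w : iwahori_weyl) : Prop :=
  0 < (iw_lin w 1)%:Z - (iw_lin w 0)%:Z + 3 * (iw_trans w).1.

Section RootSubgroup.
Variable K : fieldType.
Local Notation L := (laurent K).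
Local Notation gl := (gl L 3).
Local Notation pgl := (pgl L 3).
Implicit Types (f : L) (g h : gl) (w x y : iwahori_weyl).

Definition root_mx f : 'M[L]_3 := 1%:M + f *: delta_mx 1 0.

Lemma root_mxE f i j :
  root_mx f i j = (i == j)%:R + f * ((i == 1) && (j == 0))%:R.
Proof. by rewrite !mxE. Qed.

Lemma det_root_mx f : \det (root_mx f) = 1.
Proof.
rewrite det_trig.
  by rewrite big1 // => i _; rewrite root_mxE eqxx; case: eqVneq => [->|]; rewrite mulr0 addr0.
apply/is_trig_mxP => i j ij; rewrite root_mxE.
have /negbTE -> : i != j by rewrite neq_ltn ij.
suff -> : (i == 1) && (j == 0) = false by rewrite mulr0 addr0.
by apply/negP => /andP[_ /eqP j0]; rewrite j0 in ij.
Qed.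

Lemma root_mx_unit f : root_mx f \in unitmx.
Proof. by rewrite unitmxE det_root_mx unitr1. Qed.

Definition root_gl f : gl := Gl (root_mx_unit f).

Lemma root_glD f f' : (root_gl f * root_gl f')%g = root_gl (f + f').
Proof.
apply: val_inj; rewrite /= /root_mx mulmxDl mulmxDr !mul1mx mulmxDr mulmx1.
rewrite -scalemxAl -scalemxAr mul_delta_mx_cond /= !scaler0 addr0 scalerDl.
by rewrite addrAC addrA addrAC.
Qed.

Lemma root_gl0 : root_gl 0 = 1%g.
Proof. by apply: val_inj; rewrite /= /root_mx scale0r addr0. Qed.

Lemma root_glN f : root_gl (- f) = (root_gl f)^-1%g.
Proof. by apply: (mulgI (root_gl f)); rewrite root_glD subrr root_gl0 mulgV. Qed.

Lemma root_gl_iwahori f : integral f -> iwahori_gl (root_gl f).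
Proof.
move=> fi; apply/iwahori_glP; split; last by rewrite /= det_root_mx; exact: valuation1.
have one i : vanish_below 0 (i%:R : L).
  case: i => [|[|i]]; first exact: vanish_below0; first exact: (valuation1 K).1.
  elim: i.+2 => [|n IH]; first exact: vanish_below0.
  by rewrite -natr1; apply: vanish_belowD => //; exact: (valuation1 K).1.
move=> i j; rewrite root_mxE; case: (ltnP i j) => [ij|_].
  have /negbTE -> : i != j by rewrite neq_ltn ij.
  suff -> : (i == 1) && (j == 0) = false by rewrite mulr0 addr0; exact: vanish_below0.
  by apply/negP => /andP[_ /eqP j0]; rewrite j0 in ij.
by apply: vanish_belowD => //; exact: (@vanish_belowMle _ 0 0 0).
Qed.

Definition root_elt (a : K) : pgl := to_pgl (root_gl (lconst a)).

Lemma lconst_integral (a : K) : integral (lconst a).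
Proof. by move=> n n0; rewrite /= /lconst_coef lt_eqF. Qed.

Lemma lconstN (a : K) : lconst (- a) = - lconst a.
Proof.
apply: laurent_eq => n; rewrite lcoefN /= /lconst_coef.
by case: ifP; rewrite ?oppr0.
Qed.

Lemma lconstB (a b : K) : lconst (a - b) = lconst a - lconst b.
Proof.
rewrite -lconstN; apply: laurent_eq => n; rewrite lcoefD /= /lconst_coef.
by case: ifP; rewrite ?addr0.
Qed.

Lemma root_eltB (a b : K) : (root_elt a * (root_elt b)^-1)%g = root_elt (a - b).
Proof. by rewrite -to_pglV -root_glN -to_pglM root_glD -lconstB. Qed.

Lemma root_elt_iwahori (a : K) : iwahori (root_elt a).
Proof. by exists (root_gl (lconst a)) => //; apply/root_gl_iwahori/lconst_integral. Qed.

(** Conjugation moves the entry (1, 0) to the position (i, j) that [x] maps to (1, 0), with a power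
    of eps as factor. [ascent x^-1] is exactly the inequality that keeps this entry in the Iwahori
    subgroup. *)
Lemma root_gl_conj x f : integral f -> ascent x^-1%g ->
  iwahori (iw_rep K x * to_pgl (root_gl f) * (iw_rep K x)^-1)%g.
Proof.
move=> fi ax; apply: conj_iwahori; first by rewrite /= det_root_mx; exact: valuation1.
move=> i j; rewrite iw_conjE; apply: vanish_below_epsM; rewrite root_mxE.
have [<-|ij] := eqVneq i j.
  rewrite ltnn eqxx !subrr; case: eqVneq => [->|_]; rewrite mulr0 addr0; exact: (valuation1 K).1.
have /negbTE -> : iw_lin x i != iw_lin x j by rewrite (inj_eq perm_inj).
rewrite add0r; case: eqVneq => [i1|_]; last by rewrite mulr0; exact: vanish_below0.
case: eqVneq => [j0|_]; last by rewrite mulr0; exact: vanish_below0.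
rewrite mulr1; apply: vanish_belowW fi.
move: ax; rewrite /ascent /= -i1 -j0 !permK.
move: (cw_coord _ i) (cw_coord _ j) (ltn_ord i) (ltn_ord j) => ci cj i3 j3 ax.
by case: ltnP => /=; lia.
Qed.

Lemma s1_lin : [/\ iw_lin s1 0 = 1, iw_lin s1 1 = 0 & iw_lin s1 2 = 2].
Proof. by split; rewrite /= !permE /=. Qed.

Lemma s1V : (s1^-1 = s1)%g.
Proof. 
apply: (mulIg s1); rewrite mulVg; apply: iw_eq => [|i]; rewrite /= ?weyl_act0 ?addr0 //.
by rewrite tperm2.
Qed.

Lemma iwahori_root_decomposition (i : pgl) : iwahori i ->
  exists a, iwahori (iw_rep K s1 * (i * (root_elt a)^-1) * (iw_rep K s1)^-1)%g.
Proof.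
move=> [g gI <-]; have [gd _] := iwahori_residues gI.
(* With this [a] the column operation clears the constant term of the entry (1, 0), the only
   obstruction to conjugating by [s1] inside I. *)
pose a := (g 1 0) 0 / (g 1 1) 0; exists a.
rewrite -to_pglV -to_pglM.
set h := (g * _)%g.
have hI : iwahori_gl h.
  by apply: iwahori_glM => //; apply/iwahori_glV/root_gl_iwahori/lconst_integral.
have [hi dh] := (iwahori_glP h).1 hI.
have h10E : h 1 0 = g 1 0 + g 1 1 * lconst (- a).
  rewrite /h -root_glN -lconstN.
  by rewrite [LHS]mxE ord3_sum !root_mxE /= !(mulr0, mulr1, addr0, add0r).
have h10 : vanish_below 1 (h 1 0).
  move=> n; rewrite (ltzD1 n 0) le_eqVlt => /predU1P[->|]; last exact: (ivanish_integral _ _ hi).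
  rewrite h10E lcoefD.
  rewrite lcoefM_integral; [|exact: (gd 1).1|exact: lconst_integral].
  by rewrite /= /lconst_coef eqxx mulrN /a mulrC divfK ?subrr // (gd 1).2.
apply: (conj_iwahori dh) => k l; rewrite iw_conjE; apply: vanish_below_epsM.
have [e0 e1 e2] := s1_lin; have ck m : cw_coord (iw_trans s1) m = 0 by move: m; apply: ord3P.
rewrite !ck !subr0; move: k l; apply: ord3P; apply: ord3P; rewrite ?e0 ?e1 ?e2;
  by [exact: h10|apply: vanish_belowW (hi _ _)].
Qed.

(** This is an identity in SL_2: the upper unipotent matrix with entry f equals N diag(f, -1/f) s N,
    where s swaps the coordinates and N is lower unipotent with entry 1/f. So [v] is again in the
    root subgroup, whence its conjugation property. *)
Lemma iwahori_s1_root (a : K) : a != 0 -> exists i v,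
  [/\ iwahori i,
      forall x, ascent x^-1%g -> iwahori (iw_rep K x * v * (iw_rep K x)^-1)%g
    & (iw_rep K s1 * root_elt a * iw_rep K s1 = i * iw_rep K s1 * v)%g].
Proof.
move=> a0; pose f := lconst a; have fv := valuation_const a0; rewrite -/f in fv.
have f0 : f != 0 := valuation_neq0 fv.
pose fV := f^-1.
have fVi : integral fV by have := (valuationV fv).1; rewrite oppr0.
(* The default value 1 of [nth] serves as third diagonal entry. *)
pose D : 'rV[L]_3 := \row_i (nth 1 [:: f; - f^-1] i).
have DU : diag_mx D \in unitmx.
  rewrite unitmxE det_diag unitfE; apply/prodf_neq0 => i _; rewrite mxE.
  by move: i; apply: ord3P; rewrite /= ?oppr_eq0 ?invr_eq0 ?oner_eq0.
exists (to_pgl (root_gl fV * Gl DU)%g), (to_pgl (root_gl fV)); split.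
- exists (root_gl fV * Gl DU)%g => //; apply: iwahori_glM.
    exact: root_gl_iwahori.
  apply/iwahori_glP; split=> [i j|] /=.
    rewrite mxE; case: eqVneq => [->|_]; last exact: vanish_below0.
    rewrite mxE ltnn; move: j; apply: ord3P => /=; first exact: fv.1.
    + have := (valuationN (valuationV fv)).1; rewrite oppr0; exact.
    + exact: (valuation1 K).1.
  rewrite det_diag big_ord_recl big_ord_recl big_ord_recl big_ord0 !mxE /= !mulr1.
  rewrite mulrN divff //; exact/valuationN/valuation1.
- by move=> x; exact: root_gl_conj.
pose r := iw_gl K s1.
suff E : (r * root_gl f * r = root_gl fV * Gl DU * r * root_gl fV)%g.
  rewrite -[iw_rep K s1]/(to_pgl r) -(to_pglM r) -(to_pglM (r * _)%g) E.
  by rewrite (to_pglM (_ * _ * r)%g) (to_pglM (_ * _)%g r).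
apply: val_inj; rewrite /= -/r.
have ffV : f * fV = 1 by rewrite mulfV.
have [e0 e1 e2] := s1_lin.
have ck m : cw_coord (iw_trans s1) m = 0 by move: m; apply: ord3P.
have e k l : iw_mx K s1 k l = (iw_lin s1 k == l)%:R by rewrite iw_mxE ck expr0z mul1r.
have dE k l : diag_mx D k l = (nth 1 [:: f; - fV] k) *+ (k == l) by rewrite !mxE.
move: (iw_mx K s1) e (root_mxE f) (root_mxE fV) (diag_mx D) dE => S SE UE VE T TE.
move: (root_mx f) (root_mx fV) UE VE => U V UE VE.
apply/matrixP; apply: ord3P; apply: ord3P; rewrite !mxE !ord3_sum !mxE !ord3_sum;
  rewrite ?mxE ?ord3_sum.
all: rewrite !SE ?UE ?VE ?TE ?e0 ?e1 ?e2 /= !(mulr0, mulr1, mul0r, mul1r, addr0, add0r, mulr1n, mulr0n).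
all: by rewrite ?(mulrC fV f) ?ffV ?mul1r ?addNr.
Qed.

End RootSubgroup.

(** * Bruhat decomposition *)

Lemma cw_coordN l i : cw_coord (- l) i = - cw_coord l i.
Proof.
by apply: (addIr (cw_coord l i)); rewrite -cw_coordD !addNr; move: i; apply: ord3P.
Qed.

Lemma lup_decomposition (F : fieldType) n (M : 'M[F]_n.+1) :
  exists (s : 'S_n.+1) (A U : 'M[F]_n.+1),
    [/\ perm_mx s *m M = A *m U, \det A = 1,
        forall i j : 'I_n.+1, (i <= j)%N -> A i j = (i == j)%:R
      & forall i j : 'I_n.+1, (j < i)%N -> U i j = 0].
Proof.
move: (cormen_lup_correct M) (cormen_lup_perm M) (cormen_lup_lower M).
move: (cormen_lup_upper M) (cormen_lup_detL M); case: (cormen_lup M) => [[P A] U] /=.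
by move=> Uu dA e /is_perm_mxP[s Ps] Al; exists s, A, U; rewrite -Ps.
Qed.

Section Bruhat.
Variable K : fieldType.
Local Notation L := (laurent K).
Local Notation gl := (gl L 3).
Local Notation pgl := (pgl L 3).
Implicit Types (f c : L) (g h : gl) (w x y : iwahori_weyl).

Lemma mul_iw_mxE w M (i j : 'I_3) :
  (M *m iw_mx K w) i (iw_lin w j) = M i j * eps K ^ cw_coord (iw_trans w) j.
Proof.
rewrite mxE (bigD1 j) //= big1 => [|k kj]; last first.
  by rewrite iw_mxE (inj_eq perm_inj) (negbTE kj) !mulr0.
by rewrite iw_mxE eqxx mulr1 addr0.
Qed.

Lemma iw_mx_mulE w M (i j : 'I_3) :
  (iw_mx K w *m M) i j = eps K ^ cw_coord (iw_trans w) i * M (iw_lin w i) j.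
Proof.
rewrite mxE (bigD1 (iw_lin w i)) //= big1 => [|k kj]; last first.
  by rewrite iw_mxE eq_sym (negbTE kj) mulr0 mul0r.
by rewrite iw_mxE eqxx mulr1 addr0.
Qed.

(** Compare the entries at (t, y t). On the left the valuation is known exactly, since the diagonal
    entries of [g] are units; on the right it is bounded below, with an extra 1 when the entry of
    [h] lies above the diagonal. *)
Lemma iwahori_coset_le g h x y c (n : int) (t : 'I_3) :
  iwahori_gl g -> iwahori_gl h -> valuation c n ->
  g *m iw_mx K y = c *: (iw_mx K x *m h) ->
  n + cw_coord (iw_trans x) t + (iw_lin x t < iw_lin y t)%N%:Z
    <= cw_coord (iw_trans y) t.
Proof.
move=> /iwahori_residues[gd _] /iwahori_glP[hi _] cn.
move=> /matrixP/(_ t (iw_lin y t)); rewrite mul_iw_mxE [RHS]mxE iw_mx_mulE => e.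
have := valuationM (gd t) (valuation_eps K (cw_coord (iw_trans y) t)).
rewrite e add0r; apply: vanish_below_valuation.
rewrite -addrA; apply: vanish_belowM cn.1 _.
exact: vanish_belowM (valuation_eps K _).1 (hi _ _).
Qed.

Lemma iwahori_coset_inj i j x y : iwahori i -> iwahori j ->
  (i * iw_rep K y * j)%g = iw_rep K x -> x = y.
Proof.
move=> [g gI <-] [h hI <-].
rewrite /iw_rep -(to_pglM g) -(to_pglM (g * _)%g) => /to_pglP[c c0 /= e].
have [n cn] := valuation_exists c0.
have e1 : g *m iw_mx K y = c *: (iw_mx K x *m (h^-1)%g).
  by rewrite scalemxAl -e -[gl_mx (h^-1)%g]/(invmx h) mulmxK // gl_unit.
have e2 : (g^-1)%g *m iw_mx K x = c^-1 *: (iw_mx K y *m h).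
  rewrite -[gl_mx (g^-1)%g]/(invmx g); apply: (canRL (scalerK c0)).
  by rewrite scalemxAr -e -!mulmxA mulKmx // gl_unit.
(* Adding the two inequalities cancels the scalar and forces both indicators to vanish, so the
   permutations agree; the coordinates then differ by a common shift, which a coweight ignores. *)
have le1 t := iwahori_coset_le t gI (iwahori_glV hI) cn e1.
have le2 t := iwahori_coset_le t (iwahori_glV gI) hI (valuationV cn) e2.
apply: iw_eq => [|t]; last first.
  apply: val_inj => /=; move: (le1 t) (le2 t).
  by case: (ltngtP (iw_lin x t) (iw_lin y t)) => //= _; lia.
rewrite -[LHS]cw_coordK -[RHS]cw_coordK; apply: cw_ofB => k l.
by move: (le1 k) (le2 k) (le1 l) (le2 l); lia.
Qed.

(** Membership in the monoid generated by I and the monomial representatives, phrased as an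
    induction principle for left multiplication, a form that composes along products. *)
Definition iw_generated (g : pgl) := forall P : pgl -> Prop,
  (forall i h : pgl, iwahori i -> P h -> P (i * h)%g) ->
  (forall w (h : pgl), P h -> P (iw_rep K w * h)%g) ->
  forall h : pgl, P h -> P (g * h)%g.

Lemma iw_generatedM (g h : pgl) :
  iw_generated g -> iw_generated h -> iw_generated (g * h)%g.
Proof.
move=> gG hG P PI Pr k Pk; rewrite -mulgA; apply: (gG P PI Pr).
exact: (hG P PI Pr).
Qed.

Lemma iw_generated_rep w : iw_generated (iw_rep K w).
Proof. by move=> P PI Pr h; exact: Pr. Qed.

Lemma iw_generated_iwahori i : iwahori i -> iw_generated i.
Proof. by move=> iI P PI Pr h; exact: PI. Qed.

Lemma iw_generated_conj w (g : pgl) :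
  iw_generated (iw_rep K w * g * (iw_rep K w)^-1)%g -> iw_generated g.
Proof.
move=> gG; have -> : g = (iw_rep K w^-1%g * (iw_rep K w * g * (iw_rep K w)^-1) * iw_rep K w)%g.
  by rewrite iw_repV; set r := iw_rep K w; clearbody r; rewrite !mulgA mulVg mul1g mulgKV.
by apply: iw_generatedM (@iw_generated_rep _); apply: iw_generatedM (@iw_generated_rep _) gG.
Qed.

Lemma iw_generated_lower_unit g :
  is_trig_mx g -> (forall i, valuation (g i i) 0) -> iw_generated (to_pgl g).
Proof.
move=> gt gd; have dg : valuation (\det g) 0.
  by rewrite det_trig //; have := valuation_prod (index_enum 'I_3) gd; rewrite big1_eq.
have [N gN] : exists N : nat, forall i j, vanish_below (- N%:Z) (g i j).
  have bnd i j : exists N : nat, vanish_below (- N%:Z) (g i j).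
    have [a ga] := laurent_bound (g i j); exists `|a|%N; apply: vanish_belowW ga; lia.
  pose N i j := projT1 (cid (bnd i j)).
  exists (\max_i \max_j N i j)%N => i j.
  apply: vanish_belowW (projT2 (cid (bnd i j))); rewrite lerN2 lez_nat.
  exact: leq_trans (leq_bigmax j) (leq_bigmax i).
(* Conjugation by [w] multiplies the entry (i, j) by eps^((i - j)(N + 1)), which makes every entry
   below the diagonal integral. *)
pose w := t_ (- N.+1%:Z, - N.+1%:Z).
apply: (@iw_generated_conj w); apply: iw_generated_iwahori.
apply: conj_iwahori => // i j; rewrite iw_conjE !perm1; apply: vanish_below_epsM.
have ci k : cw_coord (iw_trans w) k = - ((2 - k)%N%:Z * N.+1%:Z).
  by move: k; apply: ord3P; rewrite /cw_coord /=; lia.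
have [ij|ji] := ltnP i j.
  by rewrite (is_trig_mxP gt) //; exact: vanish_below0.
have [->|ij] := eqVneq i j; first by rewrite subrr subr0; exact: (gd j).1.
apply: vanish_belowW (gN i j); rewrite !ci.
have {ij ji} : (j < i)%N by rewrite ltn_neqAle eq_sym ij.
by move: i j; apply: ord3P; apply: ord3P => //= _; lia.
Qed.

Lemma iw_generated_lower g : is_trig_mx g -> iw_generated (to_pgl g).
Proof.
move=> gt; have gd i : exists n, valuation (g i i) n.
  apply: valuation_exists; have := gl_unit g.
  by rewrite unitmxE det_trig // unitfE => /prodf_neq0; exact.
pose m i := projT1 (cid (gd i)); have gm i : valuation (g i i) (m i) := projT2 (cid (gd i)).
pose w := t_ (cw_of m).
(* Multiplying row i by eps^(- m i) makes the diagonal entries units. The scalar in front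
   compensates for the last coordinate, which coweights normalise to 0. *)
have hU : eps K ^ (- m 2) *: (iw_mx K w^-1%g *m g) \in unitmx.
  have e0 : eps K ^ (- m 2) != 0 by rewrite expfz_neq0 // eps_neq0.
  by rewrite unitmxZ ?unitfE // (gl_unit (iw_gl K w^-1%g * g)%g).
pose h := Gl hU.
have -> : to_pgl g = (iw_rep K w * to_pgl h)%g.
  have -> : to_pgl h = (iw_rep K w^-1%g * to_pgl g)%g.
    rewrite -(to_pglM _ g); apply/to_pglP; exists (eps K ^ (- m 2)) => //.
    by rewrite expfz_neq0 // eps_neq0.
  by rewrite iw_repV mulKVg.
apply: iw_generatedM; first exact: iw_generated_rep.
have hE i j : h i j = eps K ^ (- m i) * g i j.
  rewrite [LHS]mxE iw_mx_mulE mulrA -expfzDr ?eps_neq0 //.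
  rewrite -[iw_lin _]/(1^-1)%g -[iw_trans _]/(- weyl_act (1^-1)%g (cw_of m)).
  by rewrite invg1 perm1 weyl_act1 cw_coordN cw_coord_of; congr (eps K ^ _ * _); lia.
apply: iw_generated_lower_unit => [|i]; last first.
  by rewrite hE -(addNr (m i)); apply: valuationM => //; exact: valuation_eps.
by apply/is_trig_mxP => i j ij; rewrite hE (is_trig_mxP gt) // mulr0.
Qed.

Lemma iw_generated_perm (s : 'S_3) g : (g : 'M_3) = perm_mx s -> iw_generated (to_pgl g).
Proof.
move=> gs; suff -> : to_pgl g = iw_rep K (IwahoriWeyl 0 s) by exact: iw_generated_rep.
rewrite /iw_rep; congr to_pgl; apply: val_inj; apply/matrixP => i j.
rewrite -[val g]/(g : 'M_3) gs -[val _]/(iw_mx K _) iw_mxE /= !mxE.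
rewrite (_ : cw_coord 0 i = 0) ?expr0z ?mul1r //.
by move: i; apply: ord3P.
Qed.

(** The LUP decomposition leaves permutation matrices and triangular ones; the longest permutation
    turns the upper triangular factor into a lower triangular one. *)
Lemma iw_generated_all (g : pgl) : iw_generated g.
Proof.
elim/pgl_ind: g => g.
have [s [A [U [e dA Al Uu]]]] := lup_decomposition (g : 'M_3).
have AU : A \in unitmx by rewrite unitmxE dA unitr1.
have UU : U \in unitmx.
  have : perm_mx s *m g \in unitmx by rewrite unitmx_mul unitmx_perm gl_unit.
  by rewrite e unitmx_mul => /andP[].
have VU : (perm_mx s^-1%g : 'M[L]_3) \in unitmx by exact: unitmx_perm.
have -> : g = (Gl VU * (Gl AU * Gl UU))%g.
  apply: val_inj => /=; rewrite -e mulmxA -perm_mxM.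
  by rewrite mulVg perm_mx1 mul1mx.
rewrite (to_pglM (Gl VU)) (to_pglM (Gl AU)); apply: iw_generatedM.
  exact: iw_generated_perm.
apply: iw_generatedM.
  apply: iw_generated_lower; apply/is_trig_mxP => i j ij /=.
  by rewrite Al ?(ltnW ij) // (_ : (i == j) = false) //; apply/negbTE; rewrite neq_ltn ij.
pose w := IwahoriWeyl 0 (tperm 0 2).
apply: (@iw_generated_conj w); rewrite -to_pgl_conj; apply: iw_generated_lower.
apply/is_trig_mxP => i j ij; rewrite iw_conjE Uu ?mulr0 //=.
by move: i j ij; apply: ord3P; apply: ord3P; rewrite /= !permE.
Qed.

End Bruhat.

(** * Two invariants of a conjugate *)

(** The valuation of the determinant of [iw_mx w]. Scalars change it by multiples of 3; modulo 3 it
    is the Kottwitz invariant of PGL_3. *)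
Definition kottwitz (w : iwahori_weyl) : int := (iw_trans w).1 + (iw_trans w).2 *+ 2.

Section Obstructions.
Variable K : fieldType.
Local Notation L := (laurent K).
Local Notation gl := (gl L 3).
Local Notation pgl := (pgl L 3).
Variables (g i j : pgl) (x w : iwahori_weyl).
Hypotheses (iI : iwahori i) (jI : iwahori j).
Hypothesis conj_eq : (g^-1 * iw_rep K x * g = i * iw_rep K w * j)%g.

Lemma conj_eq_gl : exists (g' i' j' : gl) (c : L), [/\ iwahori_gl i', iwahori_gl j', c != 0
  & invmx g' *m iw_mx K x *m g' = c *: (i' *m iw_mx K w *m j')].
Proof.
have [i' i'I ii'] := iI; have [j' j'I jj'] := jI.
have gg' := pgl_reprK g; set g' := pgl_repr g in gg'.
have : to_pgl (g'^-1 * iw_gl K x * g')%g = to_pgl (i' * iw_gl K w * j')%g.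
  rewrite (to_pglM (g'^-1 * _)%g) (to_pglM g'^-1%g) to_pglV (to_pglM (i' * _)%g) (to_pglM i').
  by rewrite gg' ii' jj'.
case/to_pglP=> c c0 e.
by exists g', i', j', c.
Qed.

Lemma kottwitz_conj : exists n, kottwitz w = kottwitz x + n *+ 3.
Proof.
have [g' [i' [j' [c [i'I j'I c0 e]]]]] := conj_eq_gl.
have [m cm] := valuation_exists c0; exists (- m).
have det_rep y : valuation (\det (iw_mx K y)) (kottwitz y).
  rewrite det_mulmx det_diag -[kottwitz y]addr0; apply: valuationM.
    have -> : kottwitz y = \sum_(i < 3) cw_coord (iw_trans y) i.
      by rewrite ord3_sum /cw_coord /= /kottwitz; lia.
    apply: (@valuation_prod _ _ _ _ (cw_coord (iw_trans y))) => k.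
    by rewrite mxE; exact: valuation_eps.
  by rewrite det_perm; case: odd_perm; rewrite ?expr0; [apply: valuationN|]; exact: valuation1.
have {e} := congr1 determinant e.
have g'0 : \det g' \is a GRing.unit by rewrite -unitmxE gl_unit.
rewrite detZ (det_mulmx _ g') (det_mulmx (invmx g')) det_inv mulrAC mulVr // mul1r.
rewrite (det_mulmx _ j') (det_mulmx i') => e.
have c3 : valuation (c ^+ 3) (m + (m + m)) by apply: valuationM cm (valuationM cm cm).
have := valuationM c3 (valuationM (valuationM ((iwahori_glP i').1 i'I).2 (det_rep w))
          ((iwahori_glP j').1 j'I).2).
rewrite -e => v1; have v2 := det_rep x.
by have := valuation_uniq v1 v2; lia.
Qed.

(* A conjugate of [iw_rep x] has trace [0] when [x] permutes the coordinates
   without fixed point, whereas here the term of index [k] dominates the trace. *)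
Lemma trace_obstruction (k : 'I_3) : (forall t, iw_lin x t != t) ->
  iw_lin w k = k ->
  (forall t, t != k ->
     cw_coord (iw_trans w) k < cw_coord (iw_trans w) t + (iw_lin w t < t)%N%:Z) ->
  False.
Proof.
move=> xt wk wt; have [g' [i' [j' [c [i'I j'I c0 e]]]]] := conj_eq_gl.
have {e} := congr1 mxtrace e.
rewrite mxtrace_mulC mulmxA mulmxV ?gl_unit // mul1mx linearZ /= => e.
have tr0 : \tr (iw_mx K x) = 0.
  by apply: big1 => t _; rewrite iw_mxE (negbTE (xt t)) mulr0.
move: e; rewrite tr0 => /esym/eqP; rewrite mulf_eq0 (negbTE c0) /= mxtrace_mulC mulmxA.
pose M := (j' *m i' : 'M[L]_3); rewrite -/M; have MI : iwahori_gl (j' * i')%g by exact: iwahori_glM.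
have [Md _] := iwahori_residues MI; have [Mi _] := (iwahori_glP _).1 MI.
have {}Md t : valuation (M t t) 0 := Md t.
have {}Mi : ivanish M := Mi.
(* After a cyclic permutation under the trace, the term of index t is the entry (w t, t) of an
   element of I times a power of eps; at t = k this entry is diagonal, hence a unit. *)
rewrite /mxtrace (reindex_inj (@perm_inj _ (iw_lin w))) /=.
under eq_bigr => t _ do rewrite mul_iw_mxE.
apply/negP; apply: (@valuation_dominant _ _ _ k (cw_coord (iw_trans w) k)) => [|t tk].
  by rewrite wk -[X in valuation _ X]add0r; apply: valuationM => //; exact: valuation_eps.
apply: vanish_belowMle (Mi _ _) (valuation_eps K _).1.
by have := wt t tk; lia.
Qed.

End Obstructions.

(** * Iwahori systems *)

Lemma ascent_s1 w : ascent (s1 * w)%g <-> ~ ascent w.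
Proof.
case: w => [[a b] v]; rewrite /ascent /= !permE /= /weyl_act /cw_of /cw_coord /= !permE /=.
have : v 0 != v 1 by rewrite (inj_eq perm_inj).
case: (v 0) (v 1) => [m m3] [n n3] /eqP mn; have {}mn : m <> n by move=> e; apply: mn; exact: val_inj.
by split=> /=; lia.
Qed.

(** The root subgroup of [s1] alone is recorded, since conjugation by [tau] reaches the other simple
    reflections. The clause on [v] in [sys_s1_root] makes it behave like an element of that
    subgroup. *)
Record iwahori_system (K : fieldType) := IwahoriSystem {
  sys_group :> groupType;
  sys_I : set sys_group;
  sys_rep : iwahori_weyl -> sys_group;
  sys_root : K -> sys_group;
  sys_I1 : sys_I 1%g;
  sys_IM : forall g h, sys_I g -> sys_I h -> sys_I (g * h)%g;
  sys_IV : forall g, sys_I g -> sys_I g^-1%g;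
  sys_repM : forall x y, sys_rep (x * y)%g = (sys_rep x * sys_rep y)%g;
  sys_tau : forall g, sys_I g -> sys_I (sys_rep tau * g * (sys_rep tau)^-1)%g;
  sys_tauV : forall g, sys_I g -> sys_I ((sys_rep tau)^-1 * g * sys_rep tau)%g;
  sys_root_I : forall a, sys_I (sys_root a);
  sys_rootB : forall a b, (sys_root a * (sys_root b)^-1)%g = sys_root (a - b);
  sys_root_conj : forall a x, ascent x^-1%g ->
    sys_I (sys_rep x * sys_root a * (sys_rep x)^-1)%g;
  sys_decomposition : forall i, sys_I i ->
    exists a, sys_I (sys_rep s1 * (i * (sys_root a)^-1) * (sys_rep s1)^-1)%g;
  sys_s1_root : forall a, a != 0 -> exists i v,
    [/\ sys_I i,
        forall x, ascent x^-1%g -> sys_I (sys_rep x * v * (sys_rep x)^-1)%g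
      & (sys_rep s1 * sys_root a * sys_rep s1 = i * sys_rep s1 * v)%g];
  sys_inj : forall i j x y, sys_I i -> sys_I j ->
    (i * sys_rep y * j)%g = sys_rep x -> x = y;
  sys_generated : forall (P : set sys_group) g,
    (forall i h, sys_I i -> P h -> P (i * h)%g) ->
    (forall w h, P h -> P (sys_rep w * h)%g) -> P 1%g -> P g }.

Section BruhatTits.
Variables (K : fieldType) (S : iwahori_system K).
Implicit Types (g h i j : S) (w x y : iwahori_weyl).
Local Notation I := (@sys_I K S).
Local Notation r := (@sys_rep K S).
Local Notation u := (@sys_root K S).

Definition bruhat_cell w g := exists i j, [/\ I i, I j & g = (i * r w * j)%g].
Local Notation D := bruhat_cell.

Lemma sys_rep1 : r 1%g = 1%g.
Proof. by apply: (mulIg (r 1%g)); rewrite -sys_repM !mul1g. Qed.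

Lemma sys_repV w : r w^-1%g = (r w)^-1%g.
Proof. by apply: (mulIg (r w)); rewrite -sys_repM !mulVg sys_rep1. Qed.

Lemma bruhat_cell_rep w : D w (r w).
Proof. by exists 1%g, 1%g; rewrite mul1g mulg1; split=> //; exact: sys_I1. Qed.

Lemma bruhat_cellIl i w g : I i -> D w g -> D w (i * g)%g.
Proof.
move=> iI [i' [j [i'I jI ->]]]; exists (i * i')%g, j.
by rewrite !mulgA; split=> //; exact: sys_IM.
Qed.

Lemma bruhat_cellIr j w g : I j -> D w g -> D w (g * j)%g.
Proof.
move=> jI [i [j' [iI j'I ->]]]; exists i, (j' * j)%g.
by rewrite !mulgA; split=> //; exact: sys_IM.
Qed.

Lemma bruhat_cellV w g : D w g -> D w^-1%g g^-1%g.
Proof.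
move=> [i [j [iI jI ->]]]; exists j^-1%g, i^-1%g.
by rewrite sys_repV !invgM !mulgA; split=> //; exact: sys_IV.
Qed.

Lemma bruhat_cell_inj x y g : D x g -> D y g -> x = y.
Proof.
move=> [i [j [iI jI ->]]] [i' [j' [i'I j'I e]]].
apply: (@sys_inj _ S (i^-1 * i')%g (j' * j^-1)%g).
- by apply: sys_IM => //; exact: sys_IV.
- by apply: sys_IM => //; exact: sys_IV.
- by apply: (mulIg j); apply: (mulgI i); rewrite !mulgA mulgKV mulgV mul1g e.
Qed.

Lemma bruhat_cell1 g : D 1%g g <-> I g.
Proof.
split=> [[i [j [iI jI ->]]]|gI]; first by rewrite sys_rep1 mulg1; exact: sys_IM.
by rewrite -[g]mulg1; apply: bruhat_cellIl => //; rewrite -sys_rep1; exact: bruhat_cell_rep.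
Qed.

Lemma bruhat_cell_tau w g : D w g -> D (tau * w)%g (r tau * g)%g.
Proof.
move=> [i [j [iI jI ->]]]; exists (r tau * i * (r tau)^-1)%g, j.
by split=> //; [exact: sys_tau|rewrite (sys_repM S tau w) !mulgA mulgKV].
Qed.

Lemma bruhat_cell_tauV w g : D w g -> D (tau^-1 * w)%g ((r tau)^-1 * g)%g.
Proof.
move=> [i [j [iI jI ->]]]; exists ((r tau)^-1 * i * r tau)%g, j.
by split=> //; [exact: sys_tauV|rewrite (sys_repM S tau^-1%g) sys_repV !mulgA mulgK].
Qed.

Lemma mulg_bruhat_cell_tau w g : D w g -> D (w * tau)%g (g * r tau)%g.
Proof.
move=> /bruhat_cellV/bruhat_cell_tauV/bruhat_cellV.
by rewrite !invgM !invgK.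
Qed.

Lemma mulg_bruhat_cell_tauV w g : D w g -> D (w * tau^-1)%g (g * (r tau)^-1)%g.
Proof.
move=> /bruhat_cellV/bruhat_cell_tau/bruhat_cellV.
by rewrite !invgM !invgK.
Qed.

Lemma s1_involution : (s1 * s1 = 1)%g.
Proof. by rewrite -[X in (X * _)%g]s1V mulVg. Qed.

(** The factor of I between [s1] and [w] is split as k' (u a), with k' conjugated into I by [s1].
    Then k' moves left past [s1], and [u a] moves right past [w] because [w] is an ascent. *)
Lemma bruhat_cell_s1 w g h :
  ascent w -> D s1 g -> D w h -> D (s1 * w)%g (g * h)%g.
Proof.
move=> aw [i [j [iI jI ->]]] [i' [j' [i'I j'I ->]]].
have [a] := sys_decomposition (sys_IM jI i'I).
set k := (r s1 * _ * _)%g => kI.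
have wuI : I (r w^-1 * u a * (r w^-1)^-1)%g by apply: sys_root_conj; rewrite invgK.
exists (i * k)%g, (r w^-1 * u a * (r w^-1)^-1 * j')%g; split; try exact: sys_IM.
by rewrite (sys_repM S s1) sys_repV invgK /k !mulgA mulgKV mulgK mulgKV.
Qed.

Lemma bruhat_cell_s1_or w g h : D s1 g -> D w h ->
  D (s1 * w)%g (g * h)%g \/ D w (g * h)%g.
Proof.
move=> Dg Dh; have [aw|/ascent_s1] := pselect (ascent w).
  by left; exact: bruhat_cell_s1.
(* If [w] is not an ascent, [w'] is one, and the product contains s1 (u a) s1: it is 1 when a = 0,
   and otherwise lies in I s1 v with v able to move past [w']. *)
set w' := (s1 * w)%g; have ww' : w = (s1 * w')%g by rewrite mulgA s1_involution mul1g.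
move=> aw'; move: Dg Dh => [i [j [iI jI ->]]] [i' [j' [i'I j'I ->]]].
have [a] := sys_decomposition (sys_IM jI i'I).
set k := (r s1 * _ * _)%g => kI.
have e : (i * r s1 * j * (i' * r w * j') = i * k * (r s1 * u a * r s1) * r w' * j')%g.
  by rewrite [in LHS]ww' (sys_repM S s1) /k !mulgA !mulgKV.
have [a0|a0] := eqVneq a 0.
  left; exists (i * k)%g, j'; split=> //; first exact: sys_IM.
  rewrite e a0 -(subrr 0) -sys_rootB mulgV mulg1 -sys_repM s1_involution sys_rep1 mulg1.
  by [].
right; have [k' [v [k'I vI e']]] := sys_s1_root S a0.
have wvI : I (r w'^-1 * v * (r w'^-1)^-1)%g by apply: vI; rewrite invgK.
exists (i * k * k')%g, (r w'^-1 * v * (r w'^-1)^-1 * j')%g; split; try exact: sys_IM.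
  by apply: sys_IM => //; exact: sys_IM.
rewrite e -(mulgA (i * k)%g) -(mulgA (i * k)%g) e' [in RHS]ww' (sys_repM S s1).
by rewrite sys_repV invgK !mulgA mulgK.
Qed.

Lemma mulg_bruhat_cell_s1 w g h :
  ascent w^-1%g -> D w g -> D s1 h -> D (w * s1)%g (g * h)%g.
Proof.
move=> aw /bruhat_cellV Dg /bruhat_cellV; rewrite s1V => Dh.
by have /bruhat_cellV := bruhat_cell_s1 aw Dh Dg; rewrite !invgM !invgK s1V.
Qed.

Lemma mulg_bruhat_cell_s1_or w g h : D w g -> D s1 h ->
  D (w * s1)%g (g * h)%g \/ D w (g * h)%g.
Proof.
move=> /bruhat_cellV Dg /bruhat_cellV; rewrite s1V => Dh.
by case: (bruhat_cell_s1_or Dh Dg) => /bruhat_cellV; rewrite !invgM !invgK ?s1V; [left|right].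
Qed.

Lemma bruhat_decomposition g : exists w, D w g.
Proof.
apply: (@sys_generated _ S (fun g => exists w, D w g)) => [i h iI [w Dh]|w h|].
- by exists w; exact: bruhat_cellIl.
- have stau h' : (exists w, D w h') -> exists w, D w (r tau * h')%g.
    by move=> [x Dh]; exists (tau * x)%g; exact: bruhat_cell_tau.
  have ss1 h' : (exists w, D w h') -> exists w, D w (r s1 * h')%g.
    move=> [x Dh]; have := bruhat_cell_s1_or (bruhat_cell_rep s1) Dh.
    by case; [exists (s1 * x)%g|exists x].
  have stauV h' : (exists w, D w h') -> exists w, D w (r tau^-1 * h')%g.
    by move=> [x Dh]; exists (tau^-1 * x)%g; rewrite sys_repV; exact: bruhat_cell_tauV.
  have [n /asboolP[v [m [_ vS ->]]]] := word_ex w.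
  have : forall k, (exists w, D w (h : S)) -> exists w, D w (r (tau ^+ k)%g * h)%g.
    elim=> [|k IH]; first by rewrite expg0 sys_rep1 mul1g.
    by move=> /IH; rewrite expgS sys_repM -mulgA; exact: stau.
  rewrite sys_repM -mulgA => /(_ m); move: (r (tau ^+ m) * h)%g => h' H /H {H}.
  elim: v vS => [|y v IH] vS; first by rewrite big_nil sys_rep1 mul1g.
  have vS' : {subset v <= [:: s0; s1; s2]} by move=> z zv; apply: vS; rewrite inE zv orbT.
  rewrite big_cons sys_repM -mulgA => /(IH vS'); move: (r _ * h')%g => h''.
  have := vS y (mem_head _ _); rewrite !inE => /or3P[] /eqP -> Dh.
  + have -> : s0 = (tau^-1 * (s1 * tau))%g by rewrite -tau_s0 mulKg.
    by rewrite (sys_repM S tau^-1%g) (sys_repM S s1) -!mulgA; apply/stauV/ss1/stau.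
  + exact: ss1.
  + have -> : s2 = (tau * (s1 * tau^-1))%g by rewrite mulgA tau_s1 mulgK.
    by rewrite (sys_repM S tau) (sys_repM S s1) -!mulgA; apply/stau/ss1/stauV.
- by exists 1%g; apply/bruhat_cell1; exact: sys_I1.
Qed.

(** * Panels and chambers *)

Lemma panel_cell a : D s1 (u a * r s1)%g.
Proof. by apply: bruhat_cellIl; [exact: sys_root_I|exact: bruhat_cell_rep]. Qed.

Lemma sys_root0 : u 0 = 1%g.
Proof. by rewrite -(subrr 0) -sys_rootB mulgV. Qed.

Lemma sys_rootN a : u (- a) = (u a)^-1%g.
Proof. by rewrite -sub0r -sys_rootB sys_root0 mul1g. Qed.

Lemma sys_s1V : (r s1)^-1%g = r s1.
Proof. by rewrite -sys_repV s1V. Qed.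

(** Together with [panel_inj], this parametrizes I s1 I / I by K: a panel has as many chambers
    besides its base as K has elements. *)
Lemma panel_exists g : D s1 g -> exists a, I ((u a * r s1)^-1 * g)%g.
Proof.
move=> [i [j [iI jI ->]]]; have [a kI] := sys_decomposition (sys_IV iI).
exists (- a); rewrite sys_rootN.
have := sys_IM (sys_IV kI) jI; congr I.
by rewrite !invgM !invgK !mulgA sys_s1V.
Qed.

Lemma bruhat_cell_root_s1 a : a != 0 -> D s1 (r s1 * u a * r s1)%g.
Proof.
move=> /(sys_s1_root S)[i [v [iI vI ->]]]; exists i, v; split=> //.
have := vI 1%g; rewrite sys_rep1 mul1g !invg1 mulg1; apply.
by rewrite /ascent /= !perm1.
Qed.

Lemma panel_cell_neq a b : a != b -> D s1 ((u a * r s1)^-1 * (u b * r s1))%g.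
Proof.
have -> : ((u a * r s1)^-1 * (u b * r s1) = r s1 * u (b - a) * r s1)%g.
  rewrite invgM sys_s1V !mulgA; congr (_ * _)%g; rewrite -!mulgA; congr (_ * _)%g.
  by rewrite -!sys_rootN -[in LHS](opprK b) (sys_rootN (- b)) sys_rootB opprK addrC.
by move=> ab; apply: bruhat_cell_root_s1; rewrite subr_eq0 eq_sym.
Qed.

Lemma s1_neq1 : s1 <> 1%g.
Proof. by move=> /(congr1 iw_lin) /permP /(_ 0); rewrite perm1 permE. Qed.

Lemma panel_inj a b : I ((u a * r s1)^-1 * (u b * r s1))%g -> a = b.
Proof.
move=> /bruhat_cell1 abI; apply/eqP/negPn/negP => /panel_cell_neq Dab.
exact/s1_neq1/(bruhat_cell_inj Dab abI).
Qed.

Lemma panel_projection w g : D (s1 * w)%g g -> exists a, D w ((u a * r s1)^-1 * g)%g.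
Proof.
move=> [i [j [iI jI ->]]].
have Di : D s1 (i * r s1)%g by apply: bruhat_cellIl => //; exact: bruhat_cell_rep.
have [a aI] := panel_exists Di; exists a; exists ((u a * r s1)^-1 * (i * r s1))%g, j.
by split=> //; rewrite (sys_repM S s1) !mulgA.
Qed.

(** For a <> b the two panel elements differ by an element of I s1 I, which would carry the cell of
    [w] to that of [s1 * w]. *)
Lemma panel_projection_uniq w g a b : ascent w ->
  D w ((u a * r s1)^-1 * g)%g -> D w ((u b * r s1)^-1 * g)%g -> a = b.
Proof.
move=> aw Da Db; apply/eqP/negPn/negP => /panel_cell_neq ab.
have := bruhat_cell_s1 aw ab Db; rewrite -mulgA mulVKg => /(bruhat_cell_inj Da) e.
by apply: s1_neq1; apply: (mulIg w); rewrite mul1g -e.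
Qed.

Definition chamber g : set S := fun h => I (g^-1 * h)%g.

Lemma chamberP g h : chamber g = chamber h <-> I (g^-1 * h)%g.
Proof.
split=> [gh|ghI].
  have : chamber h h by rewrite /chamber /= mulVg; exact: sys_I1.
  by rewrite -gh.
apply/seteqP; split=> x /= xI.
  have := sys_IM (sys_IV ghI) xI; rewrite invgM invgK !mulgA mulgK; exact.
by have := sys_IM ghI xI; rewrite !mulgA mulgK.
Qed.

Lemma panel_trans g h h' : D s1 (g^-1 * h)%g -> D s1 (g^-1 * h')%g ->
  chamber h = chamber h' \/ D s1 (h^-1 * h')%g.
Proof.
move=> /bruhat_cellV; rewrite invgM invgK s1V => Dh Dh'.
have := bruhat_cell_s1_or Dh Dh'; rewrite s1_involution !mulgA mulgK.
by case=> [/bruhat_cell1|]; [left; apply/chamberP|right].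
Qed.

End BruhatTits.

(** * Counting chambers by Deligne-Lusztig reduction *)

Lemma fibration_count (T : eqType) (A : T -> Prop) (R : T -> T -> Prop)
    (m : T -> nat) (sB : seq T) : uniq sB ->
  (forall y, y \in sB -> exists s, [/\ uniq s, size s = m y
     & forall x, x \in s <-> A x /\ R x y]) ->
  (forall x y z, y \in sB -> z \in sB -> A x -> R x y -> R x z -> y = z) ->
  (forall x, A x -> exists2 y, y \in sB & R x y) ->
  exists s, [/\ uniq s, size s = (\sum_(y <- sB) m y)%N & forall x, x \in s <-> A x].
Proof.
move=> sBu fib uni tot.
have key sC : uniq sC -> {subset sC <= sB} -> exists s,
    [/\ uniq s, size s = (\sum_(y <- sC) m y)%N
      & forall x, x \in s <-> A x /\ exists2 y, y \in sC & R x y]; last first.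
  have [s [su ss sA]] := key sB sBu (fun _ => id).
  exists s; split=> // x; rewrite sA; split=> [[]//|Ax]; split=> //; exact: tot.
elim: sC => [|y sC IH] /= sCu sub.
  by exists [::]; rewrite big_nil; split=> // x; rewrite in_nil; split=> // -[_ []].
have [ysC {}sCu] := andP sCu.
have subC : {subset sC <= sB} by move=> z zC; apply: sub; rewrite inE zC orbT.
have yB : y \in sB by apply: sub; exact: mem_head.
have [s [su ss sP]] := IH sCu subC; have [s' [s'u s's s'P]] := fib y yB.
exists (s' ++ s); split.
- rewrite cat_uniq s'u su andbT /=; apply/hasPn => x /sP[Ax [z zC Rz]].
  apply/negP => /s'P[_ Ry]; move: ysC; rewrite (uni x y z) ?zC //; exact: subC.
- by rewrite size_cat ss s's big_cons.
move=> x; rewrite mem_cat; split.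
  case/orP => [/s'P[Ax Ry]|/sP[Ax [z zC Rz]]]; split=> //.
    by exists y => //; exact: mem_head.
  by exists z => //; rewrite inE zC orbT.
move=> [Ax [z]]; rewrite inE => /predU1P[->|zC] Rz; apply/orP.
  by left; apply/s'P.
by right; apply/sP; split=> //; exists z.
Qed.

Definition cycle3 : 'S_3 := (tperm 0 1%R * tperm 1%R 2%R)%g.
Definition cycle3V : 'S_3 := (tperm 1%R 2%R * tperm 0 1%R)%g.

Lemma cycle3E : [/\ cycle3 0 = 2, cycle3 1 = 0 & cycle3 2 = 1].
Proof. by split; rewrite /cycle3 !permM !permE /=. Qed.

Lemma cycle3VE : [/\ cycle3V 0 = 1, cycle3V 1 = 2 & cycle3V 2 = 0].
Proof. by split; rewrite /cycle3V !permM !permE /=. Qed.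

Lemma tauE : tau = IwahoriWeyl (1, 0) cycle3.
Proof. by apply: iw_eq => [|i]; rewrite /= ?weyl_act0 ?addr0 // mul1g. Qed.

Lemma tau_neq1 : tau <> 1%g.
Proof. by move=> /(congr1 (fun x => (iw_trans x).1)); rewrite tauE. Qed.

Lemma iw_centralizer_tau (y : iwahori_weyl) : (tau * y = y * tau)%g ->
  y \in [:: 1; tau; tau * tau]%g.
Proof.
rewrite tauE; have [c0 c1 c2] := cycle3E.
case: y => [[a b] v] /[dup] /(congr1 iw_lin) /permP e /(congr1 iw_trans) /=.
have := e 2; have := e 0; rewrite /= !(permM cycle3 v) !(permM v cycle3) c0 c2 => v2 v1.
rewrite /weyl_act /cw_of c0 c1 c2 /cw_coord => trans.
have fin (x y : iwahori_weyl) : iw_trans x = iw_trans y -> iw_lin x 0 = iw_lin y 0 ->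
    iw_lin x 1 = iw_lin y 1 -> iw_lin x 2 = iw_lin y 2 -> x = y.
  by move=> xy e0 e1 e2; apply: iw_eq => //; apply: ord3P.
have [v0|v0|v0] : [\/ v 0 = 0, v 0 = 1 | v 0 = 2].
  by move: (v 0); apply: ord3P; [exact: Or31|exact: Or32|exact: Or33].
all: rewrite v0 ?c0 ?c1 ?c2 in v2; rewrite v2 ?c0 ?c1 ?c2 in v1.
all: move: trans; rewrite v0 v1 v2 => /= -[ea eb].
- have [-> ->] : a = 0 /\ b = 0 by lia.
  by rewrite !inE; apply/or3P; apply: Or31; apply/eqP; apply: fin; rewrite /= ?perm1.
- have [-> ->] : a = 0 /\ b = 1 by lia.
  rewrite !inE; apply/or3P; apply: Or33; apply/eqP; apply: fin;
    by rewrite /= ?(permM cycle3 cycle3) ?v0 ?v1 ?v2 ?c0 ?c1 ?c2 //= /weyl_act /cw_of c0 c1 c2.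
- have [-> ->] : a = 1 /\ b = 0 by lia.
  by rewrite !inE; apply/or3P; apply: Or32; apply/eqP; apply: fin; rewrite /= ?c0 ?c1 ?c2.
Qed.

Section Counting.
Variables (K : finFieldType) (S : iwahori_system K).
Implicit Types (g h i j : S) (w x y : iwahori_weyl) (C : set S).
Local Notation I := (@sys_I K S).
Local Notation r := (@sys_rep K S).
Local Notation u := (@sys_root K S).
Local Notation D := (@bruhat_cell K S).
Local Notation chamber := (@chamber K S).
Local Notation t := (r tau).

Definition fiber w C := exists2 g, C = chamber g & D w (g^-1 * t * g)%g.

(** An enumeration, so that the recursion proves finiteness along with the size. *)
Definition fiber_card w (n : nat) := exists s : seq (set S),
  [/\ uniq s, size s = n & forall C, C \in s <-> fiber w C].

Lemma fiberP w g : fiber w (chamber g) <-> D w (g^-1 * t * g)%g.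
Proof.
split=> [[h /chamberP ghI Dh]|Dg]; last by exists g.
have := bruhat_cellIl ghI (bruhat_cellIr (sys_IV ghI) Dh).
by rewrite invgM invgK !mulgA !mulgK.
Qed.

Lemma fiber_inj x y C : fiber x C -> fiber y C -> x = y.
Proof. by move=> [g -> Dx] /fiberP; exact: bruhat_cell_inj. Qed.

Definition panel g : seq (set S) := [seq chamber (g * (u a * r s1))%g | a <- enum K].

Lemma panel_uniq g : uniq (panel g).
Proof.
rewrite map_inj_uniq ?enum_uniq // => a b /chamberP.
by rewrite invgM -!mulgA mulKg => /panel_inj.
Qed.

Lemma size_panel g : size (panel g) = #|K|.
Proof. by rewrite size_map cardE. Qed.

Lemma panelP g h : chamber h \in panel g <-> D s1 (g^-1 * h)%g.
Proof.
split=> [/mapP[a _ /chamberP hI]|/panel_exists[a aI]].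
  have := bruhat_cellIr (sys_IV hI) (panel_cell S a).
  by rewrite invgM invgK (invgM g) !mulgA mulgV mul1g.
apply/mapP; exists a; first exact: mem_enum.
by apply/esym/chamberP; rewrite (invgM g) -mulgA.
Qed.

Lemma panel_chamber g C : C \in panel g -> exists2 h, C = chamber h & D s1 (g^-1 * h)%g.
Proof. by move=> /[dup] /mapP[a _ ->] /panelP; eexists. Qed.

(* With [delta] the Weyl distance, [link w C C'] means
   [delta (C, C') = s1] and [delta (C', tau C) = w]. *)
Definition link w C C' := exists g h, [/\ C = chamber g, C' = chamber h,
  D s1 (g^-1 * h)%g & D w (h^-1 * t * g)%g].

Lemma linkP w g h : link w (chamber g) (chamber h) <->
  D s1 (g^-1 * h)%g /\ D w (h^-1 * t * g)%g.
Proof.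
split=> [[g' [h' [/chamberP gI /chamberP hI Ds Dw]]]|[Ds Dw]]; last by exists g, h.
have := bruhat_cellIl gI (bruhat_cellIr (sys_IV hI) Ds).
have := bruhat_cellIl hI (bruhat_cellIr (sys_IV gI) Dw).
by rewrite !invgM !invgK !mulgA !mulgK => Dw2 Ds2; split.
Qed.

Lemma link_uniqr w C C' C'' : ascent w -> link w C C' -> link w C C'' -> C' = C''.
Proof.
move=> aw [g [h [-> -> Ds Dw]]] [g' [h' [/chamberP gI -> Ds' Dw']]].
have [_ Dw2] : D s1 (g^-1 * h')%g /\ D w (h'^-1 * t * g)%g.
  by apply/linkP; exists g', h'; split=> //; apply/chamberP.
have Ds2 : D s1 (g^-1 * h')%g.
  have := bruhat_cellIl gI Ds'; by rewrite !mulgA mulgK.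
case: (panel_trans Ds Ds2) => // hh'.
have := bruhat_cell_s1 aw hh' Dw2; rewrite !mulgA mulgK => /(bruhat_cell_inj Dw).
by move=> e; case: s1_neq1; apply: (mulIg w); rewrite mul1g -e.
Qed.

Lemma link_uniql w C C' C'' : ascent w^-1%g -> link w C C'' -> link w C' C'' -> C = C'.
Proof.
move=> aw [g [h [-> -> Ds Dw]]] [g' [h' [-> hI Ds' Dw']]].
have [Ds2 Dw2] : D s1 (g'^-1 * h)%g /\ D w (h^-1 * t * g')%g.
  by apply/linkP; exists g', h'.
move: Ds Ds2 => /bruhat_cellV + /bruhat_cellV; rewrite !invgM !invgK s1V => Ds Ds2.
case: (panel_trans Ds Ds2) => // gg'.
have := mulg_bruhat_cell_s1 aw Dw gg'; rewrite !mulgA mulgK => /(bruhat_cell_inj Dw2).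
by move=> e; case: s1_neq1; apply: (mulgI w); rewrite mulg1 -e.
Qed.

Lemma link_fiber w g h : ascent w -> link w (chamber g) (chamber h) ->
  fiber (s1 * w)%g (chamber g).
Proof.
move=> aw /linkP[Ds Dw]; apply/fiberP.
by have := bruhat_cell_s1 aw Ds Dw; rewrite !mulgA mulgK.
Qed.

Lemma fiber_link w C : fiber (s1 * w)%g C -> exists C', link w C C'.
Proof.
move=> [g -> [i [j [iI jI e]]]]; exists (chamber (g * i * r s1)%g), g, (g * i * r s1)%g.
split=> //.
  by rewrite !mulgA mulVg mul1g; apply: bruhat_cellIl => //; exact: bruhat_cell_rep.
rewrite !invgM -!mulgA (mulgA g^-1%g) e sys_repM -!mulgA !mulKg.
by apply: bruhat_cellIr => //; exact: bruhat_cell_rep.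
Qed.

Lemma link_fiberr w g h : ascent w^-1%g -> link w (chamber g) (chamber h) ->
  fiber (w * s1)%g (chamber h).
Proof.
move=> aw /linkP[Ds Dw]; apply/fiberP.
by have := mulg_bruhat_cell_s1 aw Dw Ds; rewrite !mulgA mulgK.
Qed.

Lemma fiber_linkr w C : fiber (w * s1)%g C -> exists C', link w C' C.
Proof.
move=> [h -> [i [j [iI jI e]]]].
exists (chamber (t^-1 * h * i * r w)%g), (t^-1 * h * i * r w)%g, h; split=> //.
  rewrite !invgM !invgK -!mulgA (mulgA h^-1%g) e sys_repM -!mulgA !mulKg.
  by apply: bruhat_cellIr => //; exact: bruhat_cell_rep.
rewrite -!mulgA mulVKg mulKg; apply: bruhat_cellIl => //; exact: bruhat_cell_rep.
Qed.

Lemma link_chamberl w C C' : link w C C' -> exists g, C = chamber g.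
Proof. by move=> [g [h [-> _ _ _]]]; exists g. Qed.

Lemma link_chamberr w C C' : link w C C' -> exists g, C' = chamber g.
Proof. by move=> [g [h [_ -> _ _]]]; exists h. Qed.

(** [link w] is a bijection between the two fibers: along C, C', tau C, tau C' the distances are s1,
    w, s1, and the ascents make both products s1 w and w s1 reduced. *)
Lemma fiber_card_cyclic_shift w n : ascent w -> ascent w^-1%g ->
  fiber_card (s1 * w)%g n <-> fiber_card (w * s1)%g n.
Proof.
move=> aw awV; split=> -[s [su sn sP]].
- have [] := @fibration_count _ (fiber (w * s1)%g) (fun C C' => link w C' C) (fun=> 1%N) s su.
  + move=> C /sP CX; have [C' CC'] := fiber_link CX.
    exists [:: C']; split=> // E; rewrite inE; split=> [/eqP ->|[EX CE]].
      split=> //; have [[g eg] [h eh]] := (link_chamberl CC', link_chamberr CC').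
      by rewrite eh; move: CC'; rewrite eg eh; exact: link_fiberr.
    exact/eqP/(link_uniqr aw CE CC').
  + by move=> C C1 C2 _ _ _; exact: link_uniql.
  + move=> C CX; have [C' CC'] := fiber_linkr CX; exists C' => //; apply/sP.
    have [[g eg] [h eh]] := (link_chamberl CC', link_chamberr CC').
    by rewrite eg; move: CC'; rewrite eg eh; exact: link_fiber.
  by move=> s' [s'u s's s'P]; exists s'; split=> //; rewrite s's sum1_size sn.
- have [] := @fibration_count _ (fiber (s1 * w)%g) (link w) (fun=> 1%N) s su.
  + move=> C /sP CX; have [C' CC'] := fiber_linkr CX.
    exists [:: C']; split=> // E; rewrite inE; split=> [/eqP ->|[EX CE]].
      split=> //; have [[g eg] [h eh]] := (link_chamberl CC', link_chamberr CC').
      by rewrite eg; move: CC'; rewrite eg eh; exact: link_fiber.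
    exact/eqP/(link_uniql awV CE CC').
  + by move=> C C1 C2 _ _ _; exact: link_uniqr.
  + move=> C CX; have [C' CC'] := fiber_link CX; exists C' => //; apply/sP.
    have [[g eg] [h eh]] := (link_chamberl CC', link_chamberr CC').
    by rewrite eh; move: CC'; rewrite eg eh; exact: link_fiberr.
  by move=> s' [s'u s's s'P]; exists s'; split=> //; rewrite s's sum1_size sn.
Qed.

(** Each C in the fiber of s1 w s1 has a unique C' linked to it by [w * s1], and the distance from
    C' to tau C' is w or w s1. Conversely, the C linked to C' lie in the panel of C': all q chambers
    in the first case, all but one in the second. *)
Lemma fiber_card_reduction w n m : ascent w -> ascent w^-1%g -> ascent (w * s1)%g ->
  fiber_card w n -> fiber_card (w * s1)%g m ->
  fiber_card (s1 * (w * s1))%g (#|K| * n + (#|K| - 1) * m)%N.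
Proof.
move=> aw awV aws [sn [snu snn snP]] [sm [smu smm smP]].
have ww C : fiber w C -> fiber (w * s1)%g C -> False.
  by move=> Cw /(fiber_inj Cw) e; case: s1_neq1; apply: (mulgI w); rewrite mulg1 -e.
have sBu : uniq (sn ++ sm).
  rewrite cat_uniq snu smu andbT; apply/hasPn => C /smP Cm; apply/negP => /snP Cn.
  exact: ww Cn Cm.
have [] := @fibration_count _ (fiber (s1 * (w * s1))%g) (link (w * s1)%g)
  (fun C => if C \in sn then #|K| else (#|K| - 1)%N) (sn ++ sm) sBu.
- move=> C; rewrite mem_cat; case: ifPn => [/snP [h -> Dw] _|Csn /= /smP [h -> Dw]].
    exists (panel h); split; [exact: panel_uniq|exact: size_panel|move=> E; split].
      move=> /panel_chamber[g -> hg]; suff gh : link (w * s1)%g (chamber g) (chamber h).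
        by split=> //; exact: link_fiber gh.
      apply/linkP; split; first by have /bruhat_cellV := hg; rewrite invgM invgK s1V.
      by have := mulg_bruhat_cell_s1 awV Dw hg; rewrite !mulgA mulgK.
    move=> [_ Eh]; have [g eg] := link_chamberl Eh; move: Eh; rewrite eg => /linkP[gh _].
    by apply/panelP; have /bruhat_cellV := gh; rewrite invgM invgK s1V.
  (* The exceptional chamber [h * y] of the panel: its translate by tau is at distance w, instead of
     w s1, from the chamber of [h]. *)
  have [y Dy Dwy] : exists2 y, D s1 y & D w (h^-1 * t * h * y)%g.
    have [i [j [iI jI ->]]] := Dw; exists (j^-1 * r s1)%g.
      by apply: bruhat_cellIl; [exact: sys_IV|exact: bruhat_cell_rep].
    rewrite sys_repM -!mulgA mulVKg -{2}sys_s1V mulgV mulg1.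
    by apply: bruhat_cellIl => //; exact: bruhat_cell_rep.
  exists (rem (chamber (h * y)%g) (panel h)); split.
  + exact/rem_uniq/panel_uniq.
  + by rewrite size_rem ?size_panel ?subn1 //; apply/panelP; rewrite mulKg.
  move=> E; rewrite (mem_rem_uniq _ (panel_uniq h)) inE; split.
    case/andP => Ehy /panel_chamber[g eg hg]; suff gh : link (w * s1)%g (chamber g) (chamber h).
      by rewrite eg; split=> //; exact: link_fiber gh.
    apply/linkP; split; first by have /bruhat_cellV := hg; rewrite invgM invgK s1V.
    have Dy' : D s1 (h^-1 * (h * y))%g by rewrite mulKg.
    case: (panel_trans Dy' hg) => [e'|yg]; first by rewrite eg e' eqxx in Ehy.
    by have := mulg_bruhat_cell_s1 awV Dwy yg; rewrite invgM !mulgA mulgK mulgK.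
  move=> [_ Eh]; have [g eg] := link_chamberl Eh; move: Eh; rewrite eg => /linkP[gh Dg].
  apply/andP; split; last first.
    by apply/panelP; have /bruhat_cellV := gh; rewrite invgM invgK s1V.
  apply/eqP => /chamberP gy; have := bruhat_cellIr gy Dg.
  rewrite -!mulgA mulVKg !mulgA => /(bruhat_cell_inj Dwy) e'.
  by case: s1_neq1; apply: (mulgI w); rewrite mulg1 -e'.
- by move=> C C1 C2 _ _ _; exact: link_uniqr.
- move=> C CX; have [C' CC'] := fiber_link CX; exists C' => //; rewrite mem_cat; apply/orP.
  have [[g eg] [h eh]] := (link_chamberl CC', link_chamberr CC').
  move: CC'; rewrite eg eh => /linkP[Ds Dws].
  have := mulg_bruhat_cell_s1_or Dws Ds; rewrite -mulgA s1_involution mulg1 !mulgA mulgK.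
  by case=> Dh; [left; apply/snP|right; apply/smP]; exists h.
move=> s [su ss sP]; exists s; split=> //; rewrite ss big_cat /=.
congr (_ + _)%N; rewrite big_seq_cond.
  rewrite (eq_bigr (fun=> #|K|)) => [|C /andP[-> _]] //.
  by rewrite -big_seq_cond big_const_seq count_predT iter_addn_0 snn.
rewrite (eq_bigr (fun=> (#|K| - 1)%N)) => [|C /andP[Cm _]].
  by rewrite -big_seq_cond big_const_seq count_predT iter_addn_0 smm.
by case: ifP => // /snP Cn; case: (ww C Cn); apply/smP.
Qed.

Lemma fiber_card_tau w n : fiber_card w n -> fiber_card (tau * w * tau^-1)%g n.
Proof.
(* Since [tau] normalises I, right translation acts on chambers; here it sends gI to g tau^-1 I and
   conjugates g^-1 tau g by tau. *)
move=> [s [su sn sP]]; pose f (C : set S) : set S := fun h => C (h * t)%g.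
have f_inj : injective f.
  move=> C C' e; apply/funext => h.
  by have := congr1 (fun E : set S => E (h * t^-1)%g) e; rewrite /f /= mulgKV.
have fc g : f (chamber g) = chamber (g * t^-1)%g.
  apply/seteqP; split=> h; rewrite /f /chamber /= invgM invgK => hI.
    by have := sys_tau hI; rewrite !mulgA mulgK.
  by have := sys_tauV hI; rewrite !mulgA mulVg mul1g.
exists (map f s); split; first by rewrite map_inj_uniq.
  by rewrite size_map.
have e g : ((g * t^-1)^-1 * t * (g * t^-1) = t * (g^-1 * t * g) * t^-1)%g.
  by rewrite invgM invgK !mulgA.
move=> C; split=> [/mapP[E /sP [g -> Dg] ->]|[g -> Dg]].
  rewrite fc; apply/fiberP; rewrite e.
  by apply: mulg_bruhat_cell_tauV; exact: bruhat_cell_tau.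
rewrite -[g](mulgK t) -fc map_f //; apply/sP/fiberP.
have := bruhat_cell_tauV (mulg_bruhat_cell_tau Dg).
by rewrite mulgKV mulKg (invgM g) !mulgA.
Qed.

Lemma fiber_card_rot w w' n : (tau * w' = w * tau)%g -> fiber_card w n <-> fiber_card w' n.
Proof.
move=> ww'; split=> [/fiber_card_tau/fiber_card_tau|/fiber_card_tau]; last by rewrite ww' mulgK.
by rewrite (conjg_square _ tau_tau) -(mulgA tau^-1%g) -ww' mulKg.
Qed.

(** If g is in the cell of y and g^-1 tau g in that of tau, then tau g is in the cells of tau y and
    y tau. So y commutes with tau, hence is a power of tau and normalises I, and gI = yI. *)
Lemma fiber_card_tau3 : fiber_card tau 3.
Proof.
exists [:: chamber 1%g; chamber t; chamber (t * t)%g].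
have t1 : ~ I t.
  by move=> /bruhat_cell1/(bruhat_cell_inj (bruhat_cell_rep S tau))/tau_neq1.
have tt1 : ~ I (t * t)%g.
  have Dtt : D (tau * tau)%g (t * t)%g by apply: bruhat_cell_tau; exact: bruhat_cell_rep.
  move=> /bruhat_cell1/(bruhat_cell_inj Dtt)/(congr1 (fun x => tau^-1 * x)%g).
  rewrite /= mulKg mulg1 => tau1; apply: tau_neq1; apply: (mulgI tau).
  by rewrite mulg1 [LHS]tau_tau [RHS]tau1.
split=> //=.
  rewrite !inE !andbT negb_or; apply/andP; split; last first.
    by apply/eqP => /chamberP; rewrite mulKg.
  by apply/andP; split; apply/eqP => /chamberP; rewrite invg1 mul1g.
move=> C; rewrite !inE; split.
  have ct z : (t * z = z * t)%g -> fiber tau (chamber z).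
    by move=> tz; apply/fiberP; rewrite -mulgA tz mulKg; exact: bruhat_cell_rep.
  by case/or3P=> /eqP ->; apply: ct; rewrite ?mulg1 ?mul1g ?mulgA.
move=> [g -> [k [k' [kI k'I e]]]]; have [y Dy] := bruhat_decomposition g.
have yt : (tau * y = y * tau)%g.
  apply: bruhat_cell_inj (bruhat_cell_tau Dy) _.
  have -> : (t * g = g * k * t * k')%g by rewrite -!mulgA (mulgA k) -e !mulgA mulgV mul1g.
  by apply: bruhat_cellIr => //; apply: mulg_bruhat_cell_tau; exact: bruhat_cellIr.
have [i [j [iI jI ge]]] := Dy.
have tiI := sys_tauV iI; have ttiI := sys_tauV tiI.
have chi : I ((r y)^-1 * i * r y)%g -> chamber g = chamber (r y).
  by move=> yI; apply/esym/chamberP; rewrite ge !mulgA; exact: sys_IM.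
have := iw_centralizer_tau yt; rewrite !inE => /or3P[] /eqP ye; rewrite {}ye in chi.
- by rewrite chi ?sys_rep1 ?eqxx // invg1 mul1g mulg1.
- by rewrite chi ?eqxx ?orbT.
- rewrite (sys_repM S tau tau) in chi; rewrite chi ?eqxx ?orbT //.
  by move: ttiI; rewrite invgM !mulgA.
Qed.

End Counting.

(** * The system of [PGL_3] *)

Lemma conjg_eqV (G : groupType) (g x i w j : G) : (g^-1 * x * g = i * w * j)%g ->
  (g^-1 * x^-1 * g = j^-1 * w^-1 * i^-1)%g.
Proof.
by move=> /(congr1 (fun h => h^-1%g)); rewrite !invgM invgK !mulgA.
Qed.

Section Instance.
Variable K : fieldType.
Local Notation pgl := (pgl (laurent K) 3).

Lemma pgl_root_conj (a : K) x : ascent x^-1%g ->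
  iwahori (iw_rep K x * root_elt a * (iw_rep K x)^-1)%g.
Proof. by apply: root_gl_conj; exact: lconst_integral. Qed.

Lemma pgl_generated (P : set pgl) (g : pgl) :
  (forall i h : pgl, iwahori i -> P h -> P (i * h)%g) ->
  (forall w (h : pgl), P h -> P (iw_rep K w * h)%g) -> P 1%g -> P g.
Proof. by move=> PI Pr P1; rewrite -[g]mulg1; exact: iw_generated_all. Qed.

Lemma pgl_inj (i j : pgl) x y : iwahori i -> iwahori j ->
  (i * iw_rep K y * j)%g = iw_rep K x -> x = y.
Proof. exact: iwahori_coset_inj. Qed.

Definition pgl_system : iwahori_system K :=
  @IwahoriSystem K pgl (@iwahori K) (@iw_rep K) (@root_elt K) (@iwahori1 K)
    (@iwahoriM K) (@iwahoriV K) (@iw_repM K) (@iwahori_tau K) (@iwahori_tauV K)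
    (@root_elt_iwahori K) (@root_eltB K) pgl_root_conj
    (@iwahori_root_decomposition K) (@iwahori_s1_root K) pgl_inj pgl_generated.

End Instance.

(** * Criteria for an empty fiber *)

Section Emptiness.
Variable K : finFieldType.
Local Notation S := (pgl_system K).
Local Notation card w n := (@fiber_card K S w n).
Local Notation c w := (cw_coord (iw_trans w)).

Lemma fiber_card0 w : (forall C, ~ @fiber K S w C) -> card w 0.
Proof. by move=> e; exists [::]; split=> // C; split=> // /e. Qed.

Lemma tau_fixpoint_free k : iw_lin tau k != k.
Proof. by have [e0 e1 e2] := iw_lin_tau; move: k; apply: ord3P; rewrite ?e0 ?e1 ?e2. Qed.

Lemma fiber_card_dominant w k : iw_lin w k = k ->
  (forall t, t != k -> c w k < c w t + (iw_lin w t < t)%N%:Z) -> card w 0.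
Proof.
move=> wk wt; apply: fiber_card0 => C [g _ [i [j [iI jI e]]]].
exact: (trace_obstruction iI jI e tau_fixpoint_free wk wt).
Qed.

(** The trace obstruction for inverses: g^-1 tau^-1 g is in the cell of [w^-1], whose coordinates
    are those of [w] negated and permuted, up to a common shift. *)
Lemma fiber_card_codominant w k : iw_lin w k = k ->
  (forall t, t != k -> c w t - (t < iw_lin w t)%N%:Z < c w k) -> card w 0.
Proof.
move=> wk wt; apply: fiber_card0 => C [g _ [i [j [iI jI e]]]].
have e' : (g^-1 * iw_rep K tau^-1 * g = j^-1 * iw_rep K w^-1 * i^-1)%g.
  by rewrite (iw_repV K tau) (iw_repV K w); exact: conjg_eqV.
apply: (trace_obstruction (iwahoriV jI) (iwahoriV iI) e' (k := k)).
- move=> t; have /eqP nt := tau_fixpoint_free t; apply/eqP => e0; apply: nt.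
  by rewrite -{1}e0; exact: permKV.
- by rewrite /= -{1}wk permK.
move=> t tk; pose s := iw_lin w^-1%g t.
have ts : iw_lin w s = t by rewrite /s /= permKV.
have sk : s != k by apply: contraNneq tk => sk; rewrite -ts sk wk.
have := wt s sk; rewrite ts -/s /= !cw_coordN !cw_coord_of.
have -> : ((iw_lin w)^-1%g k = k)%g by rewrite -{1}wk permK.
rewrite -[(iw_lin w)^-1%g t]/s; lia.
Qed.

Lemma fiber_card_kottwitz w : (forall m, kottwitz w != 1 + m *+ 3) -> card w 0.
Proof.
move=> wk; apply: fiber_card0 => C [g _ [i [j [iI jI e]]]].
have [m wm] := kottwitz_conj iI jI e; have /eqP := wk m; apply.
by rewrite wm tauE.
Qed.

(** Coweights as triples modulo Z(1,1,1); the redundancy keeps the three coordinates symmetric. *)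
Definition el (c0 c1 c2 : int) (v : 'S_3) := IwahoriWeyl (c0 - c1, c1 - c2) v.

End Emptiness.

Local Notation p01 := (tperm 0 1%R : 'S_3).
Local Notation p12 := (tperm 1%R 2%R : 'S_3).
Local Notation p02 := (tperm 0 2%R : 'S_3).

Local Ltac iw_auto :=
  rewrite ?tauE; apply: iw_eq;
  [ rewrite /= /cycle3 /cycle3V /weyl_act /cw_of /= /cw_coord ?permM ?permE /= ?permM ?permE /=
      ?permM ?permE /=; congr pair; move=> /=; lia
  | apply: ord3P; rewrite /= /cycle3 /cycle3V ?permM ?permE /= ?permM ?permE /= ?permM ?permE //= ].

(** * The length function *)

Definition root_length (a b : int) (m0 m1 m2 : nat) : nat :=
  (absz (a - (m1 < m0)%N%:Z)%R + absz (b - (m2 < m1)%N%:Z)%R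
    + absz (a + b - (m2 < m0)%N%:Z)%R)%N.

(* Each summand counts the affine hyperplanes of one parallel class which
   separate the base alcove from its image. *)
Definition alcove_length (w : iwahori_weyl) : nat :=
  root_length (iw_trans w).1 (iw_trans w).2 (iw_lin w 0) (iw_lin w 1) (iw_lin w 2).

Lemma s0E : s0 = IwahoriWeyl (1, 1) p02.
Proof. iw_auto. Qed.

Lemma alcove_length_s1 a b v : alcove_length (s1 * IwahoriWeyl (a, b) v)%g =
  root_length (- a) (a + b) (v 1) (v 0) (v 2).
Proof.
rewrite /alcove_length /= !permM !permE /= /weyl_act /cw_of /cw_coord ?permE /=.
by congr root_length; lia.
Qed.

Lemma alcove_length_s2 a b v : alcove_length (s2 * IwahoriWeyl (a, b) v)%g =
  root_length (a + b) (- b) (v 0) (v 2) (v 1).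
Proof.
rewrite /alcove_length /= !permM !permE /= /weyl_act /cw_of /cw_coord ?permE /=.
by congr root_length; lia.
Qed.

Lemma alcove_length_s0 a b v : alcove_length (s0 * IwahoriWeyl (a, b) v)%g =
  root_length (1 - b) (1 - a) (v 2) (v 1) (v 0).
Proof.
rewrite s0E /alcove_length /= !permM !permE /= /weyl_act /cw_of /cw_coord ?permE /=.
by congr root_length; lia.
Qed.

Lemma alcove_length_tau a b v : alcove_length (tau * IwahoriWeyl (a, b) v)%g =
  root_length (1 - (a + b)) a (v 2) (v 0) (v 1).
Proof.
rewrite tauE; have [c0 c1 c2] := cycle3E.
rewrite /alcove_length /= !(permM cycle3 v) /weyl_act /cw_of /cw_coord c0 c1 c2 /=.
by congr root_length; lia.
Qed.

Lemma perm3P (P : 'S_3 -> Prop) : P 1%g -> P p01 -> P p12 -> P p02 ->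
  P cycle3 -> P cycle3V -> forall v, P v.
Proof.
move=> P1 P01 P12 P02 Pc PcV v.
have ext (v' : 'S_3) : v 0 = v' 0 -> v 1 = v' 1 -> v 2 = v' 2 -> P v' -> P v.
  by move=> e0 e1 e2; suff -> : v = v' by []; apply/permP; apply: ord3P.
have [c0 c1 c2] := cycle3E; have [d0 d1 d2] := cycle3VE.
have e1 : v 0 = v 1 -> False by move=> /perm_inj.
have e2 : v 0 = v 2 -> False by move=> /perm_inj.
have e3 : v 1 = v 2 -> False by move=> /perm_inj.
have val3 i : v i = 0 \/ v i = 1 \/ v i = 2 by move: (v i); apply: ord3P; auto.
case: (val3 0) => [v0|[v0|v0]]; case: (val3 1) => [v1|[v1|v1]];
  case: (val3 2) => [v2|[v2|v2]]; try (by case: e1; rewrite v0 v1);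
  try (by case: e2; rewrite v0 v2); try (by case: e3; rewrite v1 v2).
- by apply: (ext 1%g); rewrite ?perm1.
- by apply: (ext p12); rewrite ?permE.
- by apply: (ext p01); rewrite ?permE.
- by apply: (ext cycle3V); rewrite ?d0 ?d1 ?d2.
- by apply: (ext cycle3); rewrite ?c0 ?c1 ?c2.
- by apply: (ext p02); rewrite ?permE.
Qed.

Lemma alcove_length_simple s w : s \in [:: s0; s1; s2] ->
  alcove_length (s * w)%g = (alcove_length w).+1 \/
  (alcove_length (s * w)%g).+1 = alcove_length w.
Proof.
have [c0 c1 c2] := cycle3E; have [d0 d1 d2] := cycle3VE.
case: w => [[a b] v]; rewrite !inE => /or3P[] /eqP ->;
  rewrite ?alcove_length_s0 ?alcove_length_s1 ?alcove_length_s2;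
  rewrite /alcove_length /root_length /=; move: v;
  by apply: perm3P; rewrite ?perm1 ?c0 ?c1 ?c2 ?d0 ?d1 ?d2 ?permE /=; lia.
Qed.

Lemma alcove_length_tau_mul w : alcove_length (tau * w)%g = alcove_length w.
Proof.
have [c0 c1 c2] := cycle3E; have [d0 d1 d2] := cycle3VE.
case: w => [[a b] v]; rewrite alcove_length_tau /alcove_length /root_length /=; move: v.
by apply: perm3P; rewrite ?perm1 ?c0 ?c1 ?c2 ?d0 ?d1 ?d2 ?permE /=; lia.
Qed.

Lemma alcove_length_descent w : (0 < alcove_length w)%N ->
  exists2 s, s \in [:: s0; s1; s2] & (alcove_length (s * w)%g).+1 = alcove_length w.
Proof.
have [c0 c1 c2] := cycle3E; have [d0 d1 d2] := cycle3VE.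
case: w => [[a b] v] w0.
suff : (alcove_length (s0 * IwahoriWeyl (a, b) v)%g).+1 = alcove_length (IwahoriWeyl (a, b) v)
  \/ (alcove_length (s1 * IwahoriWeyl (a, b) v)%g).+1 = alcove_length (IwahoriWeyl (a, b) v)
  \/ (alcove_length (s2 * IwahoriWeyl (a, b) v)%g).+1 = alcove_length (IwahoriWeyl (a, b) v).
  by case=> [|[]] H; [exists s0|exists s1|exists s2]; rewrite ?inE ?eqxx ?orbT.
move: w0; rewrite alcove_length_s0 alcove_length_s1 alcove_length_s2.
rewrite /alcove_length /root_length /=; move: v.
by apply: perm3P; rewrite ?perm1 ?c0 ?c1 ?c2 ?d0 ?d1 ?d2 ?permE /=; lia.
Qed.

Lemma alcove_length0 w : alcove_length w = 0 -> exists j, w = (tau ^+ j)%g.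
Proof.
have [c0 c1 c2] := cycle3E; have [d0 d1 d2] := cycle3VE.
case: w => [[a b] v]; rewrite /alcove_length /root_length /=; move: v.
apply: perm3P; rewrite ?perm1 ?c0 ?c1 ?c2 ?d0 ?d1 ?d2 ?permE /= => ab0.
- exists 0; have [-> ->] : a = 0 /\ b = 0 by lia.
  by rewrite expg0.
- lia.
- lia.
- lia.
- exists 1; have [-> ->] : a = 1 /\ b = 0 by lia.
  by rewrite expg1 tauE.
- exists 2; have [-> ->] : a = 0 /\ b = 1 by lia.
  rewrite expgS expg1; iw_auto.
Qed.

(** A simple reflection changes the alcove length by one and [tau] preserves it, so it bounds the
    size of words from below. A positive alcove length can be lowered, and it is 0 only on powers of
    [tau], which yields a word of that size. *)
Lemma iw_lengthE w : iw_length w = alcove_length w.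
Proof.
rewrite /iw_length; case: ex_minnP => n /asboolP wn nmin; apply/eqP; rewrite eqn_leq.
apply/andP; split; last first.
  have [u [j [<- uS ->]]] := wn; elim: u uS => [|y u IH] uS /=.
    rewrite big_nil mul1g; elim: j => [|j IH]; last by rewrite expgS alcove_length_tau_mul.
    by rewrite expg0 /alcove_length /root_length /= !perm1.
  have {}IH : (alcove_length (\prod_(y <- u) y * tau ^+ j)%g <= size u)%N.
    by apply: IH => z zu; apply: uS; rewrite inE zu orbT.
  rewrite big_cons -(mulgA y); move: (_ * tau ^+ j)%g IH => x IH.
  case: (alcove_length_simple x (uS y (mem_head _ _))) => e; first by rewrite e ltnS.
  by rewrite (leq_trans (leqnSn _)) // e (leq_trans IH).
apply: nmin; apply/asboolP; move: {2}(alcove_length w) (erefl (alcove_length w)) => m.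
elim: m w {n wn} => [|m IH] w wm.
  by have [j e] := alcove_length0 wm; exists [::], j; rewrite wm big_nil mul1g -e; split.
have [s sS sw] : exists2 s, s \in [:: s0; s1; s2] & (alcove_length (s * w)%g).+1 = alcove_length w.
  by apply: alcove_length_descent; rewrite wm.
have /IH[u [j [un uS e]]] : alcove_length (s * w)%g = m by lia.
exists (s :: u), j; split.
- by rewrite /= un sw.
- by move=> y; rewrite inE => /predU1P[-> //|/uS].
rewrite big_cons -mulgA -e mulgA.
have -> : (s * s = 1)%g; last by rewrite mul1g.
by move: sS; rewrite !inE => /or3P[] /eqP ->; rewrite ?s0E; iw_auto.
Qed.

(** * Solving the recursion *)

Lemma mulg1_eqV (G : groupType) (x y : G) : (x * y = 1)%g -> (x^-1 = y)%g.
Proof. by move=> xy; apply: (mulgI x); rewrite xy mulgV. Qed.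

Section Recursion.
Variable K : finFieldType.
Local Notation q := #|K|.
Local Notation card w n := (@fiber_card K (pgl_system K) w n).

(* In these coordinates the length is [|p - r| + |r - t| + |p - t|], and conjugation
   by [tau] is a cyclic shift. *)
Definition rotation (p r t : int) := el (p + 1) r t cycle3.
Definition rotationV (a b c : int) := el a b (c - 1) cycle3V.

Lemma rotation_rot p r t : (tau * rotation p r t = rotation t p r * tau)%g.
Proof. iw_auto. Qed.

Lemma rotationV_rot a b c : (tau * rotationV a b c = rotationV c a b * tau)%g.
Proof. iw_auto. Qed.

Lemma rotation_V p r t : (rotation p r t)^-1%g = el (- r) (- t) (- (p + 1)) cycle3V.
Proof. apply: mulg1_eqV; iw_auto. Qed.

Lemma rotationV_V a b c : (rotationV a b c)^-1%g = el (1 - c) (- a) (- b) cycle3.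
Proof. apply: mulg1_eqV; iw_auto. Qed.

Lemma s1_rotation_s1 p r t : (s1 * (rotation p r t * s1))%g = rotationV r (p + 1) (t + 1).
Proof. iw_auto. Qed.

Lemma s1_rotationV_s1 a b c : (s1 * (rotationV a b c * s1))%g = rotation (b - 1) a (c - 1).
Proof. iw_auto. Qed.

Lemma rotationV_s1 a b c : (rotationV a b c * s1)%g = el a b (c - 1) p12.
Proof. iw_auto. Qed.

Lemma rotation_s1 p r t : (rotation p r t * s1)%g = el (p + 1) r t p02.
Proof. iw_auto. Qed.

Lemma el_tpermV c0 c1 c2 : [/\ (el c0 c1 c2 p01)^-1%g = el (- c1) (- c0) (- c2) p01,
  (el c0 c1 c2 p12)^-1%g = el (- c0) (- c2) (- c1) p12
  & (el c0 c1 c2 p02)^-1%g = el (- c2) (- c1) (- c0) p02].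
Proof. split; apply: mulg1_eqV; iw_auto. Qed.

Lemma ascent_el c0 c1 c2 v :
  ascent (el c0 c1 c2 v) <-> 3 * c1 - (v 1)%:Z < 3 * c0 - (v 0)%:Z.
Proof. by rewrite /ascent /=; split; lia. Qed.

Lemma fiber_card_rotation p r t n : card (rotation p r t) n <-> card (rotation t p r) n.
Proof. apply: iff_sym; exact: fiber_card_rot (rotation_rot p r t). Qed.

Lemma fiber_card_rotationV a b c n : card (rotationV a b c) n <-> card (rotationV c a b) n.
Proof. apply: iff_sym; exact: fiber_card_rot (rotationV_rot a b c). Qed.

Lemma fiber_card_reduction0 w n : ascent w -> ascent w^-1%g -> ascent (w * s1)%g ->
  card w n -> card (w * s1)%g 0 -> card (s1 * (w * s1))%g (q * n)%N.
Proof.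
by move=> aw awV aws wn ws; have := fiber_card_reduction aw awV aws wn ws; rewrite muln0 addn0.
Qed.

Local Ltac ascent_auto :=
  apply/ascent_el; rewrite /cycle3 /cycle3V ?permM ?permE /= ?permM ?permE /=; lia.

(** The element [w * s1] of the reduction is a transposition fixing the index 0, where its
    coordinate is r; as r is the strict maximum, its fiber is empty. *)
Lemma rotation_descent (p r t : int) n : p < r -> t < r ->
  card (rotationV r (p + 1) (t + 1)) n -> card (rotation p r t) (q * n)%N.
Proof.
move=> pr tr; have -> : rotation p r t =
    (s1 * (rotationV r (p + 1) (t + 1) * s1))%g.
  by rewrite s1_rotationV_s1 !addrK.
have asV : ascent (rotationV r (p + 1) (t + 1))^-1%g by rewrite rotationV_V; ascent_auto.
have as1 : ascent (rotationV r (p + 1) (t + 1) * s1)%g by rewrite rotationV_s1; ascent_auto.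
move=> cn; apply: fiber_card_reduction0 => //; first by ascent_auto.
rewrite rotationV_s1; apply: (@fiber_card_codominant _ _ 0); first by rewrite /= permE.
by apply: ord3P; rewrite /= ?permE /cw_coord //= => _; lia.
Qed.

(** For a repeated maximum, conjugation by [s1] keeps the length and leads to the other 3-cycle,
    where a descent becomes available. *)
Lemma rotation_shift (p t : int) n : t < p ->
  card (rotationV p (p + 1) (t + 1)) n -> card (rotation p p t) n.
Proof.
move=> tp; have e : (rotation p p t * s1 * s1)%g = rotation p p t.
  by rewrite -mulgA s1_involution mulg1.
rewrite -s1_rotation_s1 rotation_s1 => sn; rewrite -e rotation_s1.
have aw : ascent (el (p + 1) p t p02) by ascent_auto.
have awV : ascent (el (p + 1) p t p02)^-1%g.
  by have [_ _ ->] := el_tpermV (p + 1) p t; ascent_auto.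
have [H _] := @fiber_card_cyclic_shift _ (pgl_system K) _ n aw awV; exact: H sn.
Qed.

Lemma rotationV_descent (a b c : int) n : a < b -> a < c ->
  card (rotation (b - 1) a (c - 1)) n -> card (rotationV a b c) (q * n)%N.
Proof.
move=> ab ac; have -> : rotationV a b c = (s1 * (rotation (b - 1) a (c - 1) * s1))%g.
  by rewrite s1_rotation_s1 !subrK.
have asV : ascent (rotation (b - 1) a (c - 1))^-1%g by rewrite rotation_V; ascent_auto.
have as1 : ascent (rotation (b - 1) a (c - 1) * s1)%g by rewrite rotation_s1; ascent_auto.
move=> cn; apply: fiber_card_reduction0 => //; first by ascent_auto.
rewrite rotation_s1; apply: (@fiber_card_dominant _ _ 1); first by rewrite /= permE.
by apply: ord3P; rewrite /= ?permE /cw_coord //= => _; lia.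
Qed.

Lemma rotationV_shift (a c : int) n : a < c ->
  card (rotation (a - 1) a (c - 1)) n -> card (rotationV a a c) n.
Proof.
move=> ac; have e : (rotationV a a c * s1 * s1)%g = rotationV a a c.
  by rewrite -mulgA s1_involution mulg1.
rewrite -s1_rotationV_s1 rotationV_s1 => sn; rewrite -e rotationV_s1.
have aw : ascent (el a a (c - 1) p12) by ascent_auto.
have awV : ascent (el a a (c - 1) p12)^-1%g.
  by have [_ -> _] := el_tpermV a a (c - 1); ascent_auto.
have [H _] := @fiber_card_cyclic_shift _ (pgl_system K) _ n aw awV; exact: H sn.
Qed.

(** The sum of the three distances is twice the difference of the extremes, so [m] is half the
    length. *)
Definition spread (x : int) (m : nat) (p r t : int) : Prop :=
  ((x <= p) /\ (x <= r) /\ (x <= t)) /\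
  ((p <= x + m%:Z) /\ (r <= x + m%:Z) /\ (t <= x + m%:Z)) /\
  (p = x \/ r = x \/ t = x) /\
  (p = x + m%:Z \/ r = x + m%:Z \/ t = x + m%:Z).

(** Induction on half the length. The congruences express the determinant condition; for m = 0 they
    exclude [rotationV] and leave only [tau]. *)
Lemma rotation_count m :
  (forall x p r t k : int, p + r + t = 3 * k -> spread x m p r t ->
     card (rotation p r t) (3 * q ^ m)%N) /\
  (forall x a b c k : int, a + b + c = 3 * k + 2 -> spread x m a b c ->
     card (rotationV a b c) (3 * q ^ m)%N).
Proof.
elim: m => [|m [IHP IHQ]].
  split=> x p r t k; rewrite /spread; last by lia.
  move=> _ xprt; have [-> [-> ->]] : p = x /\ r = x /\ t = x by lia.
  have -> : rotation x x x = tau by iw_auto.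
  by rewrite expn0 muln1; exact: fiber_card_tau3.
have e : (3 * q ^ m.+1 = q * (3 * q ^ m))%N by rewrite expnS mulnCA.
have PS (x p r t k : int) : p + r + t = 3 * k -> spread x m.+1 p r t -> p < r -> t < r ->
    card (rotation p r t) (3 * q ^ m.+1)%N.
  move=> prt sprt pr tr; rewrite e; apply: rotation_descent => //.
  by apply: (IHQ (x + 1) _ _ _ k); rewrite /spread in sprt *; lia.
have QS (x a b c k : int) : a + b + c = 3 * k + 2 -> spread x m.+1 a b c -> a < b -> a < c ->
    card (rotationV a b c) (3 * q ^ m.+1)%N.
  move=> abc sabc ab ac; rewrite e; apply: rotationV_descent => //.
  by apply: (IHP x _ _ _ k); rewrite /spread in sabc *; lia.
have PT (x p t k : int) : p + p + t = 3 * k -> spread x m.+1 p p t -> t < p ->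
    card (rotation p p t) (3 * q ^ m.+1)%N.
  (* The minimum [t + 1] is now strict, since t = p - 1 would contradict the congruence. *)
  move=> prt sprt tp; apply: rotation_shift => //; apply/fiber_card_rotationV.
  by apply: (QS (x + 1) _ _ _ k); rewrite /spread in sprt *; lia.
have QT (x a c k : int) : a + a + c = 3 * k + 2 -> spread x m.+1 a a c -> a < c ->
    card (rotationV a a c) (3 * q ^ m.+1)%N.
  move=> abc sabc ac; apply: rotationV_shift => //; do 2 apply/fiber_card_rotation.
  by apply: (PS (x - 1) _ _ _ k); rewrite /spread in sabc *; lia.
split=> x p r t k prt sprt.
  have [h|[h|[h|[h|[h|h]]]]] : (p < r /\ t < r) \/ (r < p /\ t < p) \/ (p < t /\ r < t)
      \/ (p = r /\ t < r) \/ (r = t /\ p < r) \/ (t = p /\ r < t).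
    by rewrite /spread in sprt; lia.
  - by apply: (PS x _ _ _ k) => //; lia.
  - by apply/fiber_card_rotation; apply: (PS x _ _ _ k); rewrite /spread in sprt *; lia.
  - do 2 apply/fiber_card_rotation.
    by apply: (PS x _ _ _ k); rewrite /spread in sprt *; lia.
  - by case: h => pr tr; rewrite pr; apply: (PT x _ _ k); rewrite /spread in sprt *; lia.
  - case: h => pr tr; rewrite pr; do 2 apply/fiber_card_rotation.
    by apply: (PT x _ _ k); rewrite /spread in sprt *; lia.
  - case: h => pr tr; rewrite pr; apply/fiber_card_rotation.
    by apply: (PT x _ _ k); rewrite /spread in sprt *; lia.
have [h|[h|[h|[h|[h|h]]]]] : (p < r /\ p < t) \/ (r < p /\ r < t) \/ (t < p /\ t < r)
    \/ (p = r /\ p < t) \/ (r = t /\ r < p) \/ (t = p /\ t < r).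
  by rewrite /spread in sprt; lia.
- by apply: (QS x _ _ _ k) => //; lia.
- do 2 apply/fiber_card_rotationV.
  by apply: (QS x _ _ _ k); rewrite /spread in sprt *; lia.
- by apply/fiber_card_rotationV; apply: (QS x _ _ _ k); rewrite /spread in sprt *; lia.
- by case: h => pr tr; rewrite pr; apply: (QT x _ _ k); rewrite /spread in sprt *; lia.
- case: h => pr tr; rewrite pr; do 2 apply/fiber_card_rotationV.
  by apply: (QT x _ _ k); rewrite /spread in sprt *; lia.
- case: h => pr tr; rewrite pr; apply/fiber_card_rotationV.
  by apply: (QT x _ _ k); rewrite /spread in sprt *; lia.
Qed.

(** Conjugation by [tau] brings the fixed index of a transposition to 2; the coordinate there is
    normalised to 0. *)
Definition reflection (p r : int) := el p r 0 p01.

Lemma reflection_rot p r : (tau * el (r + 1) 0 (p - 1) p02 = reflection p r * tau)%g.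
Proof. iw_auto. Qed.

Lemma reflection_rotV p r : (tau * reflection p r = el 0 p r p12 * tau)%g.
Proof. iw_auto. Qed.

(** Three integers that are not all equal have a strict minimum or a strict maximum, so one of the
    two trace criteria applies. *)
Lemma fiber_card_translation (c0 c1 c2 k : int) : c0 + c1 + c2 = 3 * k + 1 ->
  card (el c0 c1 c2 1%g) 0.
Proof.
move=> c012; have [h|h] : ((c0 < c1 /\ c0 < c2) \/ (c1 < c0 /\ c1 < c2) \/ (c2 < c0 /\ c2 < c1))
    \/ ((c1 < c0 /\ c2 < c0) \/ (c0 < c1 /\ c2 < c1) \/ (c0 < c2 /\ c1 < c2)) by lia.
  have [h0|[h0|h0]] := h;
    [apply: (@fiber_card_dominant _ _ 0)|apply: (@fiber_card_dominant _ _ 1)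
    |apply: (@fiber_card_dominant _ _ 2)]; rewrite /= ?perm1 //;
    by apply: ord3P; rewrite /= ?perm1 /cw_coord //= => _; lia.
have [h0|[h0|h0]] := h;
  [apply: (@fiber_card_codominant _ _ 0)|apply: (@fiber_card_codominant _ _ 1)
  |apply: (@fiber_card_codominant _ _ 2)]; rewrite /= ?perm1 //;
  by apply: ord3P; rewrite /= ?perm1 /cw_coord //= => _; lia.
Qed.

(** Here [w * s1] is a 3-cycle, so the second term of the reduction survives: it is the source of
    the factor q - 1. *)
Lemma reflection_descent (p r : int) n m : 0 < p -> r < 0 ->
  card (reflection (r + 1) (p - 1)) n -> card (rotationV 0 (r + 1) p) m ->
  card (reflection p r) (q * n + (q - 1) * m)%N.
Proof.
move=> p0 r0 cn cm; apply/(@fiber_card_rot _ (pgl_system K) _ _ _ (reflection_rot p r)).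
pose w := el 0 (r + 1) (p - 1) p12.
have -> : el (r + 1) 0 (p - 1) p02 = (s1 * (w * s1))%g by iw_auto.
have ws : (w * s1)%g = rotationV 0 (r + 1) p by iw_auto.
apply: fiber_card_reduction; rewrite ?ws //; first by ascent_auto.
- by have [_ -> _] := el_tpermV 0 (r + 1) (p - 1); ascent_auto.
- by ascent_auto.
by apply/(@fiber_card_rot _ (pgl_system K) _ _ _ (reflection_rotV (r + 1) (p - 1))).
Qed.

(** Here [w * s1] is a translation, whose fiber is empty. *)
Lemma reflection_shift (p r k : int) n : p <= 0 -> 0 <= r -> p + r = 3 * k + 1 ->
  card (reflection r p) n -> card (reflection p r) (q * n)%N.
Proof.
move=> p0 r0 pr cn; have -> : reflection p r = (s1 * (reflection r p * s1))%g by iw_auto.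
have ws : (reflection r p * s1)%g = el r p 0 1%g by iw_auto.
apply: fiber_card_reduction0 => //; rewrite ?ws; first by ascent_auto.
- by have [-> _ _] := el_tpermV r p 0; ascent_auto.
- by apply/ascent_el; rewrite !perm1 /=; lia.
by apply: (@fiber_card_translation _ _ _ k); lia.
Qed.

Lemma reflection_empty (p r : int) : 0 < p /\ 0 <= r \/ p <= 0 /\ r < 0 ->
  card (reflection p r) 0.
Proof.
case=> -[p0 r0]; [apply: (@fiber_card_dominant _ _ 2)|apply: (@fiber_card_codominant _ _ 2)];
  by [rewrite /= permE|apply: ord3P; rewrite /= ?permE /cw_coord //= => _; lia].
Qed.

(** A descent leads from the first family to the second and keeps the minimum of a and b; a shift
    leads back and lowers it by one. When the minimum is 0, the shift reaches an empty fiber. *)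
Lemma reflection_count n :
  (forall (a b : nat) (k : int), minn a b = n -> a%:Z - b%:Z = 3 * k + 1 ->
     card (reflection a.+1%:Z (- b.+1%:Z)) (3 * n.+1 * q ^ (a + b).+1 * (q - 1))%N) /\
  (forall (a b : nat) (k : int), minn a b = n -> b%:Z - a%:Z = 3 * k + 1 ->
     card (reflection (- a%:Z) b) (3 * n * q ^ (a + b) * (q - 1))%N).
Proof.
have step m : (forall (a b : nat) (k : int), minn a b = m -> b%:Z - a%:Z = 3 * k + 1 ->
     card (reflection (- a%:Z) b) (3 * m * q ^ (a + b) * (q - 1))%N) ->
   forall (a b : nat) (k : int), minn a b = m -> a%:Z - b%:Z = 3 * k + 1 ->
     card (reflection a.+1%:Z (- b.+1%:Z)) (3 * m.+1 * q ^ (a + b).+1 * (q - 1))%N.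
  move=> IH a b k abm abk.
  have -> : (3 * m.+1 * q ^ (a + b).+1 * (q - 1) =
    q * (3 * m * q ^ (b + a) * (q - 1)) + (q - 1) * (3 * q ^ (a + b).+1))%N.
    by rewrite expnS (addnC b) -[m.+1]addn1; ring.
  apply: reflection_descent; [lia|lia| |].
    have -> : - b.+1%:Z + 1 = - b%:Z by lia.
    have -> : a.+1%:Z - 1 = a by lia.
    by apply: (IH b a k) => //; rewrite minnC.
  have [_ count] := rotation_count (a + b).+1.
  by apply: (count (- b%:Z) _ _ _ k); rewrite /spread; lia.
elim: n => [|n [IHA _]].
  suff B0 : forall (a b : nat) (k : int), minn a b = 0 -> b%:Z - a%:Z = 3 * k + 1 ->
      card (reflection (- a%:Z) b) (3 * 0 * q ^ (a + b) * (q - 1))%N.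
    by split=> //; exact: step.
  move=> a b k ab0 bak; rewrite muln0 !mul0n -(muln0 q).
  by apply: (@reflection_shift _ _ k); [lia|lia|lia|apply: reflection_empty; lia].
suff B : forall (a b : nat) (k : int), minn a b = n.+1 -> b%:Z - a%:Z = 3 * k + 1 ->
    card (reflection (- a%:Z) b) (3 * n.+1 * q ^ (a + b) * (q - 1))%N.
  by split=> //; exact: step.
case=> [|a] [|b] k ab bak; try by lia.
have -> : (3 * n.+1 * q ^ (a.+1 + b.+1) * (q - 1) =
  q * (3 * n.+1 * q ^ (b + a).+1 * (q - 1)))%N.
  by rewrite addSn addnS !expnS (addnC b); ring.
apply: (@reflection_shift _ _ k); [lia|lia|lia|].
by apply: (IHA b a k); lia.
Qed.

End Recursion.

(** * Functoriality and rational cosets *)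

Section PGLMapTheory.
Variables (K K' : fieldType) (phi : {rmorphism K -> K'}).
Local Notation Phi := (@pgl_map (laurent K) (laurent K') 3 (lmap phi)).

Lemma pgl_mapM g h : Phi (g * h)%g = (Phi g * Phi h)%g.
Proof.
elim/pgl_ind: g => g; elim/pgl_ind: h => h.
rewrite -(to_pglM g h) !pgl_mapE -(to_pglM (gl_map _ g)); congr to_pgl.
by apply: val_inj; rewrite /= map_mxM.
Qed.

Lemma pgl_map1 : Phi 1%g = 1%g.
Proof. by apply: (mulIg (Phi 1%g)); rewrite -pgl_mapM !mul1g. Qed.

Lemma pgl_mapV g : Phi g^-1%g = (Phi g)^-1%g.
Proof. by apply: (mulIg (Phi g)); rewrite -pgl_mapM !mulVg pgl_map1. Qed.

Lemma pgl_map_rep w : Phi (iw_rep K w) = iw_rep K' w.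
Proof.
have epsE : lmap phi (eps K) = eps K'.
  by apply: laurent_eq => n /=; rewrite /eps_coef; case: ifP; rewrite ?rmorph1 ?rmorph0.
rewrite pgl_mapE; congr to_pgl; apply: val_inj => /=.
apply/matrixP => i j; rewrite mxE !iw_mxE (rmorphM (lmap phi)) (rmorph_nat (lmap phi)).
by rewrite (fmorphXz (lmap phi)) -epsE.
Qed.

Lemma vanish_below_lmap n (f : laurent K) :
  vanish_below n (lmap phi f) <-> vanish_below n f.
Proof.
split=> fn m /fn /=; last by move=> ->; rewrite rmorph0.
by move/eqP; rewrite fmorph_eq0 => /eqP.
Qed.

Lemma valuation_lmap n (f : laurent K) : valuation (lmap phi f) n <-> valuation f n.
Proof.
by split=> -[/vanish_below_lmap fn f0]; split=> //; move: f0; rewrite /= fmorph_eq0.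
Qed.

Lemma iwahori_gl_map g : iwahori_gl (gl_map (lmap phi) g) <-> iwahori_gl g.
Proof.
split=> /iwahori_glP[gi dg]; apply/iwahori_glP; split.
- by move=> i j; have := gi i j; rewrite mxE => /vanish_below_lmap.
- by move: dg; rewrite det_map_mx => /valuation_lmap.
- by move=> i j; rewrite mxE; apply/vanish_below_lmap.
- by rewrite det_map_mx; apply/valuation_lmap.
Qed.

Lemma iwahori_map g : iwahori g -> iwahori (Phi g).
Proof.
by move=> [h hI <-]; exists (gl_map (lmap phi) h); [apply/iwahori_gl_map|rewrite pgl_mapE].
Qed.

Lemma pgl_map_root a : Phi (root_elt a) = root_elt (phi a).
Proof.
have cE : lmap phi (lconst a) = lconst (phi a).
  by apply: laurent_eq => n /=; rewrite /lconst_coef; case: ifP; rewrite ?rmorph0.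
rewrite /root_elt pgl_mapE; congr to_pgl; apply: val_inj => /=.
apply/matrixP => i j; rewrite mxE !root_mxE (rmorphD (lmap phi)) (rmorphM (lmap phi)).
by rewrite -cE !(rmorph_nat (lmap phi)).
Qed.

Lemma bruhat_cell_map w g : bruhat_cell (S := pgl_system K) w g ->
  bruhat_cell (S := pgl_system K') w (Phi g).
Proof.
move=> [i [j [iI jI ->]]]; exists (Phi i), (Phi j).
split; [exact: iwahori_map|exact: iwahori_map|].
have e : Phi (i * iw_rep K w * j)%g = (Phi i * iw_rep K' w * Phi j)%g.
  by rewrite (pgl_mapM (i * _)%g) (pgl_mapM i) pgl_map_rep.
exact: e.
Qed.

(** Cells map into cells of the same index, and these are disjoint over K'. This avoids descending
    the scalar of K'((eps)) by which a matrix of the Iwahori subgroup may differ from one defined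
    over K. *)
Lemma bruhat_cell_mapP w g : bruhat_cell (S := pgl_system K') w (Phi g) <->
  bruhat_cell (S := pgl_system K) w g.
Proof.
split=> [Dg|]; last exact: bruhat_cell_map.
have [x Dx] := @bruhat_decomposition _ (pgl_system K) g.
by rewrite -(bruhat_cell_inj (bruhat_cell_map Dx) Dg).
Qed.

Lemma iwahori_mapP g : iwahori (Phi g) <-> iwahori g.
Proof.
split=> [gI|]; last exact: iwahori_map.
apply/(@bruhat_cell1 _ (pgl_system K))/bruhat_cell_mapP.
exact/(@bruhat_cell1 _ (pgl_system K')).
Qed.

Lemma iwahori_map_surj g : (forall z : K', exists y, phi y = z) -> iwahori g ->
  exists2 h, iwahori h & Phi h = g.
Proof.
move=> surj [{}g gI <-].
have lsurj (f : laurent K') : exists f', lmap phi f' = f.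
  pose c n := projT1 (cid (surj (f n))).
  have cE n : phi (c n) = f n := projT2 (cid (surj (f n))).
  have cP : exists N : int, forall n, n < N -> c n = 0.
    have [N fN] := laurentP f; exists N => n /fN f0.
    by apply/eqP; rewrite -(fmorph_eq0 phi) cE f0.
  by exists (Laurent cP); apply: laurent_eq => n /=.
pose M : 'M[laurent K]_3 := \matrix_(i, j) projT1 (cid (lsurj (g i j))).
have ME : map_mx (lmap phi) M = g.
  by apply/matrixP => i j; rewrite !mxE; exact: projT2 (cid (lsurj (g i j))).
have MU : M \in unitmx by rewrite -(map_unitmx (lmap phi)) ME gl_unit.
have e : gl_map (lmap phi) (Gl MU) = g by apply: val_inj; exact: ME.
exists (to_pgl (Gl MU)); last by rewrite pgl_mapE e.
by exists (Gl MU) => //; apply/iwahori_gl_map; rewrite e.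
Qed.

End PGLMapTheory.

Lemma mulVg_cancel (G : groupType) (x g h : G) : ((x * g)^-1 * (x * h) = g^-1 * h)%g.
Proof. by rewrite invgM mulgA mulgKV. Qed.

Lemma mulgA_cancel (G : groupType) (x g h : G) : (x * g * (g^-1 * h) = x * h)%g.
Proof. by rewrite mulgA mulgK. Qed.

(** * Descent of sigma-fixed cosets *)

Section Rational.
Variables (Fq : finFieldType) (k : closedFieldType) (iota : {rmorphism Fq -> k}).
Local Notation PF := (pgl (laurent Fq) 3).
Local Notation PL := (pgl (laurent k) 3).
Local Notation SF := (pgl_system Fq).
Local Notation SL := (pgl_system k).
Local Notation ext := (@pgl_map (laurent Fq) (laurent k) 3 (lmap iota)).
Local Notation sig := (sigma iota).
Local Notation I := (@iwahori k).
Local Notation r := (@iw_rep k).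
Local Notation u := (@root_elt k).
Local Notation D := (@bruhat_cell k SL).

Lemma sigmaM g h : sig (g * h)%g = (sig g * sig h)%g. Proof. exact: pgl_mapM. Qed.
Lemma sigmaV g : sig g^-1%g = (sig g)^-1%g. Proof. exact: pgl_mapV. Qed.
Lemma sigma_rep w : sig (r w) = r w. Proof. exact: pgl_map_rep. Qed.
Lemma sigma_iwahori g : I g -> I (sig g). Proof. exact: iwahori_map. Qed.
Lemma sigma_cell w g : D w g -> D w (sig g). Proof. exact: bruhat_cell_map. Qed.

(** X^q - X has at most q roots, and the image of Fq already provides q of them. *)
Lemma frob_fixed (a : k) : frob iota a = a -> exists b, iota b = a.
Proof.
rewrite frobE => aq; apply: contrapT => /forallNP nb.
pose p : {poly k} := 'X^#|Fq| - 'X.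
have q1 : (1 < #|Fq|)%N := card_finNzRing_gt1 Fq.
have sp : size p = #|Fq|.+1.
  by rewrite size_polyDl ?size_polyXn // size_polyN size_polyX ltnS.
have p0 : p != 0 by rewrite -size_poly_eq0 sp.
have : all (root p) (a :: map iota (enum Fq)).
  rewrite /= rootE !hornerE aq subrr eqxx /=; apply/allP => _ /mapP[b _ ->].
  by rewrite rootE !hornerE -rmorphXn expf_card subrr.
move=> /(max_poly_roots p0) /(_ _); rewrite /= map_inj_uniq ?enum_uniq ?andbT; last first.
  exact: fmorph_inj.
rewrite size_map -cardE sp ltnn => H; apply: notF; apply: H.
by apply/mapP => -[b _ ab]; apply: (nb b).
Qed.

Lemma frob_surj (z : k) : exists y, frob iota y = z.
Proof.
have q1 : (1 < #|Fq|)%N := card_finNzRing_gt1 Fq.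
pose p : {poly k} := 'X^#|Fq| - z%:P.
have sp : size p = #|Fq|.+1.
  rewrite size_polyDl ?size_polyXn // size_polyN (leq_ltn_trans (size_polyC_leq1 z)) //.
  exact: ltnW.
have /closed_rootP[y] : size p != 1 by rewrite sp; case: #|Fq| q1 => [|[]].
by rewrite rootE !hornerE subr_eq0 => /eqP yz; exists y; rewrite frobE.
Qed.

Lemma lmap_frob_iota f : lmap (frob iota) (lmap iota f) = lmap iota f.
Proof. by apply: laurent_eq => n /=; rewrite frobE -rmorphXn expf_card. Qed.

Lemma sigma_ext g : sig (ext g) = ext g.
Proof.
elim/pgl_ind: g => g; rewrite /sigma (pgl_mapE (lmap iota)) pgl_mapE; congr to_pgl.
apply: val_inj; apply/matrixP => i j; rewrite !mxE; exact: lmap_frob_iota.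
Qed.

Definition has_rational_rep g := exists h : PF, I (g^-1 * ext h)%g.

Lemma has_rational_repM (x : PF) g :
  has_rational_rep g -> has_rational_rep (ext x * g)%g.
Proof.
move=> [h hI]; exists (x * h)%g; rewrite pgl_mapM.
by rewrite mulVg_cancel.
Qed.

Definition rational_cell w := forall g : PL, D w g -> I (g^-1 * sig g)%g -> has_rational_rep g.

Lemma sigma_translate (x : PF) g :
  ((ext x * g)^-1 * sig (ext x * g) = g^-1 * sig g)%g.
Proof.
by rewrite sigmaM sigma_ext mulVg_cancel.
Qed.

Lemma rational_cell_translate w (x : PF) g : rational_cell w ->
  D w ((ext x)^-1 * g)%g -> I (g^-1 * sig g)%g -> has_rational_rep g.
Proof.
move=> Qw xw gI; pose g' := ((ext x)^-1 * g)%g.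
have gg' : g = (ext x * g')%g by rewrite /g' mulVKg.
rewrite gg'; apply: has_rational_repM; apply: Qw; first exact: xw.
by rewrite -(sigma_translate x) -gg'.
Qed.

Lemma rational_cell_tau w : rational_cell w -> rational_cell (tau * w)%g.
Proof.
move=> Qw g Dg; apply: (@rational_cell_translate w (iw_rep Fq tau)) => //.
by rewrite pgl_map_rep; have := bruhat_cell_tauV Dg; rewrite mulKg.
Qed.

Lemma rational_cell_tauV w : rational_cell w -> rational_cell (tau^-1 * w)%g.
Proof.
move=> Qw g Dg; apply: (@rational_cell_translate w (iw_rep Fq tau^-1%g)) => //.
rewrite pgl_map_rep (iw_repV k tau) invgK.
by have := bruhat_cell_tau Dg; rewrite mulVKg.
Qed.

(* The first coordinate of a [sigma]-fixed coset in [I s1 w I / I] is unique,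
   hence fixed by Frobenius. *)
Lemma rational_cell_s1 w : rational_cell w -> rational_cell (s1 * w)%g.
Proof.
move=> Qw; have [aw|/ascent_s1 aw] := pselect (ascent w); last first.
  move=> g Dg gI; have ss : ext (iw_rep Fq s1) = r s1 := pgl_map_rep _ _.
  have Ds : D w (ext (iw_rep Fq s1) * g)%g.
    rewrite ss; have := bruhat_cell_s1 aw (bruhat_cell_rep SL s1) Dg.
    by rewrite mulgA s1_involution mul1g.
  have := Qw _ Ds; rewrite sigma_translate => /(_ gI).
  move=> /(has_rational_repM (iw_rep Fq s1)^-1%g); rewrite pgl_mapV.
  by move: (ext _) => e; rewrite mulKg.
move=> g Dg gI.
have [a Da] := panel_projection Dg.
have ua : sig (u a) = u (frob iota a) by exact: pgl_map_root.
have Da' : D w ((u (frob iota a) * r s1)^-1 * sig g)%g.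
  by have := sigma_cell Da; rewrite sigmaM sigmaV (sigmaM (u a)) ua sigma_rep.
have Da2 : D w ((u a * r s1)^-1 * sig g)%g.
  by have := @bruhat_cellIr _ SL _ _ _ gI Da; rewrite mulgA_cancel.
have [b ba] := frob_fixed (panel_projection_uniq aw Da' Da2).
apply: (@rational_cell_translate w (root_elt b * iw_rep Fq s1)%g) => //.
by rewrite pgl_mapM pgl_map_root pgl_map_rep ba.
Qed.

Lemma rational_cell_all w : rational_cell w.
Proof.
have [n /asboolP[v [m [_ vS ->]]]] := word_ex w.
elim: v vS => [|y v IH] vS.
  rewrite big_nil mul1g; elim: m => [|m IH]; last by rewrite expgS; exact: rational_cell_tau.
  rewrite expg0 => g /bruhat_cell1 gI _; exists 1%g; rewrite pgl_map1 mulg1; exact: iwahoriV.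
have vS' : {subset v <= [:: s0; s1; s2]} by move=> z zv; apply: vS; rewrite inE zv orbT.
rewrite big_cons -mulgA; move: (IH vS'); move: (_ * _)%g => x Qx.
have := vS y (mem_head _ _); rewrite !inE => /or3P[] /eqP ->.
- have -> : (s0 * x = tau^-1 * (s1 * (tau * x)))%g.
    have {1}-> : s0 = (tau^-1 * (s1 * tau))%g by rewrite -tau_s0 mulKg.
    by rewrite -(mulgA tau^-1%g) -(mulgA s1 tau x).
  by apply/rational_cell_tauV/rational_cell_s1/rational_cell_tau.
- exact: rational_cell_s1.
- have -> : (s2 * x = tau * (s1 * (tau^-1 * x)))%g.
    have {1}-> : s2 = (tau * (s1 * tau^-1))%g by rewrite mulgA tau_s1 mulgK.
    by rewrite -(mulgA tau (s1 * _)%g) -(mulgA s1 tau^-1%g x).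
  by apply/rational_cell_tau/rational_cell_s1/rational_cell_tauV.
Qed.

Lemma rational_representative g : I (g^-1 * sig g)%g -> exists h : PF, I (g^-1 * ext h)%g.
Proof. by have [w Dg] := @bruhat_decomposition _ SL g; exact: rational_cell_all Dg. Qed.

End Rational.

Lemma card_uniq_seq (T : eqType) (s : seq T) (A : set T) :
  uniq s -> (forall x, x \in s <-> A x) -> (A #= `I_(size s))%card.
Proof.
elim: s A => [|x s IH] A /=.
  move=> _ sA; rewrite II0 card_eq0; apply/eqP/seteqP; split=> y //= /sA.
  by rewrite in_nil.
move=> /andP[xs su] sA; apply/eq_cardSP; exists x; first by apply/sA; exact: mem_head.
apply: IH => // y; split=> [ys|[/sA + yx]].
  split; first by apply/sA; rewrite inE ys orbT.
  by move=> /= yx; rewrite -yx ys in xs.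
by rewrite inE => /predU1P[/yx|].
Qed.

Lemma conjg_transport (G : groupType) (g t s h : G) :
  ((g^-1 * h)^-1 * (g^-1 * t * s * (s^-1 * h)) = h^-1 * t * h)%g.
Proof. by rewrite mulgA_cancel invgM invgK !mulgA mulgK. Qed.

(** * Rational points as chambers over Fq((eps)) *)

Section RationalPoints.
Variables (Fq : finFieldType) (k : closedFieldType) (iota : {rmorphism Fq -> k}).
Local Notation PF := (pgl (laurent Fq) 3).
Local Notation PL := (pgl (laurent k) 3).
Local Notation SF := (pgl_system Fq).
Local Notation SL := (pgl_system k).
Local Notation ext := (@pgl_map (laurent Fq) (laurent k) 3 (lmap iota)).
Local Notation sig := (sigma iota).

Lemma iw_cosetE (g : PL) : iw_coset g = @chamber k SL g.
Proof.
apply/seteqP; split=> h; rewrite /chamber /=.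
  by case=> i iI <-; rewrite mulKg.
by move=> hI; exists (g^-1 * h)%g => //; rewrite mulVKg.
Qed.

Lemma iw_double_cosetE w (g : PL) : iw_double_coset (iw_rep k w) g <-> @bruhat_cell k SL w g.
Proof.
split=> [[i iI [j jI <-]]|[i [j [iI jI ->]]]]; first by exists i, j.
by exists i => //; exists j.
Qed.

Lemma iw_coset_ext (g h : PF) : iw_coset (ext g) = iw_coset (ext h) <->
  @chamber Fq SF g = @chamber Fq SF h.
Proof.
have e : ext (g^-1 * h)%g = ((ext g)^-1 * ext h)%g by rewrite pgl_mapM pgl_mapV.
rewrite !iw_cosetE; split=> [/(@chamberP _ SL)|/(@chamberP _ SF)] gh.
  by apply/(@chamberP _ SF)/(iwahori_mapP iota); rewrite e.
by apply/(@chamberP _ SL); have /(iwahori_mapP iota) := gh; rewrite e.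
Qed.

Lemma sigma_iw_coset_ext (g : PF) : (sig @` iw_coset (ext g))%classic = iw_coset (ext g).
Proof.
apply/seteqP; split=> h.
  move=> [_ [i iI <-] <-]; rewrite sigmaM sigma_ext; exists (sig i) => //.
  exact: sigma_iwahori.
move=> [i iI <-]; have [j jI ji] := iwahori_map_surj (frob_surj iota) iI.
by exists (ext g * j)%g; [exists j|rewrite sigmaM sigma_ext -ji].
Qed.

Lemma rational_pointsP w C : rational_points iota (adlv iota w (iw_rep k tau)) C <->
  exists2 g : PF, C = iw_coset (ext g) & @fiber Fq SF w (@chamber Fq SF g).
Proof.
have key (g : PF) : @fiber Fq SF w (@chamber Fq SF g) <->
    @bruhat_cell k SL w ((ext g)^-1 * iw_rep k tau * ext g)%g.
  have e : ext (g^-1 * iw_rep Fq tau * g)%g = ((ext g)^-1 * iw_rep k tau * ext g)%g.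
    by rewrite (pgl_mapM _ (_ * _)%g) (pgl_mapM _ g^-1%g) pgl_mapV pgl_map_rep.
  rewrite -e; split=> [/fiberP H|/bruhat_cell_mapP H]; last exact/fiberP.
  by apply/bruhat_cell_mapP; exact: H.
split=> [[[g -> /iw_double_cosetE Dg] Cs]|[g -> /key Dg]]; last first.
  split; last exact: sigma_iw_coset_ext.
  by exists (ext g) => //; apply/iw_double_cosetE; rewrite sigma_ext.
have gI : iwahori (g^-1 * sig g)%g.
  have : ((sig @` iw_coset g)%classic : set PL) (sig g).
    by exists g => //; exists 1%g; [exact: iwahori1|rewrite mulg1].
  by rewrite Cs => -[i iI <-]; rewrite mulKg.
have [h hI] := rational_representative gI; exists h.
  by rewrite !iw_cosetE; apply/(@chamberP _ SL).
apply/key.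
(* Within its coset, [g] may be replaced by the rational representative: g^-1 tau sigma(g) changes
   only by factors of I, and sigma fixes the new representative. *)
have shI : iwahori (sig g^-1 * ext h)%g.
  by have := sigma_iwahori iota hI; rewrite sigmaM sigma_ext.
have := @bruhat_cellIl _ SL _ _ _ (iwahoriV hI) (@bruhat_cellIr _ SL _ _ _ shI Dg).
rewrite sigmaV; congr (bruhat_cell _ _); move: (iw_rep k tau) (sig g) (ext h).
exact: conjg_transport.
Qed.

Lemma rational_points_card w n : @fiber_card Fq SF w n ->
  has_card (rational_points iota (adlv iota w (iw_rep k tau))) n%:Z.
Proof.
move=> [s [su sn sP]]; exists n => //.
pose rep (C : set PF) : PF := if pselect (exists g, C = @chamber Fq SF g) is left e
  then projT1 (cid e) else 1%g.
have repE g : @chamber Fq SF (rep (@chamber Fq SF g)) = @chamber Fq SF g.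
  rewrite /rep; case: pselect => [e|[]]; last by exists g.
  exact: esym (projT2 (cid e)).
pose f C := iw_coset (ext (rep C)).
rewrite -sn -(size_map f); apply: card_uniq_seq.
  rewrite map_inj_in_uniq // => C C' /sP[g -> _] /sP[g' -> _] /iw_coset_ext.
  by rewrite !repE.
move=> C; rewrite rational_pointsP; split=> [/mapP[E /sP Ew ->]|[g -> gw]].
  by have [g Eg _] := Ew; exists (rep E) => //; rewrite Eg repE -Eg.
apply/mapP; exists (@chamber Fq SF g); first exact/sP.
by apply/iw_coset_ext; rewrite repE.
Qed.

End RationalPoints.

(** * The conjugacy classes *)

Lemma root_latticeE m n : root_lattice m n = (2 * m - n, 2 * n - m).
Proof. by rewrite /root_lattice !coweightMz; congr pair; rewrite /= !mulrzz; lia. Qed.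

Lemma O_id_tauP w : O_id_tau w <->
  (exists p r t k : int, p + r + t = 3 * k /\ w = rotation p r t) \/
  (exists a b c k : int, a + b + c = 3 * k + 2 /\ w = rotationV a b c).
Proof.
split=> [[m [n [->|->]]]|[[p [r [t [k [prt ->]]]]]|[a [b [c [k [abc ->]]]]]]].
- left; exists (m + n), (2 * n - m), 0, n; split; first by lia.
  rewrite root_latticeE; iw_auto.
- right; exists (m + n), (2 * n - m + 1), 1, n; split; first by lia.
  rewrite root_latticeE; iw_auto.
- exists (2 * (k - t) - (r - t)), (k - t); left; rewrite root_latticeE; iw_auto.
- exists (2 * (k + 1 - c) - (b - c)), (k + 1 - c); right; rewrite root_latticeE; iw_auto.
Qed.

Definition reflection_conj (p r : int) w :=
  [\/ w = reflection p r, w = el (r + 1) 0 (p - 1) p02 | w = el 0 p r p12].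

(** On the three [tau]-conjugate shapes of a reflection, the index of the class is read off p +
    r. *)
Lemma O_tauP i w : O_tau i w <->
  exists p r : int, p + r = 3 * i - 2 /\ reflection_conj p r w.
Proof.
split=> [[k [->|->|->]]|[p [r [pr [->|->|->]]]]].
- exists (i + k - 1), (2 * i - k - 1); split; first by lia.
  apply: Or31; rewrite root_latticeE; iw_auto.
- exists (i - k), (k + 2 * i - 2); split; first by lia.
  apply: Or32; rewrite root_latticeE; iw_auto.
- exists (2 * i + k - 1), (i - k - 1); split; first by lia.
  apply: Or33; rewrite root_latticeE; iw_auto.
- exists (p - i + 1); apply: Or31; rewrite root_latticeE; iw_auto.
- exists (i - p); apply: Or32; rewrite root_latticeE; iw_auto.
- exists (p - 2 * i + 1); apply: Or33; rewrite root_latticeE; iw_auto.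
Qed.

Lemma iw_length_rotation p r t :
  iw_length (rotation p r t) = (`|p - r| + `|r - t| + `|p - t|)%N.
Proof.
have [c0 c1 c2] := cycle3E.
rewrite iw_lengthE /alcove_length /root_length /= c0 c1 c2 /=.
by congr (_ + _ + _)%N; congr absz; lia.
Qed.

Lemma iw_length_rotationV a b c :
  iw_length (rotationV a b c) = (`|a - b| + `|b - c| + `|a - c|)%N.
Proof.
have [c0 c1 c2] := cycle3VE.
rewrite iw_lengthE /alcove_length /root_length /= c0 c1 c2 /=.
by congr (_ + _ + _)%N; congr absz; lia.
Qed.

Lemma iw_length_reflection p r w : reflection_conj p r w ->
  iw_length w = (absz (p - r - 1)%R + absz r + absz p)%N.
Proof.
by rewrite iw_lengthE /alcove_length /root_length;
  case=> ->; rewrite /= !permE /=; lia.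
Qed.

Lemma spread_exists (p r t : int) : exists x m,
  spread x m p r t /\ (`|p - r| + `|r - t| + `|p - t|)%N = (m * 2)%N.
Proof.
rewrite /spread.
case: (lerP p r) => pr; case: (lerP r t) => rt; case: (lerP p t) => pt.
all: first [exists p, `|t - p|%N; lia | exists p, `|r - p|%N; lia | exists t, `|r - t|%N; lia
  | exists r, `|t - r|%N; lia | exists r, `|p - r|%N; lia | exists t, `|p - t|%N; lia].
Qed.

Section ReflectionCases.
Variable Fq : finFieldType.
Local Notation q := #|Fq|.
Local Notation card w n := (@fiber_card Fq (pgl_system Fq) w n).

Lemma fiber_card_reflection_conj p r w n : reflection_conj p r w ->
  card (reflection p r) n -> card w n.
Proof.
case=> -> // cn.
  by apply/(@fiber_card_rot _ (pgl_system Fq) _ _ _ (reflection_rot p r)).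
by apply/(@fiber_card_rot _ (pgl_system Fq) _ _ _ (reflection_rotV p r)).
Qed.

(** Opposite signs give the two families of [reflection_count] and equal signs an empty fiber, where
    0 counts as negative for p and as positive for r. *)
Lemma reflection_cases (p r k : int) w : p + r = 3 * k + 1 -> reflection_conj p r w ->
  [\/ exists a b : nat, [/\ p = a.+1, r = - b.+1%:Z, iw_length w = (2 * (a + b) + 3)%N
        & card w (3 * (minn a b).+1 * q ^ (a + b).+1 * (q - 1))%N],
      exists a b : nat, [/\ p = - a%:Z, r = b, iw_length w = (2 * (a + b) + 1)%N
        & card w (3 * minn a b * q ^ (a + b) * (q - 1))%N]
    | (0 < p /\ 0 <= r \/ p <= 0 /\ r < 0) /\ card w 0].
Proof.
move=> pr wpr; have lw := iw_length_reflection wpr.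
have [h|[h|h]] : (0 < p /\ r < 0) \/ (p <= 0 /\ 0 <= r) \/
    (0 < p /\ 0 <= r \/ p <= 0 /\ r < 0) by lia.
- apply: Or31; exists (`|p|.-1)%N, (`|r|.-1)%N.
  have [ep er] : p = (`|p|.-1)%N.+1 /\ r = - (`|r|.-1)%N.+1%:Z by lia.
  split; [by []|by []|lia|].
  apply: (fiber_card_reflection_conj wpr); rewrite {1}ep {1}er.
  have [H _] := reflection_count Fq (minn `|p|.-1 `|r|.-1); apply: (H _ _ k) => //; lia.
- apply: Or32; exists `|p|%N, `|r|%N.
  have [ep er] : p = - `|p|%N%:Z /\ r = `|r|%N by lia.
  split; [by []|by []|lia|].
  apply: (fiber_card_reflection_conj wpr); rewrite {1}ep {1}er.
  have [_ H] := reflection_count Fq (minn `|p| `|r|); apply: (H _ _ k) => //; lia.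
- apply: Or33; split=> //; apply: (fiber_card_reflection_conj wpr).
  exact: reflection_empty.
Qed.

End ReflectionCases.

Lemma ceil_quarter (z n : int) : 4 * (n - 1) < z -> z <= 4 * n ->
  Num.ceil (z%:~R / 4 : rat) = n.
Proof.
move=> nz zn; apply/eqP; rewrite ceil_eq; apply/andP; split.
  by rewrite ltr_pdivlMr // -[4]/(4%:~R) -intrM ltr_int; lia.
by rewrite ler_pdivrMr // -[4]/(4%:~R) -intrM ler_int; lia.
Qed.

Lemma has_card_cast (T : Type) (A : set T) (c m : nat) (q : nat) (z : int) : (0 < q)%N ->
  z = c -> has_card A (3 * c * q ^ m * (q - 1))%N%:Z ->
  has_card A (3 * z * q%:Z ^+ m * (q%:Z - 1)).
Proof.
move=> q0 ->; congr has_card; rewrite !PoszM -subzn //.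
by congr (_ * _ * _); rewrite -natz natrX natz.
Qed.

Theorem corollary3p10 (Fq : finFieldType) (k : closedFieldType)
    (iota : {rmorphism Fq -> k}) (k_alg : forall z : k, algebraicOver iota z)
    (w : iwahori_weyl) :
  let q : int := #|Fq|%:Z in
  let l : nat := iw_length w in
  let X := rational_points iota (adlv iota w (iw_rep k tau)) in
  [/\ O_id_tau w -> has_card X (3 * q ^+ (l %/ 2)%N),
      forall i : nat, (0 < i)%N -> O_tau i%:Z w -> 6 * i%:Z - 1 <= l%:Z ->
        has_card X (3 * Num.ceil ((l%:R - 6 * i%:R + 3) / 4 : rat)
                      * q ^+ ((l - 1) %/ 2)%N * (q - 1)),
      forall i : nat, (0 < i)%N -> O_tau (1 - i%:Z) w -> 6 * i%:Z + 1 <= l%:Z ->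
        has_card X (3 * Num.ceil ((l%:R - 6 * i%:R + 1) / 4 : rat)
                      * q ^+ ((l - 1) %/ 2)%N * (q - 1))
    & ~ O_id_tau w ->
      ~ (exists i : nat, [/\ (0 < i)%N, O_tau i%:Z w & 6 * i%:Z - 1 <= l%:Z]) ->
      ~ (exists i : nat,
           [/\ (0 < i)%N, O_tau (1 - i%:Z) w & 6 * i%:Z + 1 <= l%:Z]) ->
      has_card X 0].
Proof.
move=> q l X; rewrite /q {q}.
have q0 : (0 < #|Fq|)%N by exact: ltnW (card_finNzRing_gt1 Fq).
have X_card n : @fiber_card Fq (pgl_system Fq) w n -> has_card X n%:Z.
  exact: rational_points_card.
have castR (i c : nat) : l%:R - 6 * i%:R + c%:R = (l%:Z - 6 * i%:Z + c%:Z)%:~R :> rat.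
  by rewrite !rmorphD rmorphN rmorphM /=.
split.
- have card3 m : (iw_length w = m * 2)%N -> @fiber_card Fq (pgl_system Fq) w (3 * #|Fq| ^ m)%N ->
      has_card X (3 * #|Fq|%:Z ^+ (l %/ 2)%N).
    move=> lm /X_card; rewrite /l lm mulnK // PoszM; congr (has_card _ (_ * _)).
    by rewrite -natz natrX natz.
  move=> /O_id_tauP[[p [r [t [n [prt e]]]]]|[p [r [t [n [prt e]]]]]].
    have [x [m [sp lm]]] := spread_exists p r t; have [H _] := rotation_count Fq m.
    by apply: (card3 m); rewrite e ?iw_length_rotation //; exact: H prt sp.
  have [x [m [sp lm]]] := spread_exists p r t; have [_ H] := rotation_count Fq m.
  by apply: (card3 m); rewrite e ?iw_length_rotationV //; exact: H prt sp.
- move=> i i0 /O_tauP[p [r [pri wpr]]] il.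
  have pr : p + r = 3 * (i%:Z - 1) + 1 by lia.
  rewrite -[3 in X in X / 4]/(3%:R) castR.
  have lw : l = (absz (p - r - 1)%R + absz r + absz p)%N := iw_length_reflection wpr.
  (* As p + r = 3i - 2, the minimum is b in the first family, with l = 4b + 6i - 1 and ceiling b +
     1, and a in the second, with l = 4a + 6i - 3 and ceiling a. Equal signs would give l <= 6i -
     5. *)
  have [[a [b [pa rb la /X_card ca]]]|[a [b [pa rb la /X_card ca]]]|[h _]] := reflection_cases Fq pr wpr.
  + rewrite (_ : ((l - 1) %/ 2 = (a + b).+1)%N); last by rewrite /l la; lia.
    by apply: has_card_cast ca => //; apply: ceil_quarter; rewrite /l la; lia.
  + rewrite (_ : ((l - 1) %/ 2 = (a + b))%N); last by rewrite /l la; lia.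
    by apply: has_card_cast ca => //; apply: ceil_quarter; rewrite /l la; lia.
  + by lia.
- move=> i i0 /O_tauP[p [r [pri wpr]]] il.
  have pr : p + r = 3 * (- i%:Z) + 1 by lia.
  rewrite -[1 in X in X / 4]/(1%:R) castR.
  have lw : l = (absz (p - r - 1)%R + absz r + absz p)%N := iw_length_reflection wpr.
  (* As p + r = 1 - 3i, the minimum is now a in the first family, with l = 4a + 6i + 1 and ceiling a
     + 1, and b in the second, with l = 4b + 6i - 1 and ceiling b. Equal signs would give l <= 6i -
     3. *)
  have [[a [b [pa rb la /X_card ca]]]|[a [b [pa rb la /X_card ca]]]|[h _]] := reflection_cases Fq pr wpr.
  + rewrite (_ : ((l - 1) %/ 2 = (a + b).+1)%N); last by rewrite /l la; lia.
    by apply: has_card_cast ca => //; apply: ceil_quarter; rewrite /l la; lia.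
  + rewrite (_ : ((l - 1) %/ 2 = (a + b))%N); last by rewrite /l la; lia.
    by apply: has_card_cast ca => //; apply: ceil_quarter; rewrite /l la; lia.
  + by lia.
move=> nid npos nneg; apply: X_card.
have refl (p r n : int) : p + r = 3 * n + 1 -> reflection_conj p r w ->
    @fiber_card Fq (pgl_system Fq) w 0.
  move=> pr wpr; have wO : O_tau (n + 1) w by apply/O_tauP; exists p, r; split=> //; lia.
  (* The class has index n + 1, that is i or 1 - i with i positive. Below the bound on the length,
     only an empty fiber or the second family with minimum 0 is possible. *)
  have [n0|n0] := leP 0 n.
    have nl : ~ (6 * (n + 1) - 1 <= l%:Z).
      move=> nl; apply: npos; exists (absz (n + 1)%R).
      have e : (absz (n + 1)%R)%:Z = n + 1 by lia.
      by split; rewrite ?e //; lia.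
    have [[a [b [pa rb la ca]]]|[a [b [pa rb la ca]]]|[_ //]] := reflection_cases Fq pr wpr.
      by lia.
    suff ab0 : minn a b = 0 by rewrite ab0 muln0 !mul0n in ca.
    by lia.
  have nl : ~ (6 * (- n) + 1 <= l%:Z).
    move=> nl; apply: nneg; exists `|n|%N.
    have e : `|n|%N%:Z = - n by lia.
    split; rewrite ?e //; first by lia.
    by have -> : 1 - - n = n + 1 by lia.
  have [[a [b [pa rb la ca]]]|[a [b [pa rb la ca]]]|[_ //]] := reflection_cases Fq pr wpr.
    by lia.
  suff ab0 : minn a b = 0 by rewrite ab0 muln0 !mul0n in ca.
  by lia.
(* Outside the coset of [tau] modulo W_a the determinant is the obstruction; inside it, the linear
   part of [w] decides. *)
have [[n wn]|/forallNP wn] := pselect (exists n : int, kottwitz w = 1 + n *+ 3); last first.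
  by apply: fiber_card_kottwitz => n; apply/eqP; exact: wn.
clear castR npos nneg X l; case: w nid wn refl => [[a b] v] nid.
rewrite /kottwitz /= => wn refl.
have wE c0 c1 c2 : a = c0 - c1 -> b = c1 - c2 -> IwahoriWeyl (a, b) v = el c0 c1 c2 v.
  by move=> -> ->.
move: v wE nid refl; apply: perm3P => wE nid refl.
- by rewrite (wE (a + b) b 0); [apply: (@fiber_card_translation _ _ _ _ n)| |]; lia.
- by apply: (refl (a + b) b n); [lia|apply: Or31; apply: wE; lia].
- by apply: (refl (- a) (- (a + b)) (n - a - b)); [lia|apply: Or33; apply: wE; lia].
- by apply: (refl (1 - b) (a - 1) (n - b)); [lia|apply: Or32; apply: wE; lia].
- case: nid; apply/O_id_tauP; left; exists (a + b - 1), b, 0, n; split; first by lia.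
  by apply: wE; lia.
- case: nid; apply/O_id_tauP; right; exists (a + b), b, 1, n; split; first by lia.
  by apply: wE; lia.
Qed.
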